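(* Let $p$ be an odd prime and let $\mathfrak R$ be a set of representatives of the orbits of $\mathfrak g=\mathrm{GL}(2,\mathbb F_p)$ acting on $\tilde{\mathfrak F}(\mathbb F_p)$. Then every nilpotent Chernikov $p$-group whose top is an elementary abelian $p$-group and whose bottom is $M^{(2)}$ (a direct sum of two quasi-cyclic $p$-groups) is isomorphic to $G(\rho)=G(\tilde{\mathfrak A}^\rho)$ for a uniquely determined $\rho\in\mathfrak R$.
   Context: A Chernikov $p$-group is an extension of a finite direct sum of quasi-cyclic $p$-groups (bottom) by a finite $p$-group (top). Fix generators $a_1,a_2$ of $\{a\in M^{(2)}:pa=0\}\cong\mathbb F_p^2$. For a pair $\mathbf A=(A_1,A_2)$ of $m\times m$ skew-symmetric matrices over $\mathbb F_p$, $A_k=(t^{(k)}_{ij})$, $G(\mathbf A)$ is the additively written group generated by $M^{(2)}$ and $\bar h_1,\dots,\bar h_m$ with relations $\bar h_i+a=a+\bar h_i$ ($a\in M^{(2)}$), $p\bar h_i=0$, $[\bar h_i,\bar h_j]=t^{(1)}_{ij}a_1+t^{(2)}_{ij}a_2$, where $[u,v]=u+v-u-v$. Direct sums of pairs are blockwise. For a pair $R=(R_1,R_2)$ of $r\times s$ matrices, $R^+=\left(\begin{pmatrix}0&R_i\\-R_i^\top&0\end{pmatrix}\right)_{i=1,2}$. Pairs: $R_f=(I_d,F(f))$ for $f\in\mathbb F_p[x]$ monic of degree $d$, $F(f)$ its companion matrix; $R_{\infty,d}=(F(x^d),I_d)$; $R_{-,d}=((I_{d-1}\mid0),(0\mid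 I_{d-1}))$ ($(d-1)\times d$ matrices). $\mathcal P$ is the set of irreducible homogeneous polynomials $g\in\mathbb F_p[x_1,x_2]$ that are unital ($g=x_2$ or leading coefficient in $x_1$ equal to $1$), $\tilde{\mathcal P}=\mathcal P\cup\{\varepsilon\}$. For $Q=(q_{ij})\in\mathfrak g$ and $g\in\mathcal P$, $Q*g$ is the unique $g'\in\mathcal P$ with $g(q_{11}x_1+q_{12}x_2,q_{21}x_1+q_{22}x_2)=\lambda g'$, $\lambda\ne0$; $Q*\varepsilon=\varepsilon$. $\tilde{\mathfrak F}(\mathbb F_p)$ is the set of finitely supported functions $\rho:\tilde{\mathcal P}\times\mathbb N\to\mathbb Z_{\ge0}$, with $\mathfrak g$-action $(\rho*Q)(g,d)=\rho(Q*g,d)$. $R(g,d)=R^+_{-,d}$ if $g=\varepsilon$, $R^+_{\infty,d}$ if $g=x_2$, $R^+_{g(x,1)^d}$ otherwise, and $\tilde{\mathfrak A}^\rho=\bigoplus_{(g,d)}R(g,d)^{\rho(g,d)}$. *)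

(* Defs.v *)
From HB Require Import structures.
From mathcomp Require Import all_boot all_order all_algebra.
Set Implicit Arguments. Unset Strict Implicit. Unset Printing Implicit Defensive.
Import Order.TTheory GRing.Theory Num.Theory.
Local Open Scope ring_scope.

Record Grp := MkGrp {
  gcar :> Type;
  gmul : gcar -> gcar -> gcar;
  ginv : gcar -> gcar;
  gone : gcar;
  gmulA : forall x y z, gmul x (gmul y z) = gmul (gmul x y) z;
  gmul1 : forall x, gmul gone x = x;
  gmulV : forall x, gmul (ginv x) x = gone }.

Section GroupNotions.
Variable G : Grp.

Definition gexp (x : G) (n : nat) : G := iter n (gmul x) (gone G).
Definition gcomm (x y : G) : G :=
  gmul (gmul (gmul (ginv x) (ginv y)) x) y.

Definition is_subgroup (H : G -> Prop) : Prop :=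
  [/\ H (gone G), forall x y, H x -> H y -> H (gmul x y)
    & forall x, H x -> H (ginv x)].

Definition is_normal (H : G -> Prop) : Prop :=
  is_subgroup H /\ forall x y, H y -> H (gmul (gmul (ginv x) y) x).

Definition gen (S : G -> Prop) : G -> Prop :=
  fun x => forall H, is_subgroup H -> (forall y, S y -> H y) -> H x.

Fixpoint lcs (n : nat) : G -> Prop :=
  match n with
  | 0 => fun _ => True
  | n'.+1 => gen (fun z => exists x y, lcs n' x /\ z = gcomm x y)
  end.

Definition grp_nilpotent : Prop := exists c, forall x, lcs c x -> x = gone G.

(* T / K with T described by a carrier T, a domain predicate D and an
   operation op; [quot_iso D op K S] says that D (with op) modulo K is
   isomorphic to the subgroup S of G (first isomorphism theorem form). *)
Definition quot_iso (T : Type) (D : T -> Prop) (op : T -> T -> T)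
    (K : T -> Prop) (S : G -> Prop) : Prop :=
  exists f : T -> G,
    [/\ forall x y, D x -> D y -> f (op x y) = gmul (f x) (f y),
        forall x, D x -> (f x = gone G <-> K x)
      & forall g, S g <-> exists x, D x /\ f x = g].

End GroupNotions.

(* The quasi-cyclic p-group Z(p^oo) = Z[1/p]/Z and M^(2) = Z(p^oo)^2.  *)
Definition pden (p : nat) (q : rat) : bool := p.-nat (absz (denq q)).
Definition ratint (q : rat) : bool := denq q == 1.

Definition M2_dom (p : nat) (a : rat * rat) : Prop := pden p a.1 && pden p a.2.
Definition M2_op (a b : rat * rat) : rat * rat := (a.1 + b.1, a.2 + b.2).
Definition M2_ker (a : rat * rat) : Prop := ratint a.1 && ratint a.2.

Definition chernikov_M2_elab (p : nat) (G : Grp) : Prop :=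
  exists B : G -> Prop,
    [/\ is_normal B,
        quot_iso (@M2_dom p) M2_op M2_ker B,
        (exists (n : nat) (t : nat -> G),
            forall x, exists i, (i < n)%N /\ B (gmul (ginv (t i)) x)),
        (forall x y, B (gcomm x y))
      & (* ... of exponent p *) forall x, B (gexp x p)].

(* Pairs of square matrices, as entry functions with a size.           *)
Record MP (F : Type) := MkMP { msz : nat; mA : nat -> nat -> F; mB : nat -> nat -> F }.

Section Matrices.
Variable F : fieldType.

Definition dsumf (a : nat) (A B : nat -> nat -> F) : nat -> nat -> F :=
  fun i j => if (i < a)%N && (j < a)%N then A i j
             else if (a <= i)%N && (a <= j)%N then B (i - a)%N (j - a)%N else 0.
Definition dsum (X Y : MP F) : MP F :=
  MkMP (msz X + msz Y) (dsumf (msz X) (mA X) (mA Y)) (dsumf (msz X) (mB X) (mB Y)).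
Definition dsum0 : MP F := MkMP 0 (fun _ _ => 0) (fun _ _ => 0).

(* R^+ for an r x s matrix R : ( 0  R ; -R^T 0 ) *)
Definition plusf (r s : nat) (R : nat -> nat -> F) : nat -> nat -> F :=
  fun i j =>
    if (i < r)%N && (r <= j)%N && (j < r + s)%N then R i (j - r)%N
    else if (r <= i)%N && (i < r + s)%N && (j < r)%N then - R j (i - r)%N
    else 0.
Definition mkPlus (r s : nat) (R1 R2 : nat -> nat -> F) : MP F :=
  MkMP (r + s) (plusf r s R1) (plusf r s R2).

Definition idf : nat -> nat -> F := fun i j => (i == j)%:R.
Definition companion (f : {poly F}) (n : nat) : nat -> nat -> F :=
  fun i j => (i == j.+1)%:R - (j == n.-1)%:R * f`_i.
(* (I_{d-1} | 0) and (0 | I_{d-1}) *)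
Definition Rm1 : nat -> nat -> F := fun i j => (i == j)%:R.
Definition Rm2 : nat -> nat -> F := fun i j => (j == i.+1)%:R.

(* Homogeneous polynomials in F[x1,x2], represented in {poly {poly F}}: *)
(* the outer variable is x1, the inner one (coefficients) is x2.        *)
Definition X1 : {poly {poly F}} := 'X.
Definition X2 : {poly {poly F}} := ('X)%:P.
Definition cst (c : F) : {poly {poly F}} := (c%:P)%:P.

Definition bihomogeneous (g : {poly {poly F}}) : Prop :=
  exists d, forall i j, (g`_i)`_j != 0 -> (i + j)%N = d.
Definition ring_irreducible (g : {poly {poly F}}) : Prop :=
  [/\ g != 0, ~~ (g \is a GRing.unit)
    & forall a b, g = a * b -> a \is a GRing.unit \/ b \is a GRing.unit].
Definition unital (g : {poly {poly F}}) : Prop := g = X2 \/ lead_coef g = 1.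

Definition inP (g : {poly {poly F}}) : Prop :=
  [/\ ring_irreducible g, bihomogeneous g & unital g].

Definition subst2 (Q : 'M[F]_2) (g : {poly {poly F}}) : {poly {poly F}} :=
  let L1 := cst (Q 0 0) * X1 + cst (Q 0 1) * X2 in
  let L2 := cst (Q 1 0) * X1 + cst (Q 1 1) * X2 in
  \sum_(i < size g) \sum_(j < size (g`_i)) cst ((g`_i)`_j) * L1 ^+ i * L2 ^+ j.

Definition actP (Q : 'M[F]_2) (g g' : {poly {poly F}}) : Prop :=
  inP g' /\ exists lam : F, lam != 0 /\ subst2 Q g = cst lam * g'.

Definition dehom (g : {poly {poly F}}) : {poly F} := map_poly (fun q => q.[1]) g.

(* Ptilde = option {poly {poly F}}, None standing for epsilon *)
Definition Fun := option {poly {poly F}} -> nat -> nat.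

(* the set \tilde{F}(F): finitely supported functions on Ptilde x N,
   N = {1,2,...} *)
Definition inFtilde (rho : Fun) : Prop :=
  [/\ exists s : seq (option {poly {poly F}} * nat),
        forall k d, rho k d != 0%N -> (k, d) \in s,
      forall g d, rho (Some g) d != 0%N -> inP g
    & forall k, rho k 0 = 0%N].

Definition act_rel (Q : 'M[F]_2) (rho rho' : Fun) : Prop :=
  [/\ forall d, rho' None d = rho None d,
      forall g g', inP g -> actP Q g g' -> forall d, rho' (Some g) d = rho (Some g') d
    & forall g d, ~ inP g -> rho' (Some g) d = 0%N].

Definition same_orbit (rho rho' : Fun) : Prop :=
  exists Q : 'M[F]_2, Q \in unitmx /\ act_rel Q rho rho'.

Definition orbit_reps (Rep : Fun -> Prop) : Prop :=
  [/\ forall rho, Rep rho -> inFtilde rho,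
      forall rho, inFtilde rho -> exists rho', Rep rho' /\ same_orbit rho rho'
    & forall rho rho', Rep rho -> Rep rho' -> same_orbit rho rho' -> rho = rho'].

Definition Rblock (k : option {poly {poly F}}) (d : nat) : MP F :=
  match k with
  | None => mkPlus d.-1 d Rm1 Rm2
  | Some g =>
      if g == X2 then mkPlus d d (companion 'X^d d) idf
      else let f := dehom g ^+ d in
           mkPlus (size f).-1 (size f).-1 idf (companion f (size f).-1)
  end.

Definition Ablocks (s : seq (option {poly {poly F}} * nat)) : MP F :=
  foldr (fun kd acc => dsum (Rblock kd.1 kd.2) acc) dsum0 s.

End Matrices.

(* The group G(A) for a pair A of skew-symmetric matrices over F_p.    *)
(* Concrete model: carrier M^(2) x F_p^n with the cocycle              *)
(*   (a,v)(b,w) = (a + b + beta(v,w), v + w),                            *)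
(*   beta(v,w) = 1/2 (v A1 w^T) a1 + 1/2 (v A2 w^T) a2,                 *)
(* with a1 = (1/p, 0), a2 = (0, 1/p) in M^(2) = (Z[1/p]/Z)^2.           *)
Unset Implicit Arguments.

Definition bilin {F : fieldType} {n : nat} (A : nat -> nat -> F) (v w : 'rV[F]_n) : F :=
  \sum_(i < n) \sum_(j < n) v 0 i * A i j * w 0 j.

Definition Fp_to_rat (p : nat) (c : 'F_p) : rat := (nat_of_ord c)%:R / p%:R.

Definition GA_car (p : nat) (M : MP 'F_p) : Type := ((rat * rat) * 'rV['F_p]_(msz M))%type.

Definition GA_op (p : nat) (M : MP 'F_p) (x y : GA_car p M) : GA_car p M :=
  let b1 := 2%:R^-1 * bilin (mA M) x.2 y.2 in
  let b2 := 2%:R^-1 * bilin (mB M) x.2 y.2 in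
  ((x.1.1 + y.1.1 + Fp_to_rat p b1, x.1.2 + y.1.2 + Fp_to_rat p b2), x.2 + y.2).

Definition GA_dom (p : nat) (M : MP 'F_p) (x : GA_car p M) : Prop := M2_dom p x.1.
Definition GA_ker (p : nat) (M : MP 'F_p) (x : GA_car p M) : Prop :=
  M2_ker x.1 /\ x.2 = 0.

Definition iso_GA (p : nat) (M : MP 'F_p) (G : Grp) : Prop :=
  quot_iso (@GA_dom p M) (@GA_op p M) (@GA_ker p M) (fun _ : G => True).

Definition iso_Grho (p : nat) (rho : Fun 'F_p) (G : Grp) : Prop :=
  exists s : seq (option {poly {poly 'F_p}} * nat),
    (forall k d, count_mem (k, d) s = rho k d) /\ iso_GA p (Ablocks s) G.

(* Main.v *)
(** Linear algebra. A pair [(A, B)] of skew-symmetric matrices is split one block [R^+] at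
    a time. If the pencil is singular, a polynomial null vector of minimal degree spans,
    with a dual sequence, an epsilon-block. If it is regular and [A] is singular, a
    maximal chain [v_i A = v_(i+1) B] gives an infinite block; if [A] is invertible, a
    vector generating a maximal primary cyclic module of [T = B A^-1] gives a finite one.
    The spaces involved are isotropic because a Hankel matrix that is skew-symmetric
    vanishes in odd characteristic. Conversely the numbers of solutions [Y] of
    [A Y X1 = B Y X2], for test pencils [(X1, X2)] running over the blocks, determine
    the multiplicities of the blocks. A substitution [Q] in the variables changes the
    pencil to the linear combination of its matrices with coefficients [Q], and the
    block of [g'] to that of [g] when [Q * g = g'].

    Groups. Nilpotency forces the divisible bottom to be central, so that commutators lie
    in its [p]-torsion and Baer's trick gives an abelian group with the same powers; the
    bottom, being divisible, has in that group a complement of exponent [p], and the commutators on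
    this complement are a pair of skew forms. The group determines the bottom as the set
    of [p]-th powers, hence the pair up to congruence and up to the action of [GL(2, F_p)]
    on the [p]-torsion of the bottom; every element of [GL(2, F_p)] is induced by an
    automorphism of the bottom. *)
Require Import Defs.
From HB Require Import structures.
From mathcomp Require Import all_boot all_order all_algebra.
From mathcomp Require Import boolp ring zify.
Set Implicit Arguments. Unset Strict Implicit. Unset Printing Implicit Defensive.
Import Order.TTheory GRing.Theory Num.Theory.
Local Open Scope ring_scope.

(** * Congruence of pairs and orthogonal splittings *)

Section PairCongruence.
Variable F : fieldType.

(** Two difficulties shape the proof. On the matrix side, multiplicities of blocks must be recovered
    from a mere congruence. Instead of a Krull-Schmidt argument, solutions of a linear matrix
    equation are counted over the finite field: the counts are multiplicative over blockwise sums,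
    so their logarithms are additive in the multiplicities, and second differences along a family of
    test pencils single out one block. On the group side, [G(A)] is given only by representatives in
    [rat * rat], and the section of the quotient by the bottom is not a homomorphism. An isomorphism
    is therefore split into a map [phi] on representatives and a section [tau], and additivity of
    representatives of the torsion holds only modulo integers. The generators of the [p]-torsion are
    not canonical: changing them mixes the two forms linearly, which relabels the blocks through
    substitution in binary forms, and this is where the orbits come from. The sizes of congruent
    matrices are equal only provably, so a congruence carries a rectangular matrix together with its
    inverse. *)

Definition pcong n n' (A B : 'M[F]_n) (A' B' : 'M[F]_n') : Prop :=
  exists (S : 'M[F]_(n', n)) (T : 'M[F]_(n, n')),
    [/\ S *m T = 1%:M, T *m S = 1%:M,
        S *m A *m S^T = A' & S *m B *m S^T = B'].

Lemma pcong_refl n (A B : 'M[F]_n) : pcong A B A B.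
Proof. by exists 1%:M, 1%:M; split; rewrite ?trmx1 ?mul1mx ?mulmx1. Qed.

Lemma pcong_trans n1 n2 n3 (A1 B1 : 'M[F]_n1) (A2 B2 : 'M[F]_n2) (A3 B3 : 'M[F]_n3) :
  pcong A1 B1 A2 B2 -> pcong A2 B2 A3 B3 -> pcong A1 B1 A3 B3.
Proof.
move=> [S [T [ST TS <- <-]]] [S' [T' [ST' TS' <- <-]]].
exists (S' *m S), (T *m T'); split.
- by rewrite mulmxA -(mulmxA S') ST mulmx1.
- by rewrite mulmxA -(mulmxA T) TS' mulmx1.
- by rewrite trmx_mul !mulmxA.
- by rewrite trmx_mul !mulmxA.
Qed.

Lemma pcong_comb n n' (A B : 'M[F]_n) (A' B' : 'M[F]_n') a b c d :
  pcong A B A' B' ->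
  pcong (a *: A + b *: B) (c *: A + d *: B) (a *: A' + b *: B') (c *: A' + d *: B').
Proof.
move=> [S [T [ST TS <- <-]]]; exists S, T; split => //.
- by rewrite mulmxDr mulmxDl -!scalemxAr -!scalemxAl.
- by rewrite mulmxDr mulmxDl -!scalemxAr -!scalemxAl.
Qed.

Lemma pcong_dsum n1 n2 m1 m2 (A1 B1 : 'M[F]_n1) (A2 B2 : 'M[F]_n2)
    (A1' B1' : 'M[F]_m1) (A2' B2' : 'M[F]_m2) :
  pcong A1 B1 A1' B1' -> pcong A2 B2 A2' B2' ->
  pcong (block_mx A1 0 0 A2) (block_mx B1 0 0 B2)
        (block_mx A1' 0 0 A2') (block_mx B1' 0 0 B2').
Proof.
move=> [S [T [ST TS <- <-]]] [S' [T' [ST' TS' <- <-]]].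
exists (block_mx S 0 0 S'), (block_mx T 0 0 T').
rewrite tr_block_mx !trmx0 !mulmx_block !(mulmx0, mul0mx, addr0, add0r).
by rewrite ST TS ST' TS' -!scalar_mx_block.
Qed.

Definition mx1 (M : MP F) : 'M[F]_(msz M) := \matrix_(i, j) mA M i j.
Definition mx2 (M : MP F) : 'M[F]_(msz M) := \matrix_(i, j) mB M i j.

Definition mxf r s (R : nat -> nat -> F) : 'M[F]_(r, s) := \matrix_(i, j) R i j.

Lemma mxf_dsum a b (A B : nat -> nat -> F) :
  mxf (a + b) (a + b) (dsumf a A B) = block_mx (mxf a a A) 0 0 (mxf b b B).
Proof.
apply/matrixP => i j; rewrite !mxE /dsumf.
case: splitP => i' ->; rewrite !mxE; case: splitP => j' ->; rewrite !mxE ?ltn_ord //=.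
- by rewrite leqNgt ltn_ord.
- by rewrite andbC leqNgt ltn_ord.
- by rewrite !leq_addr !addKn.
Qed.

Lemma mxf_plus r s (R : nat -> nat -> F) :
  mxf (r + s) (r + s) (plusf r s R) = block_mx 0 (mxf r s R) (- (mxf r s R)^T) 0.
Proof.
apply/matrixP => i j; rewrite !mxE /plusf.
case: splitP => i' ->; rewrite !mxE; case: splitP => j' ->; rewrite !mxE ?ltn_ord //=.
- by rewrite !(leqNgt r) !ltn_ord.
- by rewrite leq_addr ltn_add2l ltn_ord addKn.
- by rewrite leq_addr ltn_add2l ltn_ord addKn.
- by rewrite andbF.
Qed.

Lemma mx1_dsum X Y : mx1 (dsum X Y) = block_mx (mx1 X) 0 0 (mx1 Y).
Proof. exact: mxf_dsum. Qed.
Lemma mx2_dsum X Y : mx2 (dsum X Y) = block_mx (mx2 X) 0 0 (mx2 Y).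
Proof. exact: mxf_dsum. Qed.

Definition pplus r s (R : 'M[F]_(r, s)) : 'M[F]_(r + s) := block_mx 0 R (- R^T) 0.

Lemma mx1_plus r s R1 R2 : mx1 (mkPlus r s R1 R2) = pplus (mxf r s R1).
Proof. exact: mxf_plus. Qed.
Lemma mx2_plus r s R1 R2 : mx2 (mkPlus r s R1 R2) = pplus (mxf r s R2).
Proof. exact: mxf_plus. Qed.

(* The row space of [U] plus its orthogonal for [A] and for [B] is everything. *)
Definition splits n k (A B : 'M[F]_n) (U : 'M[F]_(k, n)) : Prop :=
  exists P : 'M[F]_(n, k), [/\ U *m P = 1%:M,
    (1%:M - P *m U) *m A *m U^T = 0 & (1%:M - P *m U) *m B *m U^T = 0].

(** [E = 1 - P U] is an idempotent with [U E = 0], and a row basis [W] of its image is orthogonal to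
    [U] on the left by hypothesis, on the right by skewness. The stacked matrix of [U] and [W] is
    the change of basis. *)
Lemma splits_pcong n k (A B : 'M[F]_n) (U : 'M[F]_(k, n)) :
  A^T = - A -> B^T = - B -> splits A B U ->
  exists m (A' B' : 'M[F]_m), [/\ n = (k + m)%N, A'^T = - A', B'^T = - B' &
   pcong A B (block_mx (U *m A *m U^T) 0 0 A') (block_mx (U *m B *m U^T) 0 0 B')].
Proof.
move=> sA sB [P [UP]]; set E : 'M[F]_n := 1%:M - P *m U => PA PB.
pose W := row_base E; pose m : nat := \rank E.
have fW : row_free W := row_base_free E.
have sWE : (W <= E)%MS by rewrite eq_row_base.
have sEW : (E <= W)%MS by rewrite eq_row_base.
clearbody W.
have EE : E *m E = E.
  rewrite /E mulmxBl mul1mx mulmxBr mulmx1 mulmxA -(mulmxA P) UP mulmx1.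
  by rewrite subrr subr0.
have UE : U *m E = 0 by rewrite /E mulmxBr mulmx1 mulmxA UP mul1mx subrr.
have EP : E *m P = 0 by rewrite /E mulmxBl mul1mx -mulmxA UP mulmx1 subrr.
have WE : W = W *m E.
  by case/submxP: sWE => D ->; rewrite -mulmxA EE.
have WP : W *m P = 0 by rewrite WE -mulmxA EP mulmx0.
have [L EL] : exists L, E = L *m W by apply/submxP.
have WL : W *m L = 1%:M.
  apply: (row_free_inj fW).
  by rewrite -mulmxA -EL mul1mx -WE.
have UL : U *m L = 0.
  apply: (row_free_inj fW).
  by rewrite -mulmxA -EL mul0mx.
have WAU : W *m A *m U^T = 0 by rewrite WE -2!mulmxA (mulmxA E) PA mulmx0.
have WBU : W *m B *m U^T = 0 by rewrite WE -2!mulmxA (mulmxA E) PB mulmx0.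
have UAW : U *m A *m W^T = 0.
  apply: trmx_inj; rewrite !trmx_mul trmxK sA trmx0 mulNmx mulmxN mulmxA.
  by rewrite WAU oppr0.
have UBW : U *m B *m W^T = 0.
  apply: trmx_inj; rewrite !trmx_mul trmxK sB trmx0 mulNmx mulmxN mulmxA.
  by rewrite WBU oppr0.
have TS : row_mx P L *m col_mx U W = 1%:M.
  by rewrite mul_row_col -EL /E addrC subrK.
have ST : col_mx U W *m row_mx P L = 1%:M.
  by rewrite mul_col_row UP WP UL WL -scalar_mx_block.
exists m, (W *m A *m W^T), (W *m B *m W^T); split.
- by apply/eqP; rewrite eqn_leq (mulmx1_min TS) (mulmx1_min ST).
- by rewrite !trmx_mul trmxK sA mulNmx mulmxN mulmxA.
- by rewrite !trmx_mul trmxK sB mulNmx mulmxN mulmxA.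
- exists (col_mx U W), (row_mx P L); split => //.
  + by rewrite tr_col_mx mul_col_mx mul_col_row WAU UAW.
  + by rewrite tr_col_mx mul_col_mx mul_col_row WBU UBW.
Qed.

End PairCongruence.

Section Splitting.
Variable F : fieldType.

Lemma mulmx_sub_kernel m n (t : 'rV[F]_n) (C : 'M[F]_(m, n)) :
  (forall l : 'cV_n, C *m l = 0 -> t *m l = 0) -> exists z, z *m C = t.
Proof.
move=> H; suff /submxP[z ->] : (t <= C)%MS by exists z.
rewrite submxE; apply/eqP/matrixP => i j.
move: (cokermx C) (mulmx_coker C) => K CK.
have := H (K *m delta_mx j (0 : 'I_1)).
rewrite !mulmxA CK mul0mx -colE => /(_ erefl) /matrixP /(_ i 0).
by rewrite !mxE.
Qed.

(* Fredholm alternative for a linear recursion of length [k]. *)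
Lemma chain_dual n k q (A B : 'M[F]_n) (C : 'M[F]_(n, q)) (t : 'rV[F]_q) :
  (forall (l : 'cV_q) (u : nat -> 'cV_n), C *m l = B *m u 0%N ->
     (forall i, A *m u i = B *m u i.+1) -> (forall i, (k <= i)%N -> u i = 0) ->
     t *m l = 0) ->
  exists2 z : nat -> 'rV[F]_n,
    forall i, (i < k)%N -> z i.+1 *m A = z i *m B & z 0%N *m C = t.
Proof.
elim: k q C t => [|k IH] q C t H.
  have [|z zC] := @mulmx_sub_kernel _ _ t C; last by exists (fun=> z).
  move=> l Cl; apply: (H l (fun=> 0)) => //; first by rewrite mulmx0.
  by move=> i; rewrite !mulmx0.
(* The columns of the cokernel span the pairs [(l, u 0)] with [C l = B (u 0)]. In these parameters
   the rest of the recursion has the same form, one step shorter, with [A *m dsubmx K] for [C] and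
   [t *m usubmx K] for [t]. *)
have KE := mulmx_coker (row_mx C (- B)).
have KS z : z *m cokermx (row_mx C (- B)) = 0 -> exists z0 : 'rV_n, z0 *m row_mx C (- B) = z.
  by move=> zK; suff /submxP [z0 ->] : (z <= row_mx C (- B))%MS; [exists z0|rewrite submxE zK].
move: (cokermx _) KE KS => K; rewrite -{1}[K]vsubmxK mul_row_col mulNmx.
move=> /eqP; rewrite subr_eq0 => /eqP KE KS.
have [|z zA zC] := IH _ (A *m dsubmx K) (t *m usubmx K).
  move=> l u Cl uA u0; rewrite -mulmxA.
  apply: (H _ (fun i => if i is j.+1 then u j else dsubmx K *m l)) => /=.
  - by rewrite !mulmxA KE.
  - by case=> [|i]; rewrite ?mulmxA.
  - by case.
have [z0 z0P] : exists z0, z0 *m row_mx C (- B) = row_mx t (- (z 0%N *m A)).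
  by apply: KS; rewrite -[K]vsubmxK mul_row_col mulNmx -mulmxA zC subrr.
exists (fun i => if i is j.+1 then z j else z0).
  case=> [_|i]; last exact: zA.
  move: z0P; rewrite mul_mx_row mulmxN => /eq_row_mx [_] /oppr_inj -> //.
by move: z0P; rewrite mul_mx_row => /eq_row_mx [].
Qed.

Hypothesis F2 : (2%:R : F) != 0.

Lemma skew_diag0 (x : F) : x = - x -> x = 0.
Proof.
move=> /eqP; rewrite -subr_eq0 opprK -mulr2n -mulr_natl mulf_eq0 (negPf F2) /=.
by move/eqP.
Qed.

(** Moving along an antidiagonal from [(i, j)] to [(j, i)] shows that [f] is symmetric; being skew
    as well, its values are killed by 2. *)
Lemma hankel_skew0 k (f : nat -> nat -> F) :
  (forall i j, (i.+1 < k)%N -> (j.+1 < k)%N -> f i.+1 j = f i j.+1) ->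
  (forall i j, f i j = - f j i) ->
  forall i j, (i < k)%N -> (j < k)%N -> f i j = 0.
Proof.
move=> fH fS; have fT t a b : (a + t < k)%N -> (b + t < k)%N -> f a (b + t)%N = f (a + t)%N b.
  elim: t a b => [|t IH] a b; first by rewrite !addn0.
  rewrite !addnS => Ha Hb; rewrite -fH; last 2 first.
  - by apply: leq_trans Ha; rewrite !ltnS leq_addr.
  - by [].
  by rewrite IH ?addSn ?addnS // ltnW.
have fsym i j : (i <= j)%N -> (j < k)%N -> f i j = f j i.
  by move=> ij jk; have := @fT (j - i)%N i i; rewrite subnKC // => ->.
move=> i j ik jk; apply: skew_diag0; rewrite {1}fS; congr (- _).
by case: (leqP i j) => [/fsym->|/ltnW/fsym->].
Qed.

Definition rowsm n k (v : nat -> 'rV[F]_n) : 'M[F]_(k, n) := \matrix_(i < k) v i.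

Definition bl n (A : 'M[F]_n) (x y : 'rV[F]_n) : F := (x *m A *m y^T) 0 0.

Lemma gramE n k l (A : 'M[F]_n) v w (i : 'I_k) (j : 'I_l) :
  (rowsm k v *m A *m (rowsm l w)^T) i j = bl A (v i) (w j).
Proof.
rewrite /bl !mxE; apply: eq_bigr => a _; rewrite !mxE; congr (_ * _).
by apply: eq_bigr => b _; rewrite !mxE.
Qed.

Lemma mul_rowsT n k l (A : 'M[F]_(l, n)) v (i : 'I_l) (j : 'I_k) :
  (A *m (rowsm k v)^T) i j = (A *m (v j)^T) i 0.
Proof. by rewrite !mxE; apply: eq_bigr => a _; rewrite !mxE. Qed.

Lemma rowsm_mul n m k (M : 'M[F]_(n, m)) v : rowsm k v *m M = rowsm k (fun i => v i *m M).
Proof. by apply/row_matrixP => i; rewrite row_mul !rowK. Qed.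

Lemma bl_skew n (A : 'M[F]_n) x y : A^T = - A -> bl A x y = - bl A y x.
Proof.
move=> sA; have -> : bl A x y = (x *m A *m y^T)^T 0 0 by rewrite mxE.
by rewrite !trmx_mul trmxK sA mulNmx mulmxN mulmxA mxE.
Qed.

Lemma bl0r n (A : 'M[F]_n) x : bl A x 0 = 0.
Proof. by rewrite /bl trmx0 mulmx0 mxE. Qed.

Lemma splits_of n k (A B : 'M[F]_n) (U : 'M[F]_(k, n)) P K1 K2 :
  U *m P = 1%:M -> A *m U^T = P *m K1 -> B *m U^T = P *m K2 -> splits A B U.
Proof.
move=> UP AU BU; exists P; split => //.
  by rewrite -mulmxA AU mulmxA mulmxBl mul1mx -mulmxA UP mulmx1 subrr mul0mx.
by rewrite -mulmxA BU mulmxA mulmxBl mul1mx -mulmxA UP mulmx1 subrr mul0mx.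
Qed.

(* Two isotropic spaces stable under the pencil and in duality span an orthogonal summand. *)
Lemma hyper_split n D (A B : 'M[F]_n) (V Z : 'M[F]_(D, n)) (N N' : 'M[F]_D) :
  A^T = - A -> B^T = - B ->
  V *m A *m V^T = 0 -> V *m B *m V^T = 0 ->
  Z *m A *m Z^T = 0 -> Z *m B *m Z^T = 0 ->
  Z *m B *m V^T \in unitmx ->
  V *m A = N *m V *m B -> Z *m A = N' *m Z *m B ->
  exists U : 'M[F]_(D + D, n), [/\ splits A B U,
    U *m A *m U^T = pplus N^T & U *m B *m U^T = pplus 1%:M].
Proof.
move=> sA sB VAV VBV ZAZ ZBZ uG VA ZA.
(* Rescaling [Z] by the inverse Gram matrix makes the two bases dual for [B]; the multiplier [N'] is
   only conjugated by this. *)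
pose G := Z *m B *m V^T; pose Z1 := invmx G *m Z.
have Z1BV : Z1 *m B *m V^T = 1%:M by rewrite /Z1 -!mulmxA (mulmxA Z) mulVmx.
have {}uG : G \in unitmx by []. clearbody G.
have Z1AZ1 : Z1 *m A *m Z1^T = 0.
  by rewrite /Z1 trmx_mul -!mulmxA (mulmxA Z) (mulmxA _ Z^T) ZAZ mul0mx mulmx0.
have Z1BZ1 : Z1 *m B *m Z1^T = 0.
  by rewrite /Z1 trmx_mul -!mulmxA (mulmxA Z) (mulmxA _ Z^T) ZBZ mul0mx mulmx0.
have Z1A : Z1 *m A = (invmx G *m N' *m G) *m Z1 *m B.
  rewrite /Z1 !mulmxA (mulmxK uG) -(mulmxA _ Z A) ZA.
  by rewrite !mulmxA.
have AV : A *m V^T = B *m V^T *m N^T.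
  apply: trmx_inj; rewrite !trmx_mul !trmxK sA sB !mulmxN mulmxA -VA //.
have AZ1 : A *m Z1^T = B *m Z1^T *m (invmx G *m N' *m G)^T.
  by apply: trmx_inj; rewrite !(trmx_mul, trmxK) sA sB !mulmxN Z1A !mulmxA.
clearbody Z1.
have VBZ1 : V *m B *m Z1^T = - 1%:M.
  apply: trmx_inj; rewrite !trmx_mul trmxK sB mulNmx mulmxN mulmxA Z1BV.
  by rewrite linearN /= trmx1.
have Z1AV : Z1 *m A *m V^T = N^T by rewrite -mulmxA AV mulmxA mulmxA Z1BV mul1mx.
have VAZ1 : V *m A *m Z1^T = - N by rewrite VA -!mulmxA (mulmxA V) VBZ1 mulmxN mulmx1.
exists (col_mx Z1 V); split.
(* By duality and isotropy the columns of [B V^T] and [- B Z1^T] form the basis dual to the rows of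
   [Z1] and [V]. *)
- apply: (@splits_of _ _ _ _ _ (row_mx (B *m V^T) (- (B *m Z1^T)))
     (block_mx 0 N^T (- (invmx G *m N' *m G)^T) 0) (block_mx 0 1%:M (- 1%:M) 0)).
  + rewrite mul_col_row !mulmxN !mulmxA Z1BV Z1BZ1 VBV VBZ1 opprK oppr0.
    by rewrite -scalar_mx_block.
  + rewrite tr_col_mx mul_mx_row mul_row_block !mulmx0 add0r addr0.
    by rewrite mulNmx mulmxN opprK AV AZ1.
  + rewrite tr_col_mx mul_mx_row mul_row_block !mulmx0 add0r addr0.
    by rewrite mulNmx mulmxN opprK !mulmx1.
- by rewrite tr_col_mx mul_col_mx mul_col_row Z1AZ1 VAV Z1AV VAZ1 /pplus trmxK.
- by rewrite tr_col_mx mul_col_mx mul_col_row Z1BZ1 VBV Z1BV VBZ1 /pplus trmx1.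
Qed.

End Splitting.

(** * Singular and infinite blocks *)

Section EpsilonInfinity.
Variable F : fieldType.
Hypothesis F2 : (2%:R : F) != 0.
Variables (n : nat) (A B : 'M[F]_n).
Hypothesis sA : A^T = - A.
Hypothesis sB : B^T = - B.

(** For [v(x) = \sum_i v_i x^i] the condition says that [v(x) (x A - B)] is the constant [- v_0 B];
    a chain with [v_0 B = 0] is a polynomial null vector of the pencil, of degree less than [d]. *)
Definition chain (v : nat -> 'rV[F]_n) d : Prop :=
  (forall i, v i *m A = v i.+1 *m B) /\ (forall i, (d <= i)%N -> v i = 0).

Definition singular_pencil : Prop :=
  exists v d, [/\ chain v d, v 0%N *m B = 0 & v d.-1 != 0].

Lemma chainT v d : chain v d -> forall i, A *m (v i)^T = B *m (v i.+1)^T.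
Proof.
by case=> vA _ i; apply: trmx_inj; rewrite !trmx_mul !trmxK sA sB !mulmxN vA.
Qed.

Lemma bl_chainB v d i w : chain v d -> bl B (v i.+1) w = bl A (v i) w.
Proof. by case=> vA _; rewrite /bl -vA. Qed.

Lemma bl_chainBr v d i w : chain v d -> bl B w (v i.+1) = bl A w (v i).
Proof. by move=> cv; rewrite bl_skew // (bl_chainB _ _ cv) -bl_skew. Qed.

Lemma chain_isoB v d i j : chain v d -> bl B (v i) (v j) = 0.
Proof.
move=> cv; apply: (@hankel_skew0 _ F2 (maxn i j).+1 (fun i j => bl B (v i) (v j))).
- by move=> a b _ _; rewrite (bl_chainB _ _ cv) (bl_chainBr _ _ cv).
- by move=> a b; apply: bl_skew.
- by rewrite ltnS leq_maxl.
- by rewrite ltnS leq_maxr.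
Qed.

Lemma chain_isoA v d i j : chain v d -> bl A (v i) (v j) = 0.
Proof. by move=> cv; rewrite -(bl_chainB _ _ cv) (chain_isoB _ _ cv). Qed.

Lemma cochain_isoA (z : nat -> 'rV[F]_n) k :
  (forall i, (i.+1 < k)%N -> z i.+1 *m A = z i *m B) ->
  forall i j, (i < k)%N -> (j < k)%N -> bl A (z i) (z j) = 0.
Proof.
move=> zA; have zl i w : (i.+1 < k)%N -> bl A (z i.+1) w = bl B (z i) w.
  by move=> ik; rewrite /bl zA.
have zr i w : (i.+1 < k)%N -> bl A w (z i.+1) = bl B w (z i).
  by move=> ik; rewrite bl_skew // zl // -bl_skew.
apply: hankel_skew0 => // [i j ik jk|i j]; last exact: bl_skew.
by rewrite zl ?zr.
Qed.

Lemma cochain_isoB (z : nat -> 'rV[F]_n) k :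
  (forall i, (i.+1 < k)%N -> z i.+1 *m A = z i *m B) ->
  forall i j, (i < k)%N -> (j < k)%N -> bl B (z i) (z j) = 0.
Proof.
move=> zA; have lt i j : (i.+1 < k)%N -> (j < k)%N -> bl B (z i) (z j) = 0.
  move=> ik jk; have := cochain_isoA zA ik jk; rewrite {1}/bl zA //.
move=> i j ik jk; have [|ki] := ltnP i.+1 k; first by move=> ?; apply: lt.
have [|kj] := ltnP j.+1 k; first by move=> ?; rewrite bl_skew // lt ?oppr0.
(* Only for [i = j = k - 1] can neither argument be shifted to a value of [A]; there skewness alone
   suffices. *)
have -> : i = j by apply/eq_add_S/eqP; rewrite eqn_leq (leq_trans ik kj) (leq_trans jk ki).
by apply: (skew_diag0 F2); apply: bl_skew.
Qed.

Lemma comb_chain d (v : nat -> 'rV[F]_n) dv (l : 'cV[F]_d) k :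
  chain v dv ->
  A *m \sum_(j < d) l j 0 *: (v (j + k)%N)^T = B *m \sum_(j < d) l j 0 *: (v (j + k.+1)%N)^T.
Proof.
move=> cv; rewrite !mulmx_sumr; apply: eq_bigr => j _.
by rewrite -!scalemxAr (chainT cv) addnS.
Qed.

Lemma rowsT_mul d (v : nat -> 'rV[F]_n) (l : 'cV[F]_d) :
  (rowsm d v)^T *m l = \sum_(j < d) l j 0 *: (v j)^T.
Proof.
apply/colP => i; rewrite mxE summxE; apply: eq_bigr => j _.
by rewrite !mxE mulrC.
Qed.

Lemma cochainP (u : nat -> 'cV[F]_n) d :
  (forall i, A *m u i = B *m u i.+1) -> (forall i, (d <= i)%N -> u i = 0) ->
  chain (fun i => (u i)^T) d.
Proof.
move=> uA u0; split=> [i|i di]; last by rewrite u0 ?trmx0.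
by apply: trmx_inj; rewrite !trmx_mul !trmxK sA sB !mulNmx uA.
Qed.

Lemma chain_top v d : chain v d -> (exists i, v i != 0) -> exists2 d', (d' <= d)%N & chain v d'.+1 /\ v d' != 0.
Proof.
move=> [vA v0] [i vi].
have ex : exists m, [exists j : 'I_d, (v j != 0) && (j == m :> nat)].
  case: (ltnP i d) => [lid|/v0 vi0]; last by rewrite vi0 eqxx in vi.
  by exists i; apply/existsP; exists (Ordinal lid); rewrite vi eqxx.
have ub m : [exists j : 'I_d, (v j != 0) && (j == m :> nat)] -> (m <= d)%N.
  by move=> /existsP[j /andP[_ /eqP <-]]; apply: ltnW.
case: (ex_maxnP ex ub) => m /existsP[j /andP[vj /eqP jm]] maxm.
exists m; first by rewrite -jm ltnW.
split; last by rewrite -jm.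
split=> // k mk; apply: contraTeq mk => vk; rewrite -leqNgt; apply: maxm.
have kd : (k < d)%N by rewrite ltnNge; apply: contra vk => /v0 ->.
by apply/existsP; exists (Ordinal kd); rewrite vk eqxx.
Qed.

Lemma sum_delta m (f : 'I_m -> F) (k : nat) (g : nat -> F) :
  (forall i : 'I_m, f i = g i) ->
  \sum_(i < m) f i * (k == i :> nat)%:R = if (k < m)%N then g k else 0.
Proof.
move=> fg; case: ltnP => km.
  rewrite (bigD1 (Ordinal km)) //= eqxx mulr1 fg big1 ?addr0 // => i.
  by rewrite -val_eqE /= eq_sym => /negPf ->; rewrite mulr0.
rewrite big1 // => i _; case: eqP => [ki|_]; last by rewrite mulr0.
by have := ltn_ord i; rewrite -ki ltnNge km.
Qed.

Lemma split_of_dual k (U : 'M[F]_(k, n)) P K1 K2 :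
  U *m P = 1%:M -> A *m U^T = P *m K1 -> B *m U^T = P *m K2 ->
  [/\ splits A B U, U *m A *m U^T = K1 & U *m B *m U^T = K2].
Proof.
move=> UP AU BU; split; first exact: splits_of UP AU BU.
  by rewrite -mulmxA AU mulmxA UP mul1mx.
by rewrite -mulmxA BU mulmxA UP mul1mx.
Qed.

(* [v] is a null vector of the pencil of minimal degree [e]; subtracting a
   combination of shifts of [v] from the sequence obtained by gluing a
   multiplier [u] to [v] leaves a null vector of degree [< e]. *)
Lemma eps_dual e v : chain v e.+1 -> v 0%N *m B = 0 -> v e != 0 ->
  (forall w, chain w e -> w 0%N *m B = 0 -> w e.-1 = 0) ->
  exists2 z : nat -> 'rV[F]_n, forall i, (i.+1 < e)%N -> z i.+1 *m A = z i *m B &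
    forall j, (j < e)%N -> bl A (z 0%N) (v j) = (j == 0%N)%:R.
Proof.
move=> cv v0 ve min0.
have [|z zA zC] := @chain_dual _ n e.-1 e A B (A *m (rowsm e v)^T) (\row_j (j == 0%N :> nat)%:R).
  move=> l u Cl uA u0.
  pose q k := u k - \sum_(j < e) l j 0 *: (v (j + k.+1)%N)^T.
  have cq : chain (fun i => (q i)^T) e.
    apply: cochainP => [i|i ei].
      by rewrite /q !mulmxBr uA (comb_chain _ _ cv).
    rewrite /q u0 ?(leq_trans (leq_pred _)) // big1 ?subr0 // => j _.
    by rewrite cv.2 ?trmx0 ?scaler0 // addnS ltnS (leq_trans ei) // leq_addl.
  have q0 : (q 0%N)^T *m B = 0.
    apply: trmx_inj; rewrite trmx_mul trmxK sB mulNmx /q mulmxBr -(comb_chain _ _ cv).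
    rewrite -Cl -mulmxA rowsT_mul trmx0.
    under [in X in _ - _ *m X]eq_bigr do rewrite addn0.
    by rewrite subrr oppr0.
  (* In position [e - 1] the sequence [u] vanishes and only the term [j = 0] of the sum survives, so
     [q] equals [- l_0 v_e] there and [l_0 = 0]. For [e = 0] the predecessor is truncated and the
     claim is empty. *)
  have := min0 _ cq q0 => /(congr1 trmx); rewrite trmxK trmx0 /q u0 // sub0r.
  case: e l ve min0 Cl cv u0 q cq q0 => [|e] l ve min0 Cl cv u0 q cq q0.
    by move=> _; apply/matrixP => i j; rewrite !mxE big_ord0.
  rewrite big_ord_recl /= add0n big1 ?addr0; last first.
    by move=> j _; rewrite cv.2 ?trmx0 ?scaler0 // /bump /= add1n addSn ltnS leq_addl.
  move/eqP; rewrite oppr_eq0 scaler_eq0 => /orP[/eqP l0|]; last first.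
    by move/eqP => /(congr1 trmx); rewrite trmxK trmx0 => ve0; rewrite ve0 eqxx in ve.
  apply/matrixP => i j; rewrite !ord1 !mxE big_ord_recl !mxE /= l0 mulr0 add0r.
  by rewrite big1 // => k _; rewrite !mxE /= mul0r.
exists z; first by move=> i ie; apply: zA; rewrite -ltnS prednK // (leq_ltn_trans _ ie).
move=> j je; move/matrixP: zC => /(_ 0 (Ordinal je)).
by rewrite mulmxA mul_rowsT /bl => ->; rewrite mxE.
Qed.

Lemma eps_split : singular_pencil ->
  exists e (U : 'M[F]_(e + e.+1, n)), [/\ splits A B U,
    U *m A *m U^T = pplus (mxf e e.+1 (Rm1 F)) & U *m B *m U^T = pplus (mxf e e.+1 (Rm2 F))].
Proof.
move=> [v1 [d1 [cv1 v10 v1d]]].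
pose Q e := `[< exists v, [/\ chain v e.+1, v 0%N *m B = 0 & v e != 0] >].
have exQ : exists e, Q e.
  have [|d _ [cd vd]] := chain_top cv1; first by exists d1.-1.
  by exists d; apply/asboolP; exists v1.
case: (ex_minnP exQ) => e /asboolP[v [cv v0 ve]] mine.
have min0 w : chain w e -> w 0%N *m B = 0 -> w e.-1 = 0.
  move=> cw w0; apply/eqP; apply: contraT => we.
  have [|d de [cd wd]] := chain_top cw; first by exists e.-1.
  have : Q d by apply/asboolP; exists w.
  move/mine => ed; have {de ed}ed : d = e by apply/eqP; rewrite eqn_leq de.
  by move: wd; rewrite ed cw.2 ?eqxx.
have [z zA z0] := eps_dual cv v0 ve min0.
have Bv0 w : bl B w (v 0%N) = 0 by rewrite bl_skew // /bl v0 mul0mx mxE oppr0.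
have zAv i j : (i < e)%N -> (j <= e)%N -> bl A (z i) (v j) = (i == j)%:R.
  elim: i j => [|i IH] j ie.
    rewrite leq_eqVlt => /orP[/eqP->|je]; last by rewrite z0 // eq_sym.
    by rewrite -(bl_chainBr _ _ cv) cv.2 // bl0r; case: e ie {mine min0 cv ve z0 zA}.
  case: j => [|j] je; rewrite {1}/bl zA // -/(bl _ _ _); first by rewrite Bv0.
  by rewrite (bl_chainBr _ _ cv) IH ?eqSS // ltnW.
have zBv i j : (i < e)%N -> (j <= e)%N -> bl B (z i) (v j) = (j == i.+1)%:R.
  case: j => [|j] ie je; first by rewrite Bv0.
  by rewrite (bl_chainBr _ _ cv) zAv ?(ltnW je) // eqSS eq_sym.
(* Columns dual to the [v j]. The two prescriptions [- A z_j^T] for [zt j] and [- B z_j^T] for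
   [zt (j + 1)] agree because [z_(j+1) A = z_j B]. For [e = 0] there is no [z], and any column dual
   to [v 0] serves. *)
have [zt [zt1 zt2 ztv ztz]] : exists zt : nat -> 'cV[F]_n, [/\
    forall j, (j < e)%N -> A *m (z j)^T = - zt j,
    forall j, (j < e)%N -> B *m (z j)^T = - zt j.+1,
    forall i j, (i <= e)%N -> (j <= e)%N -> (v i *m zt j) 0 0 = (i == j)%:R &
    forall i j, (i < e)%N -> (j <= e)%N -> (z i *m zt j) 0 0 = 0].
  case e0 : e => [|k].
    have fve : row_free (v 0%N) by move: ve; rewrite /row_free rank_rV e0 => ->.
    exists (fun=> pinvmx (v 0%N)); split=> // i j; rewrite !leqn0 => /eqP-> /eqP->.
    by rewrite (mulmxVp fve) mxE.
  exists (fun j => if (j <= k)%N then - (A *m (z j)^T) else - (B *m (z k)^T)); split.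
  - by move=> j jk; rewrite -ltnS jk opprK.
  - move=> j jk; case: ltnP => [jk'|kj]; rewrite opprK; last first.
      by have -> : j = k by apply/eqP; rewrite eqn_leq -ltnS jk.
    by apply: trmx_inj; rewrite !trmx_mul !trmxK sA sB !mulmxN zA // e0.
  - move=> i j ie je; case: ifP => jk; rewrite mulmxN mulmxA mxE -/(bl _ _ _).
      by rewrite bl_skew // opprK zAv ?e0 // eq_sym.
    rewrite bl_skew // opprK zBv ?e0 //; congr (_ == _)%:R.
    by apply/eqP; rewrite eqn_leq je ltnNge jk.
  - move=> i j ie je; case: ifP => jk; rewrite mulmxN mulmxA mxE -/(bl _ _ _).
      by rewrite (cochain_isoA zA) ?oppr0 ?e0.
    by rewrite (cochain_isoB zA) ?oppr0 ?e0.
exists e, (col_mx (rowsm e z) (rowsm e.+1 v)).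
have := @split_of_dual _ (col_mx (rowsm e z) (rowsm e.+1 v))
  (row_mx (A *m (rowsm e v)^T) (\matrix_(a < n, j < e.+1) zt j a 0))
  (pplus (mxf e e.+1 (Rm1 F))) (pplus (mxf e e.+1 (Rm2 F))).
apply.
- rewrite mul_col_row [in RHS]scalar_mx_block; congr block_mx; apply/matrixP => i j.
  + by rewrite mulmxA gramE zAv ?(ltnW (ltn_ord j)) // mxE.
  + rewrite !mxE -[RHS](ztz i j) // ?leq_ord // mxE.
    by apply: eq_bigr => a _; rewrite !mxE.
  + by rewrite mulmxA gramE (chain_isoA _ _ cv) mxE.
  + rewrite !mxE -[RHS](ztv i j) ?leq_ord // mxE.
    by apply: eq_bigr => a _; rewrite !mxE.
- rewrite tr_col_mx mul_mx_row mul_row_block !mulmx0 add0r addr0 mulmxN.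
  congr row_mx; apply/matrixP => a j; rewrite mul_rowsT.
    rewrite zt1 // !mxE (eq_bigr (fun i : 'I_e.+1 => zt i a 0 * (j == i :> nat)%:R)).
      by rewrite (@sum_delta _ _ _ (fun i => zt i a 0)) // ltnW // ltnS.
    by move=> i _; rewrite !mxE.
  rewrite [RHS]mxE (eq_bigr (fun i : 'I_e => (A *m (v i)^T) a 0 * (j == i :> nat)%:R)).
    rewrite (@sum_delta _ _ _ (fun i => (A *m (v i)^T) a 0)) //.
    case: ltnP => // ej; have -> : j = e :> nat by apply/eqP; rewrite eqn_leq ej -ltnS ltn_ord.
    by rewrite (chainT cv) cv.2 // trmx0 mulmx0 mxE.
  by move=> i _; rewrite mul_rowsT [X in _ * X]mxE eq_sym.
- rewrite tr_col_mx mul_mx_row mul_row_block !mulmx0 add0r addr0 mulmxN.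
  congr row_mx; apply/matrixP => a j; rewrite mul_rowsT.
    rewrite zt2 // !mxE (eq_bigr (fun i : 'I_e.+1 => zt i a 0 * (j.+1 == i :> nat)%:R)).
      by rewrite (@sum_delta _ _ _ (fun i => zt i a 0)) // !ltnS ltn_ord.
    by move=> i _; rewrite !mxE eq_sym.
  rewrite [RHS]mxE; case: j => -[|j] je /=.
    rewrite big1 => [|i _]; last by rewrite mul_rowsT [X in _ * X]mxE /Rm2 mulr0.
    have -> : B *m (v 0%N)^T = 0; last by rewrite mxE.
    by apply: trmx_inj; rewrite trmx_mul trmxK sB mulmxN v0 oppr0 trmx0.
  rewrite (eq_bigr (fun i : 'I_e => (A *m (v i)^T) a 0 * (j == i :> nat)%:R)).
    by rewrite (@sum_delta _ _ _ (fun i => (A *m (v i)^T) a 0)) // -ltnS je (chainT cv).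
  by move=> i _; rewrite mul_rowsT [X in _ * X]mxE /Rm2 eqSS.
Qed.

End EpsilonInfinity.

Section InfinitySplit.
Variable F : fieldType.
Hypothesis F2 : (2%:R : F) != 0.
Variables (n : nat) (A B : 'M[F]_n).
Hypothesis sA : A^T = - A.
Hypothesis sB : B^T = - B.

(* More than [n] vectors are dependent, and the shifts of a dependent chain
   combine to a null vector of the pencil. *)
Lemma chain_bounded v d : ~ singular_pencil A B ->
  chain A B v d -> v d.-1 != 0 -> (d <= n)%N.
Proof.
move=> reg cv vd; rewrite leqNgt; apply/negP => nd; apply: reg.
case: d cv vd nd => [|d] cv /= vd nd; first by rewrite ltn0 in nd.
have : kermx (rowsm d.+1 v) != 0.
  rewrite kermx_eq0 /row_free neq_ltn; apply/orP; left.
  exact: leq_ltn_trans (rank_leq_col _) nd.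
case/rowV0Pn => c /sub_kermxP cV c0.
pose l := c^T; pose s k := \sum_(j < d.+1) l j 0 *: (v (j + k)%N)^T.
have s0 : s 0%N = 0.
  rewrite /s; under eq_bigr do rewrite addn0.
  by rewrite -rowsT_mul /l -trmx_mul cV trmx0.
have cs : chain A B (fun k => (s k.+1)^T) d.
  apply: cochainP => // [i|i di]; first exact: (comb_chain _ _ _ _ cv).
  rewrite /s big1 // => j _; rewrite cv.2 ?trmx0 ?scaler0 // addnS ltnS.
  by rewrite (leq_trans di) // leq_addl.
have [i ci] : exists i, c 0 i != 0.
  apply/existsP; apply: contraNT c0; rewrite negb_exists => /forallP H.
  by apply/eqP/rowP => i; rewrite mxE; have := H i; rewrite negbK => /eqP.
case: (@arg_minnP _ i (fun j => c 0 j != 0) (fun j => j : nat) ci) => j cj minj.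
have sj : s (d - j)%N = c 0 j *: (v d)^T.
  rewrite /s (bigD1 j) //= mxE subnKC -1?ltnS // big1 ?addr0 // => k kj.
  have [kltj|jltk] := ltnP k j.
    rewrite mxE; have -> : c 0 k = 0; last by rewrite scale0r.
    by apply/eqP; apply: contraTT kltj => /minj; rewrite -leqNgt.
  rewrite cv.2 ?trmx0 ?scaler0 //.
  have jk : (j < k)%N by rewrite ltn_neqAle jltk andbT eq_sym.
  by have := ltn_ord j; lia.
have sj0 : s (d - j)%N != 0.
  rewrite sj scaler_eq0 (negPf cj) /=; apply: contra vd => /eqP /(congr1 trmx).
  by rewrite trmxK trmx0 => ->.
have [|d' _ [cd sd]] := chain_top cs.
  case: (d - j)%N sj0 => [|k]; first by rewrite s0 eqxx.
  by move=> sk; exists k; apply: contra sk => /eqP /(congr1 trmx); rewrite trmxK trmx0 => ->.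
exists (fun k => (s k.+1)^T), d'.+1; split => //.
apply: trmx_inj; rewrite trmx_mul trmxK sB mulNmx -(comb_chain _ _ _ _ cv) //.
by rewrite -/(s 0%N) s0 mulmx0 oppr0 trmx0.
Qed.

(** The obstruction to solving for [z] is a linear relation which, after subtracting shifts of [v],
    becomes a chain one step longer whose top term is a multiple of [v d]; maximality makes the
    coefficient vanish. *)
Lemma inf_dual d v : chain A B v d.+1 -> v d != 0 ->
  (forall w, chain A B w d.+2 -> w d.+1 = 0) ->
  exists z : nat -> 'rV[F]_n, [/\ z 0%N *m A = 0,
    forall i, (i < d)%N -> z i.+1 *m A = z i *m B &
    forall j, (j <= d)%N -> bl B (z 0%N) (v j) = (j == 0%N)%:R].
Proof.
move=> cv vd maxd; set V := rowsm d.+1 v.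
have [|z zA zC] := @chain_dual _ n d (n + d.+1) A B (row_mx A (B *m V^T))
    (row_mx 0 (\row_j (j == 0%N :> nat)%:R)); last first.
  exists z; move: zC; rewrite mul_mx_row => /eq_row_mx[z0A zV]; split => // j jd.
  move/matrixP: zV => /(_ 0 (Ordinal (jd : (j < d.+1)%N))).
  by rewrite mulmxA mul_rowsT /bl => ->; rewrite mxE.
move=> l u; rewrite -[l]vsubmxK; move: (usubmx l) (dsubmx l) => mu c.
rewrite !mul_row_col mul0mx add0r => Cl uA u0.
pose s k := \sum_(j < d.+1) c j 0 *: (v (j + k)%N)^T.
pose w k := if k is k'.+1 then u k' - s k' else mu.
have s0 : V^T *m c = s 0%N.
  by rewrite rowsT_mul /s; under [in RHS]eq_bigr do rewrite addn0.
have cw : chain A B (fun k => (w k)^T) d.+2.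
  apply: cochainP => // [[|i]|[|i]] //.
  - by rewrite /w mulmxBr -s0 -Cl mulmxA addrK.
  - by rewrite /w !mulmxBr uA (comb_chain _ _ _ _ cv).
  - rewrite ltnS => di; rewrite /w u0 1?ltnW // /s big1 ?subr0 // => j _.
    by rewrite cv.2 ?trmx0 ?scaler0 // (leq_trans di) // leq_addl.
have := maxd _ cw => /(congr1 trmx); rewrite trmxK trmx0 /w u0 // sub0r /s.
rewrite big_ord_recl /= add0n big1 ?addr0; last first.
  by move=> j _; rewrite cv.2 ?trmx0 ?scaler0 // /bump /= add1n addSn ltnS leq_addl.
move/eqP; rewrite oppr_eq0 scaler_eq0 => /orP[/eqP c0|]; last first.
  by move/eqP => /(congr1 trmx); rewrite trmxK trmx0 => vd0; rewrite vd0 eqxx in vd.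
apply/matrixP => i j; rewrite !ord1 !mxE big_ord_recl !mxE /= c0 mulr0 add0r.
by rewrite big1 // => k _; rewrite !mxE /= mul0r.
Qed.

(** A left null vector of [A] is a chain of length one, and regularity bounds the length of chains
    by [n], so a longest one exists. Against its dual sequence the Gram matrix is triangular with
    unit diagonal, which is what [hyper_split] requires. *)
Lemma inf_split : ~ singular_pencil A B -> A \notin unitmx ->
  exists d (U : 'M[F]_(d.+1 + d.+1, n)), [/\ splits A B U,
    U *m A *m U^T = pplus (mxf d.+1 d.+1 (companion ('X^(d.+1)) d.+1)) &
    U *m B *m U^T = pplus (mxf d.+1 d.+1 (@idf F))].
Proof.
move=> reg uA; pose Q d := `[< exists2 v, chain A B v d.+1 & v d != 0 >].
have exQ : exists d, Q d.
  have : kermx A != 0 by rewrite kermx_eq0 row_free_unit.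
  case/rowV0Pn => x /sub_kermxP xA x0; exists 0%N; apply/asboolP.
  exists (fun i => if i is 0%N then x else (0 : 'rV_n)) => //.
  by split; case=> [|i] //; rewrite ?xA !mul0mx.
have ubQ d : Q d -> (d <= n)%N.
  by move=> /asboolP[v cv vd]; apply: ltnW; apply: (chain_bounded reg cv).
case: (ex_maxnP exQ ubQ) => d /asboolP[v cv vd] maxd.
have [|z [z0A zA z0B]] := inf_dual cv vd.
  move=> w cw; apply/eqP; apply: contraT => wd.
  have : Q d.+1 by apply/asboolP; exists w.
  by move/maxd; rewrite ltnn.
have zA' i : (i.+1 < d.+1)%N -> z i.+1 *m A = z i *m B by move=> ?; apply: zA.
have zBv i j : (i <= j)%N -> (j <= d)%N -> bl B (z i) (v j) = (i == j)%:R.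
  elim: i j => [|i IH] [|j] // ij jd; rewrite ?z0B //.
  rewrite (bl_chainBr sA sB _ _ cv) // {1}/bl zA ?(leq_trans ij) // -/(bl _ _ _).
  by rewrite IH // ltnW.
pose V := rowsm d.+1 v; pose Z := rowsm d.+1 z.
pose N : 'M[F]_d.+1 := \matrix_(i, j) (i.+1 == j :> nat)%:R.
pose N' : 'M[F]_d.+1 := \matrix_(i, j) (i == j.+1 :> nat)%:R.
have [|||||||U [sU UA UB]] := @hyper_split _ n d.+1 A B V Z N N' sA sB.
- by apply/matrixP => i j; rewrite gramE (chain_isoA F2 sA sB _ _ cv) mxE.
- by apply/matrixP => i j; rewrite gramE (chain_isoB F2 sA sB _ _ cv) mxE.
- by apply/matrixP => i j; rewrite gramE (cochain_isoA F2 sA sB zA') ?mxE.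
- by apply/matrixP => i j; rewrite gramE (cochain_isoB F2 sA sB zA') ?mxE.
- rewrite unitmxE det_trig.
    rewrite big1 ?unitr1 // => i _.
    by rewrite gramE zBv ?eqxx // -ltnS.
  apply/is_trig_mxP => i j ij; rewrite gramE zBv ?(ltnW ij) -1?ltnS //.
  by rewrite ltn_eqF.
- rewrite -mulmxA !rowsm_mul; apply/row_matrixP => i; rewrite row_mul rowK.
  have [id|di] := ltnP i d.
    have -> : row i N = delta_mx 0 (Ordinal (id : (i.+1 < d.+1)%N)).
      by apply/rowP => j; rewrite !mxE eqxx /= -val_eqE /= eq_sym.
    by rewrite -rowE rowK cv.1.
  have -> : row i N = 0.
    apply/rowP => j; rewrite !mxE; case: eqP => // ij.
    by have := ltn_ord j; rewrite -ij ltnS ltnNge di.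
  by rewrite mul0mx cv.1 cv.2 ?mul0mx.
- rewrite -mulmxA !rowsm_mul; apply/row_matrixP => -[[|i] id]; rewrite row_mul rowK /=.
    have -> : row (Ordinal id) N' = 0 by apply/rowP => j; rewrite !mxE.
    by rewrite mul0mx z0A.
  have -> : row (Ordinal id) N' = delta_mx 0 (Ordinal (ltnW id)).
    by apply/rowP => j; rewrite !mxE eqxx /= -val_eqE /= eqSS eq_sym.
  by rewrite -rowE rowK zA.
exists d, U; split => //.
  rewrite UA; congr pplus; apply/matrixP => i j; rewrite !mxE /companion coefXn.
  by rewrite (ltn_eqF (ltn_ord i)) mulr0 subr0 eq_sym.
by rewrite UB; congr pplus; apply/matrixP => i j; rewrite !mxE /idf.
Qed.

End InfinitySplit.

(** * Finite blocks *)

Section FiniteSplit.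
Variable F : fieldType.
(** The right-hand side is ['X * 'X^i] reduced modulo [f]: on coefficient rows the transposed
    companion matrix is multiplication by ['X] modulo [f]. *)
Lemma rVpoly_row_companion (f : {poly F}) D (i : 'I_D) : f \is monic -> size f = D.+1 ->
  rVpoly (row i (mxf D D (companion f D))^T) = 'X^(i.+1) - (i.+1 == D)%:R *: f.
Proof.
move=> mf szf; have D0 : (0 < D)%N by apply: leq_ltn_trans (ltn_ord i).
have D1 : (i.+1 == D) = (i == D.-1 :> nat) by lia.
apply/polyP => k; rewrite coef_rVpoly coefB coefZ coefXn.
case: insubP => [k' kD /= <-|]; first by rewrite !mxE /companion D1.
rewrite -leqNgt leq_eqVlt => /orP[/eqP <-|Dk].
  have -> : f`_D = 1 by move/monicP: mf; rewrite lead_coefE szf.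
  by rewrite mulr1 eq_sym subrr.
rewrite nth_default ?szf // mulr0 subr0 gtn_eqF //.
exact: leq_ltn_trans (ltn_ord i) Dk.
Qed.

Lemma monic_irreducible_factor (p : {poly F}) : (1 < size p)%N ->
  exists g : {poly F}, [/\ irreducible_poly g, g \is monic & g %| p].
Proof.
have [m] := ubnP (size p); elim: m p => // m IH p; rewrite ltnS => pm p1.
have [irr|nirr] := pselect (irreducible_poly p).
  have p0 : p != 0 by rewrite -size_poly_gt0 ltnW.
  have lp : (lead_coef p)^-1 != 0 by rewrite invr_eq0 lead_coef_eq0.
  exists ((lead_coef p)^-1 *: p); split.
  - split; first by rewrite size_scale.
    by move=> q q1 qp; rewrite eqp_sym (eqp_trans (eqp_scale _ lp)) // eqp_sym irr.2 // -(dvdpZr _ _ lp).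
  - by rewrite monicE lead_coefZ mulVf // lead_coef_eq0.
  - by rewrite dvdpZl.
have [q [q1 qp nqp]] : exists q : {poly F}, [/\ size q != 1, q %| p & ~~ (q %= p)].
  apply: contrapT => H; apply: nirr; split=> // q q1 qp.
  by apply: contrapT => nqp; apply: H; exists q; split=> //; apply/negP.
have p0 : p != 0 by rewrite -size_poly_gt0 ltnW.
have q0 : q != 0 by apply: contraNneq p0 => q0; move: qp; rewrite q0 dvd0p.
have sq : (size q < size p)%N.
  rewrite ltn_neqAle dvdp_leq // andbT; apply: contra nqp => /eqP sqp.
  by rewrite -dvdp_size_eqp // sqp.
have [||g [ig mg gq]] := IH q; first exact: leq_trans pm.
  by rewrite ltn_neqAle eq_sym q1 size_poly_gt0.
by exists g; split => //; apply: dvdp_trans qp.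
Qed.

Lemma multiplicity_split (g p : {poly F}) : (1 < size g)%N -> p != 0 ->
  exists k q, p = g ^+ k * q /\ ~~ (g %| q).
Proof.
move=> g1; have [m] := ubnP (size p); elim: m p => // m IH p; rewrite ltnS => pm p0.
have [gp|] := boolP (g %| p); last by exists 0%N, p; rewrite expr0 mul1r.
move: (gp); rewrite dvdp_eq => /eqP pE; set q := p %/ g in pE.
have q0 : q != 0 by apply: contraNneq p0 => q0; rewrite pE q0 mul0r.
have [||k [r [qE gr]]] := IH q => //.
  by apply: leq_trans pm; rewrite size_divp ?ltn_subrL ?size_poly_gt0 ?p0 -?size_poly_gt0 ?(ltnW g1) // -subn1 subn_gt0 g1.
exists k.+1, r; split => //; rewrite pE [in LHS]qE exprSr; ring.
Qed.

(** The ideal of [p] and [g ^+ N.+1] is generated by some [g ^+ k] with [k <= N], hence contains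
    [g ^+ N], the generator of the socle modulo [g ^+ N.+1]. *)
Lemma bezout_pow (g p : {poly F}) N : irreducible_poly g -> p != 0 ->
  ~~ (g ^+ N.+1 %| p) -> exists u v, u * p + v * g ^+ N.+1 = g ^+ N.
Proof.
move=> ig p0 gp; have [k [q [pE gq]]] := multiplicity_split ig.1 p0.
have kN : (k <= N)%N.
  rewrite leqNgt; apply: contra gp => Nk.
  by rewrite pE dvdp_mulr // dvdp_exp2l.
have cop : coprimep q (g ^+ (N.+1 - k)).
  apply: coprimep_expr; rewrite coprimep_sym; apply: contraNT gq => ncop.
  have := ig.2 _ ncop (dvdp_gcdl g q); rewrite eqp_sym => /eqp_dvdl ->.
  exact: dvdp_gcdr.
have /Bezout_eq1_coprimepP [[u v] /= uv] := cop.
exists (u * g ^+ (N - k)), (v * g ^+ (N - k)).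
have gk : g ^+ N = g ^+ (N - k) * g ^+ k by rewrite -exprD subnK.
have gN : g ^+ N.+1 = g ^+ (N.+1 - k) * g ^+ k by rewrite -exprD subnK // leqW.
rewrite pE gN gk -[RHS]mulr1 -uv; ring.
Qed.

Hypothesis F2 : (2%:R : F) != 0.
Variables (n : nat) (A B : 'M[F]_n.+1).
Hypothesis sA : A^T = - A.
Hypothesis sB : B^T = - B.
Variable T : 'M[F]_n.+1.
Hypothesis uA : A \in unitmx.
Hypothesis TA : T *m A = B.

Lemma AT : A *m T^T = B.
Proof.
apply: trmx_inj; rewrite trmx_mul trmxK sA sB mulmxN; congr (- _); exact: TA.
Qed.

(** Since [A] and [T A] are both skew, [T] is self-adjoint for the form [A], and so is every
    polynomial in [T]. *)
Lemma horner_adjoint p : horner_mx T p *m A = A *m (horner_mx T p)^T.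
Proof.
elim/poly_ind: p => [|p c IH]; first by rewrite !rmorph0 trmx0 mul0mx mulmx0.
rewrite rmorphD rmorphM /= horner_mx_X horner_mx_C mulmxDl linearD mulmxDr /=.
rewrite tr_scalar_mx scalar_mxC; congr (_ + _).
have c1 : horner_mx T p *m T = T *m horner_mx T p by apply: comm_horner_mx.
by rewrite -[_ * _]/(_ *m _) trmx_mul [in RHS]mulmxA AT -TA c1 -!mulmxA IH.
Qed.

Lemma bl_horner p x y : bl A (x *m horner_mx T p) y = bl A x (y *m horner_mx T p).
Proof. by rewrite /bl -(mulmxA x) horner_adjoint trmx_mul !mulmxA. Qed.

Lemma bl_mulT x y : bl A (x *m T) y = bl A x (y *m T).
Proof. by have := bl_horner 'X x y; rewrite horner_mx_X. Qed.

Lemma bl_B x y : bl B x y = bl A (x *m T) y.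
Proof. by rewrite /bl -(mulmxA x T) TA. Qed.

Lemma powers_isoA x i j : bl A (x *m T ^+ i) (x *m T ^+ j) = 0.
Proof.
apply: (@hankel_skew0 _ F2 (maxn i j).+1 (fun i j => bl A (x *m T ^+ i) (x *m T ^+ j))).
- by move=> a b _ _; rewrite !exprSr !mulmxA bl_mulT.
- by move=> a b; apply: bl_skew.
- by rewrite ltnS leq_maxl.
- by rewrite ltnS leq_maxr.
Qed.

Lemma powers_isoB x i j : bl B (x *m T ^+ i) (x *m T ^+ j) = 0.
Proof.
have := powers_isoA x i.+1 j.
by rewrite bl_B exprSr mulmxA.
Qed.

Lemma horner_rows D (c : 'rV_D) (x : 'rV[F]_n.+1) :
  c *m rowsm D (fun i => x *m T ^+ i) = x *m horner_mx T (rVpoly c).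
Proof.
rewrite /rVpoly poly_def rmorph_sum /= mulmx_sumr mulmx_sum_row.
apply: eq_bigr => i _; rewrite rowK valK /=.
by rewrite linearZ /= rmorphXn /= horner_mx_X -scalemxAr.
Qed.

Lemma fin_split : exists (g : {poly F}) N, let D := (size (g ^+ N.+1)).-1 in
  exists U : 'M[F]_(D + D, n.+1),
  [/\ irreducible_poly g, g \is monic & [/\ splits A B U,
    U *m A *m U^T = pplus (mxf D D (@idf F)) &
    U *m B *m U^T = pplus (mxf D D (companion (g ^+ N.+1) D))]].
Proof.
pose mp := mxminpoly T; have mp0 : mp != 0 by rewrite monic_neq0 ?mxminpoly_monic.
have [|g [ig mg gmp]] := @monic_irreducible_factor mp.
  by rewrite size_mxminpoly ltnS mxminpoly_nonconstant.
have [[|N] [h [mpE gh]]] := multiplicity_split ig.1 mp0.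
  by rewrite mpE expr0 mul1r (negPf gh) in gmp.
pose f := g ^+ N.+1; have mf : f \is monic by rewrite monic_exp.
have g0 : g != 0 by apply: irredp_neq0.
(* One factor [h] is meant for each of [x] and [y], to bring both into the kernel of [f(T)]. The
   product is not a multiple of the minimal polynomial because [g] does not divide [h]. *)
have [x0 [y0 xy0]] : exists x0 y0, bl A (x0 *m horner_mx T (g ^+ N * h ^+ 2)) y0 != 0.
  apply: contrapT => H; have : ~~ (mp %| g ^+ N * h ^+ 2).
    rewrite mpE exprSr expr2 -mulrA dvdp_mul2l ?expf_neq0 //.
    rewrite dvdp_mul2r //; apply: contraNneq mp0 => h0; rewrite mpE h0 mulr0 //.
  move/negP; apply; rewrite dvd_mxminpoly.
  have : horner_mx T (g ^+ N * h ^+ 2) *m A = 0.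
    apply/matrixP => i j; apply/eqP; apply: contrapT => /negP nz; apply: H.
    exists (delta_mx 0 i), (delta_mx 0 j); apply: contra nz => /eqP b0.
    rewrite [X in _ == X]mxE -[X in _ == X]b0 /bl -(mulmxA _ _ A) trmx_delta -colE -rowE.
    by rewrite [X in _ == X]mxE [X in _ == X]mxE.
  by move/(congr1 (mulmx^~ (invmx A))); rewrite mulmxK // mul0mx => ->.
pose x := x0 *m horner_mx T h; pose y := y0 *m horner_mx T h.
have hM p q : horner_mx T (p * q) = horner_mx T p *m horner_mx T q by rewrite rmorphM.
have fh z : z *m horner_mx T h *m horner_mx T f = 0.
  by rewrite -mulmxA -hM mulrC -mpE mx_root_minpoly mulmx0.
have xy : bl A (x *m horner_mx T (g ^+ N)) y != 0.
  rewrite /y -bl_horner /x -!mulmxA -!hM; apply: contraNN xy0.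
  by have -> : h * (g ^+ N * h) = g ^+ N * h ^+ 2 by ring.
pose D := (size f).-1.
have szf : size f = D.+1.
  by rewrite prednK // size_poly_gt0 monic_neq0.
have D0 : (0 < D)%N.
  by rewrite /D /f size_exp muln_gt0 -subn1 subn_gt0 ig.1.
have relB z : z *m horner_mx T f = 0 ->
    rowsm D (fun i => z *m T ^+ i) *m B =
    (mxf D D (companion f D))^T *m rowsm D (fun i => z *m T ^+ i) *m A.
  move=> zf; rewrite -TA mulmxA; congr (_ *m A).
  apply/row_matrixP => i; rewrite !row_mul rowK horner_rows.
  rewrite rVpoly_row_companion //.
  rewrite rmorphB /= horner_mxZ rmorphXn /= horner_mx_X mulmxBr -scalemxAr zf scaler0 subr0.
  by rewrite exprSr mulmxA.
(* A kernel vector gives a polynomial [p], not divisible by [f], with [y p(T)] orthogonal to the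
   cyclic space of [x]. By Bezout [y g^N(T)] is then orthogonal to [x], against the choice of [x]
   and [y]. *)
have uG : rowsm D (fun i => y *m T ^+ i) *m A *m (rowsm D (fun i => x *m T ^+ i))^T \in unitmx.
  rewrite -row_free_unit -kermx_eq0; apply: contraT => /rowV0Pn [c /sub_kermxP cG c0].
  pose p := rVpoly c.
  have p0 : p != 0 by apply: contra c0 => /eqP /(congr1 (@poly_rV _ D)); rewrite rVpolyK linear0 => ->.
  have fp : ~~ (f %| p).
    apply/negP => /dvdp_leq -/(_ p0); rewrite szf leqNgt ltnS size_poly //.
  have [u [v uv]] := bezout_pow ig p0 fp.
  have pV (c' : 'rV_D) : bl A (y *m horner_mx T p) (x *m horner_mx T (rVpoly c')) = 0.
    rewrite /bl -!horner_rows trmx_mul !mulmxA -(mulmxA c) -(mulmxA c) cG.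
    by rewrite mul0mx mxE.
  have : bl A (y *m horner_mx T p) (x *m horner_mx T u) = 0.
    rewrite (divp_eq u f) rmorphD /= mulmxDr mulrC hM mulmxA fh mul0mx add0r.
    rewrite -(@poly_rV_K _ D (u %% f)) ?pV //.
    by rewrite -ltnS -szf ltn_modpN0 // monic_neq0.
  rewrite -bl_horner -mulmxA -hM mulrC; have -> : u * p = g ^+ N - f * v.
    by rewrite -uv -/f; ring.
  rewrite rmorphB /= mulmxBr hM mulmxA fh mul0mx subr0 bl_skew // -bl_horner => /eqP.
  by rewrite oppr_eq0 (negPf xy).
(* The two forms are exchanged, because here it is [A] that must become the identity block. *)
have [||||U [sU UB UA]] := @hyper_split _ n.+1 D B A (rowsm D (fun i => x *m T ^+ i))
  (rowsm D (fun i => y *m T ^+ i)) _ _ sB sA _ _ _ _ uG (relB x (fh _ x0)) (relB y (fh _ y0)).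
- by apply/matrixP => i j; rewrite gramE powers_isoB mxE.
- by apply/matrixP => i j; rewrite gramE powers_isoA mxE.
- by apply/matrixP => i j; rewrite gramE powers_isoB mxE.
- by apply/matrixP => i j; rewrite gramE powers_isoA mxE.
exists g, N; rewrite -/f -/D; exists U; split => //; split => //.
- case: sU => P [UP PB PA]; exists P; split => //.
- by rewrite UA; congr pplus; apply/matrixP => i j; rewrite !mxE.
- by rewrite UB trmxK.
Qed.

End FiniteSplit.

(** * Binary forms and substitutions *)

Section Homogeneous.
Variable F : fieldType.
Implicit Types (g h : {poly {poly F}}) (p q : {poly F}).

Definition homog n g : Prop := forall i j, (g`_i)`_j != 0 -> (i + j)%N = n.

Definition homogenize n p : {poly {poly F}} := \poly_(i < n.+1) (p`_i *: 'X^(n - i)).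

Lemma homog_hom n p : homog n (homogenize n p).
Proof.
move=> i j; rewrite coef_poly; case: ltnP => ni; last by rewrite coef0 eqxx.
rewrite coefZ coefXn; have [->|] := eqVneq j (n - i)%N; first by rewrite subnKC.
by rewrite mulr0 eqxx.
Qed.

Lemma homog_coef n g i : homog n g -> g`_i = (dehom g)`_i *: 'X^(n - i).
Proof.
move=> hg; have gi (j : nat) : (i + j)%N <> n -> g`_i`_j = 0.
  by move=> ij; apply/eqP; apply: contraT => /hg.
have -> : (dehom g)`_i = g`_i`_(n - i).
  rewrite coef_map_id0 ?horner0 //.
  have [ni|ni] := leqP i n; last first.
    suff -> : g`_i = 0 by rewrite horner0 coef0.
    by apply/polyP => j; rewrite coef0 gi //; lia.
  rewrite (@horner_coef_wide _ (maxn (n - i).+1 (size (g`_i)%R))) ?leq_maxr //.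
  have lt : (n - i < maxn (n - i).+1 (size (g`_i)%R))%N by rewrite leq_max leqnn.
  rewrite (bigD1 (Ordinal lt)) //= expr1n mulr1 big1 ?addr0 // => j.
  rewrite -val_eqE /= => ji; rewrite gi ?mul0r //.
  by move=> ij; move/eqP: ji; lia.
apply/polyP => j; rewrite coefZ coefXn; case: eqP => [->|ji]; first by rewrite mulr1.
have [ni|ni] := leqP i n; first by rewrite mulr0 gi //; lia.
by rewrite mulr0 gi //; lia.
Qed.

Lemma homog_coef0 n g i : homog n g -> (n < i)%N -> g`_i = 0.
Proof.
move=> hg ni; apply/polyP => j; rewrite coef0; apply/eqP; apply: contraT => /hg; lia.
Qed.

Lemma dehomK n g : homog n g -> homogenize n (dehom g) = g.
Proof.
move=> hg; apply/polyP => i; rewrite coef_poly; case: ltnP => ni.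
  by rewrite -homog_coef.
by rewrite (homog_coef0 hg).
Qed.

Lemma homK n p : (size p <= n.+1)%N -> dehom (homogenize n p) = p.
Proof.
move=> sp; apply/polyP => i; rewrite coef_map_id0 ?horner0 // coef_poly.
case: ltnP => ni; first by rewrite hornerZ hornerXn expr1n mulr1.
by rewrite horner0 nth_default // (leq_trans sp).
Qed.

Lemma dehomM g h : dehom (g * h) = dehom g * dehom h.
Proof. exact: (rmorphM (map_poly (horner_eval (1 : F)))). Qed.
Lemma dehomD g h : dehom (g + h) = dehom g + dehom h.
Proof. exact: (rmorphD (map_poly (horner_eval (1 : F)))). Qed.
Lemma dehomXn g n : dehom (g ^+ n) = dehom g ^+ n.
Proof. exact: (rmorphXn (map_poly (horner_eval (1 : F)))). Qed.
Lemma dehomC q : dehom q%:P = q.[1]%:P.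
Proof. exact: (map_polyC (horner_eval (1 : F))). Qed.
Lemma dehom_cst (c : F) : dehom (cst c) = c%:P.
Proof. by rewrite /cst dehomC hornerC. Qed.
Lemma dehom_X1 : dehom (X1 F) = 'X.
Proof. exact: (map_polyX (horner_eval (1 : F))). Qed.
Lemma dehom_X2 : dehom (X2 F) = 1.
Proof. by rewrite /X2 dehomC hornerX. Qed.

Lemma homogM m n g h : homog m g -> homog n h -> homog (m + n) (g * h).
Proof.
move=> hg hh i j; apply: contraNeq => ij; rewrite coefM coef_sum; apply/eqP.
apply: big1 => k _; rewrite coefM; apply: big1 => l _.
have [gz|/hg gn] := eqVneq (g`_k`_l) 0; first by rewrite gz mul0r.
have [hz|/hh hn] := eqVneq (h`_(i - k)`_(j - l)) 0; first by rewrite hz mulr0.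
have := ltn_ord k; have := ltn_ord l; move/eqP: ij; lia.
Qed.

Lemma homogD n g h : homog n g -> homog n h -> homog n (g + h).
Proof.
move=> hg hh i j; rewrite !coefD; have [gz|/hg //] := eqVneq (g`_i`_j) 0.
by rewrite gz add0r; apply: hh.
Qed.

Lemma homog0 n : homog n 0.
Proof. by move=> i j; rewrite !coef0 eqxx. Qed.

Lemma homog_cst (c : F) : homog 0 (cst c).
Proof.
by case=> [|i] [|j]; rewrite /cst coefC /= ?coefC ?coef0 //= eqxx.
Qed.

Lemma homogX n g k : homog n g -> homog (k * n) (g ^+ k).
Proof.
move=> hg; elim: k => [|k IH]; first by have := @homog_cst 1; rewrite /cst !polyC1 expr0 mul0n.
by rewrite exprS mulSn; apply: homogM.
Qed.

Lemma homog_X1 : homog 1 (X1 F).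
Proof.
by case=> [|[|i]] [|j]; rewrite /X1 coefX /= ?coef1 ?coef0 //= eqxx.
Qed.

Lemma homog_X2 : homog 1 (X2 F).
Proof.
by case=> [|i] [|[|j]]; rewrite /X2 coefC /= ?coefX ?coef0 //= eqxx.
Qed.

Lemma homog_sum n I (r : seq I) (P : pred I) (f : I -> {poly {poly F}}) :
  (forall i, P i -> homog n (f i)) -> homog n (\sum_(i <- r | P i) f i).
Proof.
move=> H; elim/big_ind: _ => //; first exact: homog0.
by move=> x y; apply: homogD.
Qed.

Lemma homog_uniq n m g : g != 0 -> homog n g -> homog m g -> n = m.
Proof.
move=> g0 hn hm; have : (lead_coef (lead_coef g)) != 0 by rewrite !lead_coef_eq0.
by rewrite {1}/lead_coef {1}/lead_coef => nz; rewrite -(hn _ _ nz) (hm _ _ nz).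
Qed.

Lemma dehom_eq0 n g : homog n g -> (dehom g == 0) = (g == 0).
Proof.
move=> hg; apply/eqP/eqP => [dg|->]; last by rewrite /dehom map_polyE polyseq0.
by rewrite -(dehomK hg) dg; apply/polyP => i; rewrite coef_poly !coef0 scale0r if_same.
Qed.

Lemma poly2_unit g : g \is a GRing.unit -> exists2 c : F, c != 0 & g = cst c.
Proof.
rewrite poly_unitE => /andP[/eqP/eq_leq/size1_polyC gE].
rewrite poly_unitE unitfE => /andP[/eqP/eq_leq/size1_polyC qE c0].
by exists (g`_0`_0) => //; rewrite /cst -qE -gE.
Qed.

Lemma cst_unit (c : F) : c != 0 -> cst c \is a GRing.unit.
Proof. by move=> c0; do 2!apply: rmorph_unit; rewrite unitfE. Qed.

Lemma cst_eq0 (c : F) : (cst c == 0) = (c == 0).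
Proof. by rewrite !polyC_eq0. Qed.

Lemma cstM (c d : F) : cst (c * d) = cst c * cst d.
Proof. by rewrite /cst !polyCM. Qed.

Lemma X2_neq0 : X2 F != 0.
Proof. by rewrite polyC_eq0 polyX_eq0. Qed.

Lemma lead_coef_X2 : lead_coef (X2 F) = 'X.
Proof. by rewrite /X2 lead_coefC. Qed.

Lemma lead_coef_cst (c : F) : lead_coef (cst c) = c%:P.
Proof. by rewrite lead_coefC. Qed.

Lemma pred_addn_eq1 x y : (0 < x)%N -> (0 < y)%N -> (x + y).-1 = 1%N -> x = 1%N /\ y = 1%N.
Proof. lia. Qed.

Lemma pred_addn_eq2 x y : (0 < x)%N -> (0 < y)%N -> (x + y).-1 = 2%N -> x = 1%N \/ y = 1%N.
Proof. lia. Qed.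

Lemma addn_predK x y : (0 < x)%N -> x = (x + y).-1 -> y = 1%N.
Proof. lia. Qed.

Lemma addn_pred2 x y n : (0 < x)%N -> (0 < y)%N -> (x + y).-1 = n.+1 -> (x.-1 + y.-1)%N = n.
Proof. lia. Qed.

(** Comparing degrees in [x1], both factors of [x2] are constant in [x1]; comparing degrees in [x2],
    one of them is a scalar. *)
Lemma inP_X2 : inP (X2 F).
Proof.
split; last by left.
  split; first exact: X2_neq0.
    by rewrite poly_unitE coefC eqxx poly_unitE size_polyX andbC.
  move=> a b ab; have a0 : a != 0 by apply: contraTneq X2_neq0 => a0; rewrite ab a0 mul0r eqxx.
  have b0 : b != 0 by apply: contraTneq X2_neq0 => b0; rewrite ab b0 mulr0 eqxx.
  have : size (X2 F) = 1%N by rewrite size_polyC polyX_eq0.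
  have sa : (0 < size a)%N by rewrite size_poly_gt0.
  have sb : (0 < size b)%N by rewrite size_poly_gt0.
  rewrite ab size_mul // => sab.
  have [/eq_leq/size1_polyC aE /eq_leq/size1_polyC bE] := pred_addn_eq1 sa sb sab.
  have /polyC_inj ab0 : ('X : {poly F})%:P = (a`_0 * b`_0)%:P by rewrite polyCM -aE -bE -ab.
  have a00 : a`_0 != 0 by rewrite -polyC_eq0 -aE.
  have b00 : b`_0 != 0 by rewrite -polyC_eq0 -bE.
  have := size_polyX F; rewrite ab0 size_mul // => /pred_addn_eq2 s12.
  have [||s1|s1] := s12; rewrite ?size_poly_gt0 //.
    left; rewrite aE poly_unitE size_polyC a00 coefC eqxx poly_unitE s1 /=.
    have /size1_polyC := eq_leq s1; rewrite unitfE => aE0.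
    by rewrite -polyC_eq0 -aE0.
  right; rewrite bE poly_unitE size_polyC b00 coefC eqxx poly_unitE s1 /=.
  have /size1_polyC := eq_leq s1; rewrite unitfE => bE0.
  by rewrite -polyC_eq0 -bE0.
by exists 1%N; apply: homog_X2.
Qed.

Lemma size_hom n p : size p = n.+1 -> size (homogenize n p) = n.+1.
Proof.
move=> sp; apply/eqP; rewrite size_poly_eq // subnn expr0 alg_polyC polyC_eq0.
by have := lead_coef_eq0 p; rewrite /lead_coef sp /= => ->; rewrite -size_poly_eq0 sp.
Qed.

Lemma lead_coef_hom n p : size p = n.+1 -> lead_coef (homogenize n p) = (lead_coef p)%:P.
Proof.
move=> sp; rewrite lead_coefE size_hom // coef_poly ltnS leqnn subnn expr0 alg_polyC.
by rewrite lead_coefE sp.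
Qed.

Lemma homM m n p q : (size p <= m.+1)%N -> (size q <= n.+1)%N ->
  homogenize m p * homogenize n q = homogenize (m + n) (p * q).
Proof.
move=> sp sq; rewrite -[LHS](@dehomK (m + n)); last exact: homogM (@homog_hom _ _) (@homog_hom _ _).
by rewrite dehomM !homK.
Qed.

Lemma size_dehom_monic g : lead_coef g = 1 -> size (dehom g) = size g.
Proof.
by move=> lg; apply: size_poly_eq; rewrite -lead_coefE lg hornerC oner_eq0.
Qed.

(** A factorization dehomogenizes to one of [p]. A nonunit factor such as a power of [X2] cannot
    become constant on the way: the leading coefficients in [x1] have product 1, so dehomogenizing
    preserves the degrees of the factors in [x1]. *)
Lemma inP_hom p : irreducible_poly p -> p \is monic -> inP (homogenize (size p).-1 p).
Proof.
move=> ip mp; have sp : size p = (size p).-1.+1 by rewrite prednK // ltnW // ip.1.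
set n := (size p).-1 in sp *; have n0 : (0 < n)%N by have := ip.1; rewrite sp.
have lg : lead_coef (homogenize n p) = 1 by rewrite lead_coef_hom // (monicP mp).
split; [|by exists n; apply: homog_hom|by right].
have g0 : homogenize n p != 0 by rewrite -size_poly_eq0 size_hom.
split => //; first by rewrite poly_unitE size_hom // eqSS (gtn_eqF n0).
have key a b : homogenize n p = a * b -> size (dehom a) = 1%N -> a \is a GRing.unit.
  move=> ab sa; have := lg; rewrite ab lead_coefM => lab.
  have ula : lead_coef a \is a GRing.unit.
    by apply/unitrP; exists (lead_coef b); rewrite mulrC lab.
  move: (ula); rewrite poly_unitE => /andP[/eqP/eq_leq/size1_polyC la la0].
  have sda : size (dehom a) = size a.
    apply: size_poly_eq; rewrite -lead_coefE la hornerC.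
    by rewrite -unitfE.
  have sa1 : size a = 1%N by rewrite -sda.
  have a_0 : a`_0 = lead_coef a by rewrite lead_coefE sa1.
  by rewrite poly_unitE sa1 a_0 eqxx ula.
move=> a b ab; have pE : p = dehom a * dehom b by rewrite -dehomM -ab homK ?sp.
have [sa|sa] := eqVneq (size (dehom a)) 1%N; first by left; apply: key ab sa.
right; apply: (key b a); first by rewrite mulrC.
have /(ip.2 _ sa) : dehom a %| p by rewrite pE dvdp_mulr.
have p0 : p != 0 by rewrite irredp_neq0.
have da0 : dehom a != 0 by apply: contraNneq p0 => d0; rewrite pE d0 mul0r.
have db0 : dehom b != 0 by apply: contraNneq p0 => d0; rewrite pE d0 mulr0.
by move/eqp_size; rewrite pE size_mul // => /addn_predK -> //; rewrite size_poly_gt0.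
Qed.

(** Homogenizing a divisor of [dehom g] and its cofactor gives a factorization of [g], as their
    degrees add up. With [inP_hom], the elements of [inP] other than [X2] correspond to the monic
    irreducible polynomials in one variable. *)
Lemma inP_monic g : inP g -> g != X2 F ->
  [/\ lead_coef g = 1, dehom g \is monic, irreducible_poly (dehom g)
    & homog (size (dehom g)).-1 g].
Proof.
move=> [[g0 gu gi] [n hg] ug] gX; have {ug}lg : lead_coef g = 1 by case: ug => // gE; rewrite gE eqxx in gX.
have mg : dehom g \is monic.
  by rewrite monicE /dehom lead_coef_map_id0 ?horner0 // lg hornerC ?oner_neq0.
have sg := size_dehom_monic lg.
have nE : n = (size (dehom g)).-1.
  have nz : g`_(size g).-1`_0 != 0 by rewrite -lead_coefE lg coefC eqxx oner_neq0.
  by rewrite -(hg _ _ nz) addn0 sg.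
have sg0 : size (dehom g) = n.+1 by rewrite nE prednK // sg size_poly_gt0.
split => //; last by rewrite -nE.
have dK p : size p != 1%N -> p %| dehom g -> p %= dehom g.
  move=> sp pg; have pgE := divpK pg; set q := _ %/ _ in pgE.
  have q0 : q != 0 by apply: contraTneq mg => q0; rewrite -pgE q0 mul0r monicE lead_coef0 eq_sym oner_eq0.
  have p0 : p != 0 by apply: contraTneq mg => p0; rewrite -pgE p0 mulr0 monicE lead_coef0 eq_sym oner_eq0.
  have gE : g = homogenize (size q).-1 q * homogenize (size p).-1 p.
    rewrite homM ?prednK ?size_poly_gt0 // pgE -[LHS](dehomK hg); congr homogenize.
    by move: sg0; rewrite -pgE size_mul // => /addn_pred2 -> //; rewrite size_poly_gt0.
  have su (r : {poly F}) : r != 0 -> homogenize (size r).-1 r \is a GRing.unit -> size r = 1%N.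
    move=> r0; by rewrite poly_unitE (@size_hom (size r).-1) ?prednK ?size_poly_gt0 // => /andP[/eqP].
  case: (gi _ _ gE) => /su s1; last by rewrite s1 ?eqxx in sp.
  have /size1_polyC qE := eq_leq (s1 q0).
  rewrite -pgE qE mul_polyC eqp_sym; apply: eqp_scale.
  by rewrite -polyC_eq0 -qE.
split => //; rewrite sg ltn_neqAle eq_sym size_poly_gt0 g0 andbT.
apply: contra gu => /eqP sg1.
have g_0 : g`_0 = 1 by rewrite -lg lead_coefE sg1.
by rewrite poly_unitE sg1 g_0 eqxx unitr1.
Qed.

End Homogeneous.

Section Substitution.
Variable F : fieldType.
Implicit Types (g h : {poly {poly F}}) (Q : 'M[F]_2).

Definition linform (a b : F) : {poly {poly F}} := cst a * X1 F + cst b * X2 F.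

Definition cstm : F -> {poly {poly F}} := polyC \o polyC.
HB.instance Definition _ := GRing.RMorphism.on cstm.

Lemma cstm_comm (L : {poly {poly F}}) : commr_rmorph cstm L.
Proof. by move=> c; apply: mulrC. Qed.

Definition subst_inner (L : {poly {poly F}}) : {poly F} -> {poly {poly F}} :=
  horner_morph (cstm_comm L).
HB.instance Definition _ L := GRing.RMorphism.on (subst_inner L).

Lemma subst_inner_comm (L L' : {poly {poly F}}) : commr_rmorph (subst_inner L) L'.
Proof. by move=> c; apply: mulrC. Qed.

(** The double sum [subst2] as two nested evaluations, from which it inherits the structure of a
    ring morphism. *)
Definition subst2_morph Q : {poly {poly F}} -> {poly {poly F}} :=
  horner_morph (subst_inner_comm (linform (Q 1 0) (Q 1 1)) (linform (Q 0 0) (Q 0 1))).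
HB.instance Definition _ Q := GRing.RMorphism.on (subst2_morph Q).

Lemma subst2E Q g : subst2 Q g = subst2_morph Q g.
Proof.
rewrite /subst2_morph /horner_morph /map_poly horner_poly; apply: eq_bigr => i _.
rewrite /subst_inner /horner_morph /map_poly horner_poly mulr_suml; apply: eq_bigr => j _.
by rewrite mulrAC.
Qed.

Lemma subst2_cst Q c : subst2 Q (cst c) = cst c.
Proof.
rewrite subst2E /subst2_morph /cst horner_morphC; exact: (horner_morphC (cstm_comm _)).
Qed.

Lemma subst2_X1 Q : subst2 Q (X1 F) = linform (Q 0 0) (Q 0 1).
Proof. by rewrite subst2E; apply: (horner_morphX (subst_inner_comm _ _)). Qed.

Lemma subst2_X2 Q : subst2 Q (X2 F) = linform (Q 1 0) (Q 1 1).
Proof.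
rewrite subst2E /subst2_morph /X2 horner_morphC; exact: (horner_morphX (cstm_comm _)).
Qed.

Lemma subst2M Q g h : subst2 Q (g * h) = subst2 Q g * subst2 Q h.
Proof. by rewrite !subst2E rmorphM. Qed.
Lemma subst2D Q g h : subst2 Q (g + h) = subst2 Q g + subst2 Q h.
Proof. by rewrite !subst2E rmorphD. Qed.
Lemma subst2Xn Q g n : subst2 Q (g ^+ n) = subst2 Q g ^+ n.
Proof. by rewrite !subst2E rmorphXn. Qed.
Lemma subst2_0 Q : subst2 Q 0 = 0.
Proof. by rewrite !subst2E rmorph0. Qed.

Lemma poly2_ind (P : {poly {poly F}} -> Prop) :
  (forall c, P (cst c)) -> P (X1 F) -> P (X2 F) ->
  (forall g h, P g -> P h -> P (g + h)) -> (forall g h, P g -> P h -> P (g * h)) ->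
  forall g, P g.
Proof.
move=> Pc P1 P2 PD PM; elim/poly_ind => [|g q Pg].
  by have := Pc 0; rewrite /cst !polyC0.
apply: (PD); first exact: PM.
elim/poly_ind: q => [|q c Pq]; first by have := Pc 0; rewrite /cst polyC0.
by rewrite polyCD polyCM; apply: (PD); [apply: (PM)|apply: Pc].
Qed.

Lemma mulmx2E (P Q : 'M[F]_2) i j : (P *m Q) i j = P i 0 * Q 0 j + P i 1 * Q 1 j.
Proof.
rewrite mxE big_ord_recl big_ord1; have -> : lift ord0 ord0 = 1 :> 'I_2 by apply: val_inj.
by [].
Qed.

(** Two ring morphisms fixing the scalars agree once they agree on [x1] and [x2]. The order of the
    factors makes substitution a right action. *)
Lemma subst2_comp P Q g : subst2 P (subst2 Q g) = subst2 (Q *m P) g.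
Proof.
have lind a b : subst2 P (linform a b) = linform (a * P 0 0 + b * P 1 0) (a * P 0 1 + b * P 1 1).
  rewrite /linform subst2D !subst2M !subst2_cst subst2_X1 subst2_X2 /linform /cst.
  by rewrite !polyCD !polyCM; ring.
elim/poly2_ind: g => [c|||g h Pg Ph|g h Pg Ph].
- by rewrite !subst2_cst.
- by rewrite !subst2_X1 lind !mulmx2E.
- by rewrite !subst2_X2 lind !mulmx2E.
- by rewrite !subst2D Pg Ph.
- by rewrite !subst2M Pg Ph.
Qed.

Lemma subst2_1 g : subst2 1%:M g = g.
Proof.
elim/poly2_ind: g => [c|||g h Pg Ph|g h Pg Ph].
- by rewrite !subst2_cst.
- by rewrite !subst2_X1 /linform !mxE /= /cst !polyC1 !polyC0 mul1r mul0r addr0.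
- by rewrite !subst2_X2 /linform !mxE /= /cst !polyC1 !polyC0 mul1r mul0r add0r.
- by rewrite !subst2D Pg Ph.
- by rewrite !subst2M Pg Ph.
Qed.

Lemma subst2K Q : Q \in unitmx -> cancel (subst2 Q) (subst2 (invmx Q)).
Proof. by move=> uQ g; rewrite subst2_comp mulmxV // subst2_1. Qed.

Lemma homog_lin a b : homog 1 (linform a b).
Proof.
apply: homogD.
  exact: (homogM (@homog_cst _ _) (@homog_X1 F)).
exact: (homogM (@homog_cst _ _) (@homog_X2 F)).
Qed.

Lemma homog_subst2 Q n g : homog n g -> homog n (subst2 Q g).
Proof.
move=> hg; rewrite /subst2; apply: homog_sum => i _; apply: homog_sum => j _.
have [->|/hg ij] := eqVneq (g`_i`_j) 0.
  rewrite /cst !polyC0 !mul0r; exact: homog0.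
rewrite -ij; have -> : (i + j = 0 + i * 1 + j * 1)%N by rewrite add0n !muln1.
apply: homogM; last exact/homogX/homog_lin.
by apply: homogM; [apply: homog_cst|apply/homogX/homog_lin].
Qed.

Lemma subst2_unit Q g : Q \in unitmx -> (subst2 Q g \is a GRing.unit) = (g \is a GRing.unit).
Proof.
move=> uQ; apply/idP/idP => ug; last by rewrite subst2E rmorph_unit.
by rewrite -[g](subst2K uQ) subst2E rmorph_unit.
Qed.

Lemma subst2_eq0 Q g : Q \in unitmx -> (subst2 Q g == 0) = (g == 0).
Proof. by move=> uQ; rewrite -{1}(subst2_0 Q) (can_eq (subst2K uQ)). Qed.

Lemma subst2_irreducible Q g : Q \in unitmx ->
  ring_irreducible g -> ring_irreducible (subst2 Q g).
Proof.
move=> uQ [g0 ug ig]; split; rewrite ?subst2_eq0 ?subst2_unit // => a b ab.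
have := ig (subst2 (invmx Q) a) (subst2 (invmx Q) b).
rewrite -subst2M -ab subst2K // => /(_ erefl).
by rewrite !subst2_unit ?unitmx_inv.
Qed.

Lemma irreducible_scale g c : c != 0 -> ring_irreducible g -> ring_irreducible (cst c * g).
Proof.
move=> c0 [g0 ug ig]; have uc := cst_unit c0.
split; [by rewrite mulf_neq0 ?cst_eq0|by rewrite unitrMr|move=> a b ab].
have := ig (cst c^-1 * a) b; rewrite -mulrA -ab mulrA -cstM mulVf // /cst !polyC1 mul1r.
by move=> /(_ erefl)[]; rewrite ?unitrMr ?cst_unit ?invr_eq0 //; [left|right].
Qed.

Lemma unital_scale g h c : unital g -> unital h -> g = cst c * h -> g = h.
Proof.
have key g' h' c' : lead_coef g' = 1 -> lead_coef h' = 'X -> g' <> cst c' * h'.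
  move=> lg lh gh; move: lg; rewrite gh lead_coefM lead_coef_cst lh => /(congr1 (coefp 0)) /=.
  by rewrite coefMX coef1 /= => /eqP; rewrite eq_sym oner_eq0.
move=> ug uh gh; have [c0|c0] := eqVneq c 0.
  move: gh; rewrite c0 /cst !polyC0 mul0r => g0; case: ug; rewrite g0.
    by move/esym/eqP; rewrite (negPf (X2_neq0 F)).
  by rewrite lead_coef0 => /esym/eqP; rewrite oner_eq0.
have hg : h = cst c^-1 * g by rewrite gh mulrA -cstM mulVf // /cst !polyC1 mul1r.
case: ug uh => [gX|lg] [hX|lh].
- by rewrite gX hX.
- by case: (key _ _ _ lh _ hg); rewrite gX lead_coef_X2.
- by case: (key _ _ _ lg _ gh); rewrite hX lead_coef_X2.
- move: lg; rewrite gh lead_coefM lead_coef_cst lh mulr1 => /polyC_inj c1.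
  by rewrite c1 /cst !polyC1 mul1r.
Qed.

(* A form without [x1^n] term is divisible by [x2]. *)
Lemma normalize_irreducible n g : ring_irreducible g -> homog n g ->
  exists g' c, [/\ inP g', c != 0 & g = cst c * g'].
Proof.
move=> ig hg; have [g0 ug irr] := ig; pose c := (dehom g)`_n.
have gn : g`_n = c%:P by rewrite (homog_coef _ hg) subnn expr0 alg_polyC.
have sg : (size g <= n.+1)%N by apply/leq_sizeP => j; apply: homog_coef0.
have [c0|c0] := eqVneq c 0; last first.
  have szg : size g = n.+1.
    apply/eqP; rewrite eqn_leq sg; apply: contraLR c0; rewrite -leqNgt negbK => sgn.
    by rewrite -polyC_eq0 -gn nth_default.
  exists (cst c^-1 * g), c; split=> //; last first.
    by rewrite mulrA -cstM divff // /cst !polyC1 mul1r.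
  split; first by apply: irreducible_scale; rewrite ?invr_eq0.
    by exists n; apply: (homogM (@homog_cst _ _) hg).
  right; rewrite lead_coefM lead_coef_cst lead_coefE szg gn -polyCM mulVf //.
pose h := \poly_(i < n) ((dehom g)`_i *: 'X^((n - i).-1)).
have gE : g = X2 F * h.
  apply/polyP => i; rewrite mul_polyC coefZ coef_poly; case: ltnP => ni.
    have nE : (n - i = (n - i).-1.+1)%N by lia.
    by rewrite (homog_coef _ hg) {1}nE exprS scalerAr.
  rewrite mulr0; have [->|] := eqVneq i n; first by rewrite gn c0.
  by move=> in_; apply: (homog_coef0 hg); rewrite ltn_neqAle eq_sym in_.
case: (irr _ _ gE); first by case: (inP_X2 F) => [[_ /negPf->]].
case/poly2_unit => c' c'0 hE; exists (X2 F), c'; split=> //; first exact: inP_X2.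
by rewrite gE hE mulrC.
Qed.

Lemma actP_total Q g : Q \in unitmx -> inP g -> exists g', actP Q g g'.
Proof.
move=> uQ [ig [n hg] _].
have [g' [c [ig' c0 gE]]] := normalize_irreducible (subst2_irreducible uQ ig) (homog_subst2 hg).
by exists g'; split => //; exists c.
Qed.

Lemma actP_fun Q g g1 g2 : actP Q g g1 -> actP Q g g2 -> g1 = g2.
Proof.
move=> [[_ _ u1] [a [a0 E1]]] [[_ _ u2] [b [b0 E2]]].
apply: (@unital_scale _ _ (a^-1 * b)) => //.
by rewrite cstM -mulrA -E2 E1 mulrA -cstM mulVf // /cst !polyC1 mul1r.
Qed.

Lemma actP_inv Q g g' : Q \in unitmx -> inP g -> actP Q g g' -> actP (invmx Q) g' g.
Proof.
move=> uQ ig [ig' [c [c0 E]]]; split => //; exists c^-1; split; first by rewrite invr_eq0.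
rewrite -[X in cst _ * X](subst2K uQ) E subst2M subst2_cst mulrA -cstM mulVf //.
by rewrite /cst !polyC1 mul1r.
Qed.

Lemma actP_invE Q g g' : Q \in unitmx -> inP g -> inP g' ->
  actP (invmx Q) g' g <-> actP Q g g'.
Proof.
move=> uQ ig ig'; split; last exact: actP_inv.
by move=> a; rewrite -[Q]invmxK; apply: actP_inv; rewrite ?unitmx_inv.
Qed.

End Substitution.

(** * Kronecker normal form of skew pairs *)

Section Kronecker.
Variable F : fieldType.

Definition key := (option {poly {poly F}} * nat)%type.

Definition valid_key (k : key) : Prop :=
  (0 < k.2)%N /\ forall g, k.1 = Some g -> inP g.

Lemma Rblock_X2 d : Rblock (Some (X2 F)) d = mkPlus d d (companion 'X^d d) (@idf F).
Proof. by rewrite /Rblock eqxx. Qed.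

Lemma Rblock_fin g d : g != X2 F ->
  Rblock (Some g) d = let f := dehom g ^+ d in
    mkPlus (size f).-1 (size f).-1 (@idf F) (companion f (size f).-1).
Proof. by move=> /negPf gX; rewrite /Rblock gX. Qed.

Lemma pcong_dsum_step n m (A B : 'M[F]_n) (A' B' : 'M[F]_m) X Y :
  pcong A B (block_mx (mx1 X) 0 0 A') (block_mx (mx2 X) 0 0 B') ->
  pcong A' B' (mx1 Y) (mx2 Y) -> pcong A B (mx1 (dsum X Y)) (mx2 (dsum X Y)).
Proof.
move=> c1 c2; apply: pcong_trans c1 _; rewrite mx1_dsum mx2_dsum.
exact: pcong_dsum (pcong_refl _ _) c2.
Qed.

(** [X2] is set apart because it dehomogenizes to 1, which loses its degree. *)
Definition formdeg (g : {poly {poly F}}) : nat := (if g == X2 F then 1 else (size (dehom g)).-1)%N.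

Lemma size_dehom_pow (g : {poly {poly F}}) d : inP g -> g != X2 F -> (0 < d)%N ->
  exists n, [/\ size (dehom g ^+ d) = n.+2, dehom g ^+ d \is monic & n.+1 = (d * formdeg g)%N].
Proof.
move=> ig gX d0; have [_ mg [sg _] _] := inP_monic ig gX.
have md : dehom g ^+ d \is monic by apply: monic_exp.
have s0 : (0 < size (dehom g ^+ d))%N by rewrite size_poly_gt0 monic_neq0.
have s1 := size_exp (dehom g) d.
rewrite /formdeg (negPf gX); exists ((size (dehom g)).-1 * d).-1.
have p0 : (0 < (size (dehom g)).-1 * d)%N by rewrite muln_gt0 d0 andbT -subn1 subn_gt0.
rewrite prednK //; split=> //; last by rewrite mulnC.
by rewrite -s1 prednK // s1.
Qed.

Hypothesis F2 : (2%:R : F) != 0.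

Theorem kronecker n (A B : 'M[F]_n) : A^T = - A -> B^T = - B ->
  exists s : seq key, (forall k, k \in s -> valid_key k) /\
    pcong A B (mx1 (Ablocks s)) (mx2 (Ablocks s)).
Proof.
have [N] := ubnP n; elim: N n A B => // N IH n A B; rewrite ltnS => nN sA sB.
case: n => [|n] in A B nN sA sB *.
  exists [::]; split=> //; exists 1%:M, 1%:M.
  by split; apply/matrixP => -[].
suff [k [U [vk k0 sU UA UB]]] : exists (k : key) (U : 'M[F]_(msz (Rblock k.1 k.2), n.+1)),
    [/\ valid_key k, (0 < msz (Rblock k.1 k.2))%N, splits A B U,
        U *m A *m U^T = mx1 (Rblock k.1 k.2) & U *m B *m U^T = mx2 (Rblock k.1 k.2)].
  have [m [A' [B' [nE sA' sB']]]] := splits_pcong sA sB sU; rewrite UA UB => c1.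
  have [|s [vs c2]] := IH m A' B' _ sA' sB'.
    apply: leq_trans nN; rewrite nE; lia.
  exists (k :: s); split; last exact: pcong_dsum_step c1 c2.
  by move=> k'; rewrite inE => /orP[/eqP->|/vs].
have [sg|reg] := pselect (singular_pencil A B).
  have [e [U [sU UA UB]]] := eps_split F2 sA sB sg.
  (* The block labelled [d] has [d - 1] rows, so a null vector of degree [e] belongs to
     [d = e + 1]. *)
  exists (None, e.+1), U; split => //; first by rewrite /= addnS.
    by rewrite UA mx1_plus.
  by rewrite UB mx2_plus.
have [uA|uA] := boolP (A \in unitmx); last first.
  have [d [U [sU UA UB]]] := inf_split F2 sA sB reg uA.
  exists (Some (X2 F), d.+1); rewrite /= -/(Rblock (Some (X2 F)) d.+1) Rblock_X2.
  exists U; split => //; last by rewrite UB mx2_plus.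
    by split=> // g [<-]; apply: inP_X2.
  by rewrite UA mx1_plus.
have TA : B *m invmx A *m A = B by rewrite mulmxKV.
have [g [m [U [ig mg [sU UA UB]]]]] := fin_split F2 sA sB uA TA.
have sg : (size g <= (size g).-1.+1)%N by rewrite leqSpred.
have gX : homogenize (size g).-1 g != X2 F.
  apply/eqP => gX; have := dehom_X2 F; rewrite -gX homK // => g1.
  by have := ig.1; rewrite g1 size_poly1.
exists (Some (homogenize (size g).-1 g), m.+1); rewrite [_.1]/= [_.2]/= Rblock_fin // homK //.
exists U; split => //; last by rewrite UB mx2_plus.
- by split=> // _ [<-]; apply: inP_hom.
- by rewrite /= size_exp addn_gt0 muln_gt0 -subn1 subn_gt0 ig.1.
- by rewrite UA mx1_plus.
Qed.

End Kronecker.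

(** * Uniqueness of the multiplicities *)

Lemma card_bij (T T' : finType) (S : {set T}) (S' : {set T'}) (f : T -> T') (g : T' -> T) :
  (forall x, x \in S -> f x \in S' /\ g (f x) = x) ->
  (forall y, y \in S' -> g y \in S /\ f (g y) = y) -> #|S| = #|S'|.
Proof.
move=> Hf Hg; have <- : f @: S = S'.
  apply/setP => y; apply/imsetP/idP => [[x /Hf[xS _] ->//]|/Hg[gy fy]].
  by exists (g y).
rewrite card_in_imset // => x y /Hf[_ gx] /Hf[_ gy] fxy.
by rewrite -gx -gy fxy.
Qed.

Lemma mul_pplus (F : fieldType) m r q p (R : 'M[F]_(m, r)) (Y1 : 'M_(m, q)) (Y2 : 'M_(r, q))
    (X : 'M_(q, p)) :
  pplus R *m col_mx Y1 Y2 *m X = col_mx (R *m Y2 *m X) (- (R^T *m Y1 *m X)).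
Proof. by rewrite /pplus mul_block_col !mul0mx addr0 add0r mul_col_mx !mulNmx. Qed.

(** * Counting homomorphisms of pencils *)

Section Counting.
Variable F : finFieldType.

(* Up to transposition, the homomorphisms from a fixed pencil to the pencil [(A, B)]. *)
Definition sols q p m r (X1 X2 : 'M[F]_(q, p)) (A B : 'M[F]_(m, r)) : {set 'M[F]_(r, q)} :=
  [set Y | A *m Y *m X1 == B *m Y *m X2].

Lemma card_sols_pcong q p n n' (X1 X2 : 'M[F]_(q, p)) (A B : 'M[F]_n) (A' B' : 'M[F]_n') :
  pcong A B A' B' -> #|sols X1 X2 A' B'| = #|sols X1 X2 A B|.
Proof.
move=> [S [T [ST TS <- <-]]].
have TSt : S^T *m T^T = 1%:M by rewrite -trmx_mul TS trmx1.
have STt : T^T *m S^T = 1%:M by rewrite -trmx_mul ST trmx1.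
apply: (@card_bij _ _ _ _ (fun Y => S^T *m Y) (fun Y => T^T *m Y)) => Y; rewrite !inE => /eqP YE.
  split; last by rewrite mulmxA STt mul1mx.
  move/(congr1 (mulmx T)): YE; rewrite !mulmxA TS !mul1mx => ->; exact: eqxx.
split; last by rewrite mulmxA TSt mul1mx.
by rewrite -!(mulmxA _ S^T) !(mulmxA S^T) TSt mul1mx -!mulmxA; move: YE; rewrite -!mulmxA => ->.
Qed.

Lemma card_sols_diag q p m1 m2 r1 r2 (X1 X2 : 'M[F]_(q, p)) (A1 B1 : 'M[F]_(m1, r1)) (A2 B2 : 'M[F]_(m2, r2)) :
  #|sols X1 X2 (block_mx A1 0 0 A2) (block_mx B1 0 0 B2)| =
  (#|sols X1 X2 A1 B1| * #|sols X1 X2 A2 B2|)%N.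
Proof.
rewrite -cardsX.
apply: (@card_bij _ _ _ _ (fun Y => (usubmx Y, dsubmx Y)) (fun YY => col_mx YY.1 YY.2)).
  move=> Y; rewrite !inE /= vsubmxK -{1 2}[Y]vsubmxK !mul_block_col.
  by rewrite !mul0mx !addr0 !add0r !mul_col_mx => /eqP/eq_col_mx[-> ->]; rewrite !eqxx.
move=> [Y Y']; rewrite !inE /= => /andP[/eqP H /eqP H']; rewrite col_mxKu col_mxKd; split=> //.
by rewrite !mul_block_col !mul0mx !addr0 !add0r !mul_col_mx H H'.
Qed.

(** The block antidiagonal shape decouples the equation into one for [R] and one for its transpose;
    the sign cancels. *)
Lemma card_sols_plus q p m r (X1 X2 : 'M[F]_(q, p)) (R1 R2 : 'M[F]_(m, r)) :
  #|sols X1 X2 (pplus R1) (pplus R2)| =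
  (#|sols X1 X2 R1 R2| * #|sols X1 X2 R1^T R2^T|)%N.
Proof.
rewrite -cardsX.
apply: (@card_bij _ _ _ _ (fun Y => (dsubmx Y, usubmx Y)) (fun YY => col_mx YY.2 YY.1)).
  move=> Y; rewrite !inE /= vsubmxK -{1 2}[Y]vsubmxK !mul_pplus.
  by move=> /eqP/eq_col_mx[-> /oppr_inj ->]; rewrite !eqxx.
move=> [Y Y']; rewrite !inE /= => /andP[/eqP H /eqP H']; rewrite col_mxKu col_mxKd; split=> //.
by rewrite !mul_pplus H H'.
Qed.

Lemma card_sols_unique q p m r (X1 X2 : 'M[F]_(q, p)) (A B : 'M[F]_(m, r)) :
  (forall Y, A *m Y *m X1 = B *m Y *m X2 -> Y = 0) -> #|sols X1 X2 A B| = 1%N.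
Proof.
move=> H; rewrite -(cards1 (0 : 'M[F]_(r, q))); apply: eq_card => Y; rewrite !inE.
by apply/eqP/eqP => [/H //|->]; rewrite !mulmx0 !mul0mx.
Qed.

Lemma card_sols0 q p m (X1 X2 : 'M[F]_(q, p)) (A B : 'M[F]_(m, 0)) :
  #|sols X1 X2 A B| = 1%N.
Proof. by apply: card_sols_unique => Y _; rewrite flatmx0. Qed.

Section Companion.
Variables (D n : nat) (C : 'M[F]_D.+1) (h : {poly F}).
Hypotheses (mh : h \is monic) (sh : size h = n.+2).
Let H : 'M[F]_n.+1 := mxf n.+1 n.+1 (companion h n.+1).

Let K := [set y : 'rV[F]_D.+1 | y *m horner_mx C h == 0].

Lemma horner_mx_expand (y : 'rV[F]_D.+1) :
  y *m horner_mx C h = \sum_(j < n.+1) h`_j *: (y *m C ^+ j) + y *m C ^+ n.+1.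
Proof.
have hE : h = \sum_(j < n.+1) h`_j *: 'X^j + 'X^(n.+1).
  rewrite -{1}[h]coefK poly_def sh big_ord_recr /=.
  by rewrite -[n.+1]/(n.+2.-1) -sh -lead_coefE (monicP mh) scale1r.
rewrite {1}hE rmorphD rmorph_sum /= rmorphXn /= horner_mx_X mulmxDr mulmx_sumr.
congr (_ + _); apply: eq_bigr => j _.
by rewrite horner_mxZ rmorphXn /= horner_mx_X -scalemxAr.
Qed.

Lemma row_mul_tr_companion (Y : 'M[F]_(n.+1, D.+1)) (i : 'I_n.+1) :
  row i (H^T *m Y) = if (i < n)%N then row (inord i.+1) Y
                     else - \sum_(j < n.+1) h`_j *: row j Y.
Proof.
rewrite row_mul mulmx_sum_row; case: ltnP => i_n.
  rewrite (bigD1 (inord i.+1)) //= !mxE /companion inordK ?ltnS // eqxx (ltn_eqF i_n).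
  rewrite mul0r subr0 scale1r big1 ?addr0 // => j ji.
  rewrite !mxE /companion (ltn_eqF i_n) mul0r subr0.
  case: eqP => [jE|]; last by rewrite scale0r.
  by case/eqP: ji; apply: val_inj; rewrite /= inordK ?ltnS.
rewrite -sumrN; apply: eq_bigr => j _; rewrite !mxE /companion.
have -> : i = n :> nat by apply/eqP; rewrite eqn_leq i_n -ltnS ltn_ord.
by rewrite eqxx mul1r (ltn_eqF (ltn_ord j)) sub0r scaleNr.
Qed.

Lemma row_mul_companion (Y : 'M[F]_(n.+1, D.+1)) (i : 'I_n.+1) :
  row i (H *m Y) = (if (0 < i)%N then row (inord i.-1) Y else 0) - h`_i *: row ord_max Y.
Proof.
rewrite row_mul mulmx_sum_row.
transitivity (\sum_(j < n.+1) ((i == j.+1 :> nat)%:R *: row j Y - ((j == ord_max)%:R * h`_i) *: row j Y)).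
  by apply: eq_bigr => j _; rewrite !mxE /companion -scalerBl.
rewrite sumrB; congr (_ - _); last first.
  rewrite (bigD1 ord_max) //= eqxx mul1r big1 ?addr0 // => j /negPf ->.
  by rewrite mul0r scale0r.
case: ltnP => i0.
  rewrite (bigD1 (inord i.-1)) //= inordK; last by rewrite prednK // ltnW.
  rewrite prednK // eqxx scale1r big1 ?addr0 // => j ji.
  case: eqP => [jE|]; last by rewrite scale0r.
  by case/eqP: ji; rewrite jE /= inord_val.
rewrite big1 // => j _; case: eqP => [jE|]; last by rewrite scale0r.
by move: i0; rewrite jE.
Qed.

(** Each row of a solution is [C] times the previous one, so the first row [y] determines the
    matrix, and the equation for the last row is [y h(C) = 0]. *)
Lemma card_tr_companion : #|[set Y | Y *m C == H^T *m Y]| = #|K|.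
Proof.
apply: (@card_bij _ _ _ _ (fun Y => row 0 Y) (fun y => \matrix_i (y *m C ^+ i))) => [Y|y]; rewrite !inE.
  move=> /eqP YE; have rE (i : 'I_n.+1) : row i Y *m C = row i (H^T *m Y) by rewrite -YE row_mul.
  have rC k : (k < n.+1)%N -> row (inord k) Y = row 0 Y *m C ^+ k.
    elim: k => [_|k IH kn]; first by rewrite mulmx1; congr row; apply: val_inj; rewrite /= inordK.
    have := rE (inord k); rewrite row_mul_tr_companion inordK ?(ltnW kn) // -ltnS kn => <-.
    by rewrite IH ?(ltnW kn) // -mulmxA exprSr.
  split; last by apply/row_matrixP => i; rewrite rowK -rC // inord_val.
  rewrite horner_mx_expand exprSr mulmxA -rC // (_ : inord n = ord_max); last first.
    by apply: val_inj; rewrite /= inordK.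
  rewrite rE row_mul_tr_companion ltnn addrC addr_eq0; apply/eqP; congr (- _).
  by apply: eq_bigr => j _; rewrite -rC // inord_val.
move=> /eqP yh; split; last by rewrite rowK mulmx1.
apply/eqP/row_matrixP => i; rewrite row_mul_tr_companion row_mul !rowK -mulmxA.
rewrite -[_ *m C]/(_ * _) -exprSr; case: ltnP => i_n; first by rewrite inordK.
have -> : i = n :> nat by apply/eqP; rewrite eqn_leq i_n -ltnS ltn_ord.
apply/eqP; rewrite -addr_eq0 addrC; apply/eqP; rewrite -[RHS]yh horner_mx_expand.
by congr (_ + _); apply: eq_bigr => j _; rewrite rowK.
Qed.

Lemma drop_polyS i : drop_poly i h = (h`_i)%:P + drop_poly i.+1 h * 'X.
Proof.
apply/polyP => j; rewrite coefD coefC coefMX !coef_drop_poly.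
by case: j => [|j] /=; rewrite ?addr0 ?add0r // addnS addSn.
Qed.

(** Read upwards from the last row [y], the equations are Horner's scheme: row [i] is [y G_(i+1)],
    with [G_k] the value at [C] of the quotient of [h] by ['X^k]. The equation for row 0 is
    [y h(C) = 0]. *)
Lemma card_companion : #|[set Y | Y *m C == H *m Y]| = #|K|.
Proof.
pose G k : 'M_D.+1 := horner_mx C (drop_poly k h).
have GS k : G k = (h`_k)%:M + G k.+1 *m C.
  by rewrite /G drop_polyS rmorphD rmorphM /= horner_mx_C horner_mx_X.
have G0 : G 0%N = horner_mx C h by rewrite /G drop_poly0l.
have Gn : G n.+1 = 1%:M.
  rewrite /G (_ : drop_poly _ _ = 1) ?rmorph1 //; apply/polyP => j.
  rewrite coef_drop_poly coef1; case: j => [|j].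
    by rewrite -[(0 + _)%N]/(n.+2.-1) -sh -lead_coefE (monicP mh).
  by rewrite nth_default // sh addSn !ltnS leq_addl.
apply: (@card_bij _ _ _ _ (fun Y => row ord_max Y) (fun y => \matrix_i (y *m G i.+1))) => [Y|y]; rewrite !inE.
  move=> /eqP YE; have rE (i : 'I_n.+1) : row i Y *m C = row i (H *m Y) by rewrite -YE row_mul.
  have rC k : (k < n.+1)%N -> row (inord (n - k)) Y = row ord_max Y *m G (n - k).+1.
    elim: k => [_|k IH kn].
      by rewrite subn0 Gn mulmx1; congr row; apply: val_inj; rewrite /= inordK.
    have := rE (inord (n - k)); rewrite row_mul_companion inordK; last by rewrite ltnS leq_subr.
    rewrite subn_gt0 -ltnS kn -subnS IH ?(ltnW kn) // -mulmxA => /eqP; rewrite -subr_eq opprK => /eqP <-.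
    by rewrite (subnSK kn) [in RHS]GS mulmxDr scalar_mxC mul_scalar_mx addrC.
  have rG (i : 'I_n.+1) : row i Y = row ord_max Y *m G i.+1.
    have i_n : (i <= n)%N by rewrite -ltnS ltn_ord.
    by have := rC (n - i)%N; rewrite subKn // inord_val; apply; rewrite ltnS leq_subr.
  split; last by apply/row_matrixP => i; rewrite rowK -rG.
  have := rE ord0; rewrite row_mul_companion /= rG -mulmxA => /eqP.
  by rewrite sub0r -addr_eq0 addrC -mul_scalar_mx -scalar_mxC -mulmxDr -(GS 0%N) G0.
move=> /eqP yh; split; last by rewrite rowK Gn mulmx1.
apply/eqP/row_matrixP => i; rewrite row_mul_companion row_mul !rowK Gn mulmx1.
apply/eqP; rewrite -mulmxA eq_sym subr_eq addrC -mul_scalar_mx -scalar_mxC -mulmxDr -GS eq_sym.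
case: ltnP => i0; first by rewrite inordK prednK // ltnW.
have -> : i = 0%N :> nat by apply/eqP; rewrite -leqn0.
by rewrite G0 yh.
Qed.

End Companion.

End Counting.

Lemma pred_addn_leq a b k : (0 < a)%N -> (b <= k)%N -> ((a + b).-1 <= a.-1 + k)%N.
Proof. lia. Qed.

Lemma rVpoly_eq0 (R : fieldType) m (y : 'rV[R]_m) : (rVpoly y == 0) = (y == 0).
Proof. by rewrite -(inj_eq (can_inj (@rVpolyK _ m))) linear0. Qed.

Section Weights.
Variable F : finFieldType.

Section CompanionAction.
Variables (f : {poly F}) (D : nat).
Hypotheses (mf : f \is monic) (szf : size f = D.+2).
Let C : 'M[F]_D.+1 := (mxf D.+1 D.+1 (companion f D.+1))^T.

Lemma rVpoly_mul_companion (y : 'rV_D.+1) : rVpoly (y *m C) = (rVpoly y * 'X) %% f.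
Proof.
have yE : rVpoly y * 'X = rVpoly (y *m C) + y 0 ord_max *: f.
  rewrite {2}[y]row_sum_delta mulmx_suml linear_sum /=.
  rewrite [X in _ = X + _](eq_bigr (fun i : 'I_D.+1 =>
      y 0 i *: 'X^(i.+1) - (y 0 i * (i.+1 == D.+1)%:R) *: f)); last first.
    move=> i _; rewrite -scalemxAl -rowE linearZ /= (rVpoly_row_companion i mf szf).
    by rewrite scalerBr scalerA.
  have S1 : \sum_(i < D.+1) (y 0 i * (i.+1 == D.+1)%:R) *: f = y 0 ord_max *: f.
    rewrite (bigD1 ord_max) //= eqxx mulr1 big1 ?addr0 // => i.
    by rewrite -val_eqE /= eqSS => /negPf ->; rewrite mulr0 scale0r.
  rewrite sumrB S1.
  rewrite subrK /rVpoly poly_def mulr_suml; apply: eq_bigr => i _.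
  by rewrite valK -scalerAl -exprSr.
rewrite yE modpD modpZl modpp scaler0 addr0 modp_small // szf ltnS size_poly //.
Qed.

Lemma rVpoly_horner_companion (y : 'rV_D.+1) h :
  rVpoly (y *m horner_mx C h) = (rVpoly y * h) %% f.
Proof.
elim/poly_ind: h y => [|h c IH] y; first by rewrite rmorph0 mulmx0 linear0 mulr0 mod0p.
rewrite rmorphD rmorphM /= horner_mx_X horner_mx_C mulmxDr linearD /= mulmxA.
rewrite rVpoly_mul_companion IH mulrC modp_mul mulrDr modpD; congr (_ + _).
  by congr (_ %% _); ring.
rewrite scalar_mxC mul_scalar_mx linearZ /= mulrC mul_polyC modpZl modp_small //.
by rewrite szf ltnS size_poly.
Qed.

Lemma ker_companion (y : 'rV_D.+1) h : (y *m horner_mx C h == 0) = (f %| rVpoly y * h).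
Proof. by rewrite -rVpoly_eq0 rVpoly_horner_companion. Qed.

Lemma card_ker_coprime h : coprimep f h -> #|[set y : 'rV_D.+1 | y *m horner_mx C h == 0]| = 1%N.
Proof.
move=> cop; apply/eqP/cards1P; exists 0; apply/setP => y; rewrite !inE.
rewrite ker_companion Gauss_dvdpl // -rVpoly_eq0; apply/idP/eqP => [fy|->]; last exact: dvdp0.
apply/eqP; apply: contraT => /dvdp_leq -/(_ _ fy); rewrite szf leqNgt ltnS.
by rewrite (leq_trans (size_poly _ _)).
Qed.

(** Modulo [g ^+ d] the annihilator of [g ^+ e] is the ideal of [g ^+ (d - minn d e)], of dimension
    [minn d e] times the degree of [g]. *)
Lemma card_ker_pow (g : {poly F}) d e : (1 < size g)%N -> f = g ^+ d ->
  #|[set y : 'rV_D.+1 | y *m horner_mx C (g ^+ e) == 0]| = (#|F| ^ (minn d e * (size g).-1))%N.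
Proof.
move=> g1 fE; set m := minn d e; set k := (m * _)%N.
have g0 : g != 0 by rewrite -size_poly_gt0 ltnW.
have gd : g ^+ (d - m) != 0 by rewrite expf_neq0.
have div q : (f %| q * g ^+ e) = (g ^+ (d - m) %| q).
  rewrite fE /m; have [de|ed] := leqP d e.
    by rewrite subnn expr0 dvd1p dvdp_mull // dvdp_exp2l.
  by rewrite -{1}(subnK (ltnW ed)) exprD dvdp_mul2r // expf_neq0.
have sD : (D.+1 = (d - m) * (size g).-1 + k)%N.
  rewrite /k -mulnDl subnK ?geq_minl // mulnC -size_exp -fE szf //.
rewrite -[RHS](_ : #|[set: 'rV[F]_k]| = _); last by rewrite cardsT card_mx mul1n.
apply/esym; apply: (@card_bij _ _ _ _ (fun c => poly_rV (g ^+ (d - m) * rVpoly c) : 'rV_D.+1)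
  (fun y => poly_rV (rVpoly y %/ g ^+ (d - m)))) => [c _|y].
  have sc : (size (g ^+ (d - m) * rVpoly c)%R <= D.+1)%N.
    rewrite sD mulnC -size_exp; apply: leq_trans (size_polyMleq _ _) _.
    have sb : (size (rVpoly c) <= k)%N by apply: size_poly.
    by apply: pred_addn_leq sb; rewrite size_poly_gt0.
  by rewrite inE ker_companion poly_rV_K // div dvdp_mulr // mulKp // rVpolyK.
rewrite inE ker_companion div => gy; split; first by rewrite inE.
rewrite poly_rV_K; first by rewrite mulrC divpK // rVpolyK.
rewrite size_divp // leq_subLR size_exp mulnC; apply: leq_trans (size_poly _ _) _.
by rewrite sD.
Qed.

End CompanionAction.

Lemma mulmx_nil_eq0 m n (H : 'M[F]_m.+1) (C : 'M[F]_n.+1) (Y : 'M[F]_(m.+1, n.+1)) k :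
  H ^+ k = 0 \/ C ^+ k = 0 -> Y = H *m Y *m C -> Y = 0.
Proof.
move=> nil YE; have -> : Y = H ^+ k *m Y *m C ^+ k.
  elim: {nil} k => [|k IH]; first by rewrite mul1mx mulmx1.
  by rewrite {1}IH {1}YE exprSr exprS !mulmxA.
by case: nil => ->; rewrite ?mul0mx ?mulmx0.
Qed.

Lemma trmx_exp n k (M : 'M[F]_n.+1) : (M ^+ k)^T = M^T ^+ k.
Proof.
elim: k => [|k IH]; first by rewrite !expr0 trmx1.
by rewrite exprS exprSr -IH trmx_mul.
Qed.

Lemma companion_Xn_nil D :
  (mxf D.+1 D.+1 (companion ('X^(D.+1) : {poly F}) D.+1)) ^+ D.+1 = 0.
Proof.
apply: trmx_inj; rewrite trmx0 trmx_exp -(horner_mx_X (_^T)) -rmorphXn.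
apply/row_matrixP => i; rewrite row0 rowE; apply/eqP.
by rewrite (@ker_companion 'X^(D.+1)) ?dvdp_mull ?monicXn ?size_polyXn.
Qed.

Lemma mxf_idf n : mxf n n (@idf F) = 1%:M.
Proof. by apply/matrixP => i j; rewrite !mxE. Qed.

End Weights.

Section ShiftRows.
Variable F : fieldType.

(** On coefficient rows the two matrices of the epsilon-block become inclusion and multiplication by
    ['X], from polynomials of size at most [n] to those of size at most [n + 1]. *)
Lemma rVpoly_Rm1 n (y : 'rV[F]_n) : rVpoly (y *m mxf n n.+1 (@Rm1 F)) = rVpoly y.
Proof.
apply/polyP => k; rewrite !coef_rVpoly.
case: (insubP 'I_n.+1 k) => [k' _ kE|nk]; case: insubP => [k'' _ kE'|nk'] //.
- rewrite mxE (bigD1 k'') //= mxE /Rm1 kE kE' eqxx mulr1 big1 ?addr0 // => j.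
  by rewrite -val_eqE mxE /Rm1 kE /= kE' => /negPf ->; rewrite mulr0.
- rewrite mxE big1 // => j _; rewrite mxE /Rm1 kE; case: eqP => [jk|]; last by rewrite mulr0.
  by rewrite -jk ltn_ord in nk'.
- by move: nk; rewrite -kE' (ltn_trans (ltn_ord _)).
Qed.

Lemma rVpoly_Rm2 n (y : 'rV[F]_n) : rVpoly (y *m mxf n n.+1 (@Rm2 F)) = rVpoly y * 'X.
Proof.
apply/polyP => -[|k]; rewrite coefMX !coef_rVpoly /=.
  case: insubP => // k' _ kE; rewrite mxE big1 // => j _.
  by rewrite mxE /Rm2 kE mulr0.
case: (insubP 'I_n.+1 k.+1) => [k' _ kE|nk]; case: insubP => [k'' _ kE'|nk'] //.
- rewrite mxE (bigD1 k'') //= mxE /Rm2 kE kE' eqxx mulr1 big1 ?addr0 // => j.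
  by rewrite -val_eqE mxE /Rm2 kE /= eqSS kE' eq_sym => /negPf ->; rewrite mulr0.
- rewrite mxE big1 // => j _; rewrite mxE /Rm2 kE eqSS; case: eqP => [jk|]; last by rewrite mulr0.
  by rewrite jk ltn_ord in nk'.
- by move: nk; rewrite -kE' ltnS ltn_ord.
Qed.

End ShiftRows.

(** * Solutions for the test pencils *)

Section Tests.
Variable F : finFieldType.

(* Over a [finFieldType], [rVpoly_Rm1] and [rVpoly_Rm2] do not rewrite, as the canonical
   instances differ syntactically from those of a [fieldType]. *)
Lemma rVpoly_Rm1f n (y : 'rV[F]_n) : rVpoly (y *m mxf n n.+1 (@Rm1 F)) = rVpoly y.
Proof. exact: rVpoly_Rm1. Qed.

Lemma rVpoly_Rm2f n (y : 'rV[F]_n) : rVpoly (y *m mxf n n.+1 (@Rm2 F)) = rVpoly y * 'X.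
Proof. exact: rVpoly_Rm2. Qed.

(** Extension by zero beyond the last row turns the boundary equations of the shift matrices into
    instances of the general recursion. *)
Definition rowz m q (Y : 'M[F]_(m, q)) k : 'rV[F]_q := if insub k is Some i then row i Y else 0.

Lemma rowz_ord m q (Y : 'M[F]_(m, q)) (i : 'I_m) : rowz Y i = row i Y.
Proof. by rewrite /rowz valK. Qed.

Lemma rowz_ge m q (Y : 'M[F]_(m, q)) k : (m <= k)%N -> rowz Y k = 0.
Proof. by move=> mk; rewrite /rowz insubF // ltnNge mk. Qed.

Lemma rowz_eq0 m q (Y : 'M[F]_(m, q)) : (forall k, (k < m)%N -> rowz Y k = 0) -> Y = 0.
Proof. by move=> H; apply/row_matrixP => i; rewrite row0 -rowz_ord H. Qed.

Lemma rowz_matrix m q (f : nat -> 'rV[F]_q) k : (k < m)%N -> rowz (\matrix_(i < m) f i) k = f k.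
Proof. by move=> km; rewrite -[k]/(val (Ordinal km)) rowz_ord rowK. Qed.

Lemma row_mul_delta l m q (M : 'M[F]_(l, m)) (Y : 'M[F]_(m, q)) i k :
  (forall j, M i j = (k == j :> nat)%:R) -> row i (M *m Y) = rowz Y k.
Proof.
move=> Mi; rewrite row_mul mulmx_sum_row /rowz; case: insubP => [k' _ kE|].
  rewrite (bigD1 k') //= !mxE Mi kE eqxx scale1r big1 ?addr0 // => j jk.
  by rewrite !mxE Mi -kE eq_sym val_eqE (negPf jk) scale0r.
rewrite -leqNgt => mk; apply: big1 => j _; rewrite !mxE Mi.
by rewrite gtn_eqF ?scale0r // (leq_trans _ mk).
Qed.

Lemma row_Rm1 e q (Y : 'M[F]_(e.+1, q)) (i : 'I_e) : row i (mxf e e.+1 (@Rm1 F) *m Y) = rowz Y i.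
Proof. by apply: row_mul_delta => j; rewrite mxE. Qed.

Lemma row_Rm2 e q (Y : 'M[F]_(e.+1, q)) (i : 'I_e) : row i (mxf e e.+1 (@Rm2 F) *m Y) = rowz Y i.+1.
Proof. by apply: row_mul_delta => j; rewrite mxE /Rm2 eq_sym. Qed.

Lemma row_Rm1T e q (Y : 'M[F]_(e, q)) (i : 'I_e.+1) : row i ((mxf e e.+1 (@Rm1 F))^T *m Y) = rowz Y i.
Proof. by apply: row_mul_delta => j; rewrite !mxE /Rm1 eq_sym. Qed.

Lemma row_Rm2T e q (Y : 'M[F]_(e, q)) (i : 'I_e.+1) :
  row i ((mxf e e.+1 (@Rm2 F))^T *m Y) = if i : nat is j.+1 then rowz Y j else 0.
Proof.
case: i => -[|i] ie /=; last by apply: row_mul_delta => j; rewrite !mxE /Rm2 /= eqSS.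
by rewrite row_mul mulmx_sum_row big1 // => j _; rewrite !mxE /Rm2 /= scale0r.
Qed.

Section EpsilonBlocks.
Variable e : nat.

Lemma sols_RmP q p (X1 X2 : 'M[F]_(q, p)) Y :
  reflect (forall k, (k < e)%N -> rowz Y k *m X1 = rowz Y k.+1 *m X2)
    (Y \in sols X1 X2 (mxf e e.+1 (@Rm1 F)) (mxf e e.+1 (@Rm2 F))).
Proof.
rewrite inE; apply: (iffP eqP) => [YE k ke|H].
  have /(congr1 (row (Ordinal ke))) := YE.
  by rewrite !row_mul -!(row_mul _ _ Y) row_Rm1 row_Rm2.
apply/row_matrixP => i; rewrite row_mul row_Rm1 H // row_mul row_Rm2 //.
Qed.

(** The rows satisfy [Y_k X1 = Y_(k-1) X2] with zero rows at both ends, so injectivity of [X1] kills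
    them from the first one on, and that of [X2] from the last one back. *)
Lemma card_sols_RmT q p (X1 X2 : 'M[F]_(q, p)) :
  (forall y : 'rV_q, y *m X1 = 0 -> y = 0) \/ (forall y : 'rV_q, y *m X2 = 0 -> y = 0) ->
  #|sols X1 X2 (mxf e e.+1 (@Rm1 F))^T (mxf e e.+1 (@Rm2 F))^T| = 1%N.
Proof.
move=> inj; apply: card_sols_unique => Y YE.
have rE (i : 'I_e.+1) : rowz Y i *m X1 = (if i : nat is j.+1 then rowz Y j else 0) *m X2.
  by rewrite -row_Rm1T -row_Rm2T -!row_mul YE.
have r0 : rowz Y 0 *m X1 = 0 by have := rE ord0; rewrite mul0mx.
have rS k : (k < e)%N -> rowz Y k.+1 *m X1 = rowz Y k *m X2.
  by move=> ke; have := rE (Ordinal (ke : (k.+1 < e.+1)%N)).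
case: inj => inj.
  apply: rowz_eq0; elim=> [|k IH] ke; first exact: inj.
  by apply: inj; rewrite rS ?IH ?mul0mx // ltnW.
suff H k : (k <= e)%N -> rowz Y (e - k) = 0.
  by apply: rowz_eq0 => k ke; rewrite -(subKn (ltnW ke)) H // leq_subr.
elim: k => [|k IH] ke; first by rewrite rowz_ge ?subn0.
have ek : (e - k.+1 < e)%N by lia.
by apply: inj; rewrite -(rS _ ek) subnSK // IH ?mul0mx // ltnW.
Qed.

(** The first row is free and determines the others. The count does not depend on [e], so
    epsilon-blocks contribute to [fin_weight] linearly in [d] and disappear from its second
    differences. *)
Lemma card_sols_Rm_C1 q (C : 'M[F]_q.+1) :
  #|sols C 1%:M (mxf e e.+1 (@Rm1 F)) (mxf e e.+1 (@Rm2 F))| = (#|F| ^ q.+1)%N.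
Proof.
rewrite -[RHS](_ : #|[set: 'rV[F]_q.+1]| = _); last by rewrite cardsT card_mx mul1n.
apply: (@card_bij _ _ _ _ (fun Y => rowz Y 0) (fun y => \matrix_(i < e.+1) (y *m C ^+ i))) => [Y /sols_RmP YE|y _].
  split; first by rewrite inE.
  have H k : (k < e.+1)%N -> rowz Y k = rowz Y 0 *m C ^+ k.
    elim: k => [|k IH] ke; first by rewrite mulmx1.
    by have := YE k ke; rewrite mulmx1 => <-; rewrite IH ?(ltnW ke) // -mulmxA exprSr.
  by apply/row_matrixP => i; rewrite rowK -H // rowz_ord.
split; last by rewrite (rowz_matrix (fun i => y *m C ^+ i)) // mulmx1.
apply/sols_RmP => k ke; rewrite !(rowz_matrix (fun i => y *m C ^+ i)) ?mulmx1 ?(leqW ke) //.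
by rewrite -mulmxA exprSr.
Qed.

Lemma card_sols_Rm_1C q (C : 'M[F]_q.+1) :
  #|sols 1%:M C (mxf e e.+1 (@Rm1 F)) (mxf e e.+1 (@Rm2 F))| = (#|F| ^ q.+1)%N.
Proof.
rewrite -[RHS](_ : #|[set: 'rV[F]_q.+1]| = _); last by rewrite cardsT card_mx mul1n.
apply: (@card_bij _ _ _ _ (fun Y => rowz Y e) (fun y => \matrix_(i < e.+1) (y *m C ^+ (e - i)))) => [Y /sols_RmP YE|y _].
  split; first by rewrite inE.
  have H k : (k <= e)%N -> rowz Y (e - k) = rowz Y e *m C ^+ k.
    elim: k => [|k IH] ke; first by rewrite mulmx1 subn0.
    have ek : (e - k.+1 < e)%N by lia.
    have := YE _ ek; rewrite mulmx1 subnSK // => ->.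
    by rewrite IH ?(ltnW ke) // -mulmxA exprSr.
  apply/row_matrixP => i; rewrite rowK -H ?leq_subr // subKn ?rowz_ord //.
  by rewrite -ltnS.
split; last by rewrite (rowz_matrix (fun i => y *m C ^+ (e - i))) // subnn mulmx1.
apply/sols_RmP => k ke; rewrite !(rowz_matrix (fun i => y *m C ^+ (e - i))) ?mulmx1 ?(leqW ke) //.
by rewrite -mulmxA -[_ *m C]/(_ * C) -exprSr subnSK.
Qed.

End EpsilonBlocks.

Lemma Rm1_inj n (y : 'rV[F]_n) : y *m mxf n n.+1 (@Rm1 F) = 0 -> y = 0.
Proof.
by move/(congr1 rVpoly); rewrite rVpoly_Rm1f linear0 => /eqP; rewrite rVpoly_eq0 => /eqP.
Qed.

(** The rows are polynomials [p_0, ..., p_e] of size at most [n] with [p_(k+1) = 'X * p_k], so the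
    only freedom is [p_0] of size at most [n - e]. *)
Lemma card_sols_Rm_eps e n :
  #|sols (mxf n n.+1 (@Rm2 F)) (mxf n n.+1 (@Rm1 F)) (mxf e e.+1 (@Rm1 F)) (mxf e e.+1 (@Rm2 F))|
    = (#|F| ^ (n - e))%N.
Proof.
rewrite -[RHS](_ : #|[set: 'rV[F]_(n - e)]| = _); last by rewrite cardsT card_mx mul1n.
have sz m (c : 'rV[F]_m) : (size (rVpoly c) <= m)%N by apply: size_poly.
have szX (p : {poly F}) k : p != 0 -> size ('X^k * p) = (k + size p)%N.
  by move=> p0; rewrite mulrC size_mulXn.
have szi (c : 'rV[F]_(n - e)) k : (k <= e)%N -> (size ('X^k * rVpoly c)%R <= n)%N.
  move=> ke; have [->|c0] := eqVneq (rVpoly c) 0; first by rewrite mulr0 size_poly0.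
  rewrite szX //; have := sz _ c; rewrite -size_poly_gt0 in c0; move: c0.
  by case: (size _) => // a _; lia.
apply: (@card_bij _ _ _ _ (fun Y => poly_rV (rVpoly (rowz Y 0)) : 'rV_(n - e))
  (fun c => \matrix_(i < e.+1) (poly_rV ('X^i * rVpoly c) : 'rV_n))) => [Y /sols_RmP YE|c _].
  split; first by rewrite inE.
  have H k : (k <= e)%N -> rVpoly (rowz Y k) = 'X^k * rVpoly (rowz Y 0).
    elim: k => [|k IH] ke; first by rewrite expr0 mul1r.
    have /(congr1 rVpoly) := YE k ke; rewrite rVpoly_Rm2f rVpoly_Rm1f => <-.
    by rewrite IH ?(ltnW ke) // exprSr; ring.
  have s0 : (size (rVpoly (rowz Y 0)) <= n - e)%N.
    have [->|c0] := eqVneq (rVpoly (rowz Y 0)) 0; first by rewrite size_poly0.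
    by have := sz _ (rowz Y e); rewrite H // szX //; move: (size _) => a; lia.
  apply/row_matrixP => i; rewrite rowK poly_rV_K // -H -1?ltnS // rVpolyK.
  by rewrite rowz_ord.
split; last by rewrite (rowz_matrix (fun i => poly_rV ('X^i * rVpoly c))) // expr0 mul1r poly_rV_K ?rVpolyK // (leq_trans (sz _ c)) ?leq_subr.
apply/sols_RmP => k ke; rewrite !(rowz_matrix (fun i => poly_rV ('X^i * rVpoly c))) ?(leqW ke) //.
apply: (can_inj (@rVpolyK _ _)); rewrite rVpoly_Rm2f rVpoly_Rm1f !poly_rV_K ?szi ?(ltnW ke) //.
by rewrite exprSr; ring.
Qed.

Lemma rVpoly_row_mul m n (M : 'M[F]_m) (Y : 'M[F]_(m, n)) i :
  rVpoly (row i (M *m Y)) = \sum_j M i j *: rVpoly (row j Y).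
Proof.
rewrite row_mul mulmx_sum_row linear_sum /=; apply: eq_bigr => j _.
by rewrite linearZ /= mxE.
Qed.

(** Multiplying a row by ['X] yields a combination of the rows, so any common bound on the sizes of
    the rows can be lowered by one. *)
Lemma eps_sols_degree m n (M : 'M[F]_m) (Y : 'M[F]_(m, n)) :
  Y *m mxf n n.+1 (@Rm2 F) = M *m Y *m mxf n n.+1 (@Rm1 F) -> Y = 0.
Proof.
move=> YE; have H i : rVpoly (row i Y) * 'X = \sum_j M i j *: rVpoly (row j Y).
  by rewrite -rVpoly_row_mul -rVpoly_Rm2f -row_mul YE row_mul rVpoly_Rm1f.
have S k : forall i, (size (rVpoly (row i Y)) <= n - k)%N.
  elim: k => [|k IH] i; first by rewrite subn0; apply: size_poly.
  have [->|c0] := eqVneq (rVpoly (row i Y)) 0; first by rewrite size_poly0.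
  suff : (size (rVpoly (row i Y) * 'X)%R <= n - k)%N.
    by rewrite size_mulX //; move: (size _) => a; lia.
  rewrite H (leq_trans (size_sum _ _ _)) //; apply/bigmax_leqP => j _.
  exact: leq_trans (size_scale_leq _ _) (IH j).
apply/row_matrixP => i; rewrite row0; apply/eqP.
by rewrite -rVpoly_eq0 -size_poly_eq0 -leqn0 -[0%N](subnn n) S.
Qed.

(** Each row is ['X] times a combination of the rows, hence divisible by every power of ['X]. *)
Lemma eps_sols_order m n (M : 'M[F]_m) (Y : 'M[F]_(m, n)) :
  M *m Y *m mxf n n.+1 (@Rm2 F) = Y *m mxf n n.+1 (@Rm1 F) -> Y = 0.
Proof.
move=> YE; have H i : rVpoly (row i Y) = (\sum_j M i j *: rVpoly (row j Y)) * 'X.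
  by rewrite -rVpoly_row_mul -rVpoly_Rm2f -row_mul YE row_mul rVpoly_Rm1f.
have S k : forall i, 'X^k %| rVpoly (row i Y).
  elim: k => [|k IH] i; first by rewrite expr0 dvd1p.
  rewrite H exprSr dvdp_mul2r ?polyX_eq0 //.
  elim/big_ind: _ => [|p q|j _]; [exact: dvdp0|exact: dvdp_add|].
  by rewrite -mul_polyC dvdp_mull.
apply/row_matrixP => i; rewrite row0; apply/eqP; rewrite -rVpoly_eq0; apply: contraT => c0.
have := dvdp_leq c0 (S n i); rewrite size_polyXn ltnNge.
by rewrite [X in ~~ X](_ : _ = true) //; apply: size_poly.
Qed.

End Tests.

Section Uniqueness.
Variable F : finFieldType.
Implicit Types (g : {poly {poly F}}) (k : key F).

(* [weight_test w]: for a suitable test pencil, the number of homomorphisms to a block [k]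
   is [#|F| ^ w k]. The second differences in [d] of [fin_weight g d] and of
   [eps_weight d] are supported on a single block. *)
Definition fin_weight g d k : nat := (match k.1 with
  | None => d * formdeg g
  | Some g' => if g' == g then 2 * minn d k.2 * formdeg g else 0 end)%N.

Definition eps_weight n k : nat := (if k.1 is None then n.+1 - k.2 else 0)%N.

Definition weight_test (w : key F -> nat) : Prop :=
  exists q p (X1 X2 : 'M[F]_(q, p)), forall k, valid_key k ->
    #|sols X1 X2 (mx1 (Rblock k.1 k.2)) (mx2 (Rblock k.1 k.2))| = (#|F| ^ w k)%N.

Lemma sols_C1 q m (C : 'M[F]_q) (M : 'M[F]_m) :
  sols C 1%:M 1%:M M = [set Y | Y *m C == M *m Y].
Proof. by apply/setP => Y; rewrite !inE mul1mx mulmx1. Qed.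

Lemma sols_1C q m (C : 'M[F]_q) (M : 'M[F]_m) :
  sols 1%:M C M 1%:M = [set Y | Y *m C == M *m Y].
Proof. by apply/setP => Y; rewrite !inE mul1mx mulmx1 eq_sym. Qed.

Lemma card_sols_nil_C1 q m (C : 'M[F]_q.+1) (M : 'M[F]_m.+1) (k : nat) : M ^+ k = 0 ->
  #|sols C 1%:M M 1%:M| = 1%N.
Proof.
move=> Mk; apply: card_sols_unique => Y; rewrite mul1mx mulmx1 => YE.
by apply: (@mulmx_nil_eq0 _ _ _ M C Y k); [left|].
Qed.

Lemma card_sols_nil_1C q m (C : 'M[F]_q.+1) (M : 'M[F]_m.+1) (k : nat) : C ^+ k = 0 ->
  #|sols 1%:M C 1%:M M| = 1%N.
Proof.
move=> Ck; apply: card_sols_unique => Y; rewrite mul1mx mulmx1 => YE.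
by apply: (@mulmx_nil_eq0 _ _ _ M C Y k); [right|].
Qed.

Lemma coprime_dehom g g' d e : inP g -> inP g' -> g != X2 F -> g' != X2 F -> g' != g ->
  coprimep (dehom g ^+ d) (dehom g' ^+ e).
Proof.
move=> ig ig' gX gX' gg'.
have [_ mg irr hg] := inP_monic ig gX; have [_ mg' irr' hg'] := inP_monic ig' gX'.
apply/coprimep_expl/coprimep_expr; apply: contraNT gg' => nc.
have := irr.2 _ nc (dvdp_gcdl _ _); have := irr'.2 _ nc (dvdp_gcdr _ _).
rewrite eqp_sym => e1 e2; have : dehom g' %= dehom g by apply: eqp_trans e1 e2.
rewrite eqp_monic // => /eqP E.
by rewrite -(dehomK hg) -(dehomK hg') E.
Qed.

(** The test pencil comes from the block [(g, d)] itself. Nilpotency leaves no nonzero solution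
    between the infinite block and a finite one, and coprimality none between finite blocks of
    different polynomials. *)
Lemma fin_test g d : inP g -> (0 < d)%N -> weight_test (fin_weight g d).
Proof.
move=> ig d0; have [gX|gX] := eqVneq g (X2 F).
  subst g; case: d d0 => // d _.
  pose N : 'M[F]_d.+1 := (mxf d.+1 d.+1 (companion ('X^(d.+1) : {poly F}) d.+1))^T.
  have Nnil : N ^+ d.+1 = 0 by rewrite -trmx_exp companion_Xn_nil trmx0.
  have fd : formdeg (X2 F) = 1%N by rewrite /formdeg eqxx.
  exists d.+1, d.+1, 1%:M, N => -[[g'|] e] [/= e0 vk]; last first.
    case: e e0 {vk} => // e _; rewrite mx1_plus mx2_plus card_sols_plus.
    rewrite card_sols_Rm_1C card_sols_RmT; first by rewrite /fin_weight /= fd !muln1.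
    by left=> y; rewrite mulmx1.
  rewrite /fin_weight [_.1]/= [_.2]/=; have ig' := vk _ erefl; have [g'X|g'X] := eqVneq g' (X2 F).
    case: e e0 {vk} => // e _.
    rewrite fd muln1 /= mx1_plus mx2_plus card_sols_plus mxf_idf trmx1 !sols_1C.
    rewrite card_companion ?monicXn ?size_polyXn // card_tr_companion ?monicXn ?size_polyXn //.
    rewrite (@card_ker_pow _ _ _ _ _ 'X d.+1) ?monicXn ?size_polyXn ?size_polyX //.
    by rewrite muln1 -expnD addnn -mul2n.
  have [n [sn mn _]] := size_dehom_pow ig' g'X e0.
  rewrite /= sn /= mx1_plus mx2_plus card_sols_plus mxf_idf trmx1.
  by rewrite !(card_sols_nil_1C _ Nnil).
have [D [sD mD DE]] := size_dehom_pow ig gX d0.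
set f := dehom g ^+ d in sD mD.
pose C : 'M[F]_D.+1 := (mxf D.+1 D.+1 (companion f D.+1))^T.
exists D.+1, D.+1, C, 1%:M => -[[g'|] e] [/= e0 vk]; last first.
  case: e e0 {vk} => // e _; rewrite mx1_plus mx2_plus card_sols_plus.
  rewrite card_sols_Rm_C1 card_sols_RmT; first by rewrite /fin_weight /= -DE !muln1.
  by right=> y; rewrite mulmx1.
rewrite /fin_weight /=; have ig' := vk _ erefl; have [g'X|g'X] := eqVneq g' (X2 F).
  case: e e0 {vk} => // e _.
  have -> : (g' == g) = false by rewrite g'X eq_sym; apply/negbTE.
  rewrite /= mx1_plus mx2_plus card_sols_plus.
  rewrite mxf_idf trmx1 (card_sols_nil_C1 _ (companion_Xn_nil F e)).
  rewrite (@card_sols_nil_C1 _ _ _ _ e.+1) //.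
  by rewrite -trmx_exp companion_Xn_nil trmx0.
have [n [sn mn nE]] := size_dehom_pow ig' g'X e0.
rewrite /= sn /= mx1_plus mx2_plus card_sols_plus mxf_idf trmx1.
rewrite !sols_C1 card_companion // card_tr_companion //.
case: eqP => [gg|/eqP gg].
  have [_ _ [sg _] _] := inP_monic ig gX.
  rewrite gg (@card_ker_pow _ f _ _ _ (dehom g) d) // -expnD addnn -mul2n mulnA.
  by rewrite /formdeg (negPf gX).
by rewrite card_ker_coprime //; apply: coprime_dehom.
Qed.

Lemma eps_test n : weight_test (eps_weight n).
Proof.
exists n, n.+1, (mxf n n.+1 (@Rm2 F)), (mxf n n.+1 (@Rm1 F)) => -[[g'|] e] [/= e0 vk]; last first.
  case: e e0 {vk} => // e _; rewrite mx1_plus mx2_plus card_sols_plus.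
  rewrite card_sols_Rm_eps card_sols_RmT ?muln1 //.
  by right=> y; apply: Rm1_inj.
rewrite /eps_weight /=; have [g'X|g'X] := eqVneq g' (X2 F).
  rewrite /= mx1_plus mx2_plus card_sols_plus mxf_idf trmx1.
  by rewrite !card_sols_unique // => Y; rewrite mul1mx; apply: eps_sols_order.
rewrite /= mx1_plus mx2_plus card_sols_plus mxf_idf trmx1.
by rewrite !card_sols_unique // => Y; rewrite mul1mx; apply: eps_sols_degree.
Qed.

Lemma card_sols_Ablocks q p (X1 X2 : 'M[F]_(q, p)) (w : key F -> nat) (s : seq (key F)) :
  (forall k, valid_key k ->
    #|sols X1 X2 (mx1 (Rblock k.1 k.2)) (mx2 (Rblock k.1 k.2))| = (#|F| ^ w k)%N) ->
  (forall k, k \in s -> valid_key k) ->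
  #|sols X1 X2 (mx1 (Ablocks s)) (mx2 (Ablocks s))| = (#|F| ^ \sum_(k <- s) w k)%N.
Proof.
move=> H; elim: s => [|k s IH] vs; first by rewrite big_nil card_sols0.
have vk : valid_key k by apply: vs; rewrite mem_head.
have {}IH := IH (fun k' k's => vs k' (mem_behead (s := k :: s) k's)).
by rewrite big_cons expnD [Ablocks _]/= mx1_dsum mx2_dsum card_sols_diag IH H.
Qed.

Lemma weight_test_eq w (s s' : seq (key F)) : weight_test w ->
  (forall k, k \in s -> valid_key k) -> (forall k, k \in s' -> valid_key k) ->
  pcong (mx1 (Ablocks s)) (mx2 (Ablocks s)) (mx1 (Ablocks s')) (mx2 (Ablocks s')) ->
  \sum_(k <- s) w k = \sum_(k <- s') w k.
Proof.
move=> [q [p [X1 [X2 H]]]] vs vs' /(card_sols_pcong X1 X2).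
rewrite !(card_sols_Ablocks H) // => /eqP.
by rewrite eqn_exp2l ?card_finNzRing_gt1 // => /eqP.
Qed.

(** The second difference [w2 - 2 w1 + w0] is [c' - c] at [k0] and 0 elsewhere. Having two constants
    avoids subtraction in [nat] and allows both signs. *)
Lemma count_second_difference (w0 w1 w2 : key F -> nat) c c' k0 (s s' : seq (key F)) : c != c' ->
  (forall k, valid_key k -> (w2 k + w0 k + c * (k == k0) = 2 * w1 k + c' * (k == k0))%N) ->
  (forall k, k \in s -> valid_key k) -> (forall k, k \in s' -> valid_key k) ->
  (\sum_(k <- s) w0 k = \sum_(k <- s') w0 k)%N ->
  (\sum_(k <- s) w1 k = \sum_(k <- s') w1 k)%N ->
  (\sum_(k <- s) w2 k = \sum_(k <- s') w2 k)%N ->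
  count_mem k0 s = count_mem k0 s'.
Proof.
move=> c0 H vs vs' e0 e1 e2.
have E (r : seq (key F)) : (forall k, k \in r -> valid_key k) ->
    (\sum_(k <- r) w2 k + \sum_(k <- r) w0 k + c * count_mem k0 r =
     2 * \sum_(k <- r) w1 k + c' * count_mem k0 r)%N.
  elim: r => [|k r IH] vr; first by rewrite !big_nil /=; lia.
  have vk : valid_key k by apply: vr; rewrite mem_head.
  have := IH (fun k' k's => vr k' (mem_behead (s := k :: r) k's)).
  have := H _ vk; rewrite !big_cons /=; lia.
have := E _ vs; have := E _ vs'; rewrite e0 e1 e2.
by move: c0 (count_mem k0 s) (count_mem k0 s'); case: ltngtP => // + _ n n'; case: (ltngtP n n') => //; nia.
Qed.

Theorem kronecker_unique (s s' : seq (key F)) :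
  (forall k, k \in s -> valid_key k) -> (forall k, k \in s' -> valid_key k) ->
  pcong (mx1 (Ablocks s)) (mx2 (Ablocks s)) (mx1 (Ablocks s')) (mx2 (Ablocks s')) ->
  forall k, count_mem k s = count_mem k s'.
Proof.
move=> vs vs' cs k; have [vk|nvk] := pselect (valid_key k); last first.
  have /count_memPn -> : k \notin s by apply/negP => /vs.
  by have /count_memPn -> : k \notin s' by apply/negP => /vs'.
have W w (tw : weight_test w) := weight_test_eq tw vs vs' cs.
case: k vk => -[g|] d [/= d0 ig].
  have {}ig := ig _ erefl.
  have dg0 : (0 < formdeg g)%N.
    rewrite /formdeg; case: eqVneq => // gX.
    by have [_ _ [sg _] _] := inP_monic ig gX; rewrite -subn1 subn_gt0.
  (* For [d = 1] the index is 0, outside the range of [fin_test], but then the weight is identically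
     0. *)
  have W0 : (\sum_(k <- s) fin_weight g d.-1 k = \sum_(k <- s') fin_weight g d.-1 k)%N.
    case: d d0 => [|[|d]] // _; last by apply: W; apply: fin_test.
    by rewrite !big1 // => -[[g'|] e] _; rewrite /fin_weight /= ?min0n ?muln0 ?mul0n ?if_same.
  (* As a function of [d], [minn d e] is concave with a single kink at [d = e], where its second
     difference is -1. *)
  apply: (@count_second_difference (fin_weight g d.-1) (fin_weight g d) (fin_weight g d.+1) (2 * formdeg g)%N 0) => //.
  - by rewrite -lt0n muln_gt0.
  - move=> [[g'|] e] [/= e0 _]; rewrite /fin_weight /= ?xpair_eqE /=; last first.
      by rewrite !muln0 !addn0 -mulnDl mulnA; congr (_ * _)%N; lia.
    rewrite -[Some g' == Some g]/(g' == g); case: eqP => _ /=; last by rewrite !muln0.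
    have -> : (2 * formdeg g * (e == d) = 2 * (e == d) * formdeg g)%N by rewrite mulnAC.
    rewrite mul0n addn0 -!mulnDl mulnA; congr (_ * _)%N.
    by case: eqP => ed /=; lia.
  - by apply: W; apply: fin_test.
  - by apply: W; apply: fin_test.
(* For [d = 1] the truncation of [d.-2] to 0 is harmless, since [1 - e] is 0 for every valid key. *)
apply: (@count_second_difference (eps_weight d.-2) (eps_weight d.-1) (eps_weight d) 0 1) => //; [|exact: W (eps_test _)..].
move=> [[g'|] e] [/= e0 _]; rewrite /eps_weight /= ?xpair_eqE /= ?mul1n ?mul0n //.
by case: eqP => ed; lia.
Qed.

End Uniqueness.

(** * Equivariance of the blocks *)

Section Equivariance.
Variable F : fieldType.
Implicit Types (g G : {poly {poly F}}) (p : {poly F}).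

Lemma pcong_pplus r s r' s' (A1 A2 : 'M[F]_(r, s)) (B1 B2 : 'M[F]_(r', s'))
    (S : 'M[F]_(r', r)) (S' : 'M[F]_(r, r')) (T : 'M[F]_(s, s')) (T' : 'M[F]_(s', s)) :
  S *m S' = 1%:M -> S' *m S = 1%:M -> T *m T' = 1%:M -> T' *m T = 1%:M ->
  S *m A1 *m T = B1 -> S *m A2 *m T = B2 ->
  pcong (pplus A1) (pplus A2) (pplus B1) (pplus B2).
Proof.
move=> SS SS' TT TT' <- <-; exists (block_mx S 0 0 T^T), (block_mx S' 0 0 T'^T).
split.
- by rewrite mulmx_block !(mulmx0, mul0mx, addr0, add0r) SS -trmx_mul TT' trmx1 -scalar_mx_block.
- by rewrite mulmx_block !(mulmx0, mul0mx, addr0, add0r) SS' -trmx_mul TT trmx1 -scalar_mx_block.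
- rewrite /pplus tr_block_mx !trmx0 !mulmx_block !(mulmx0, mul0mx, addr0, add0r) trmxK.
  by rewrite !trmx_mul !mulmxA mulmxN mulNmx.
- rewrite /pplus tr_block_mx !trmx0 !mulmx_block !(mulmx0, mul0mx, addr0, add0r) trmxK.
  by rewrite !trmx_mul !mulmxA mulmxN mulNmx.
Qed.

Lemma pplus_comb r s a b (A B : 'M[F]_(r, s)) :
  a *: pplus A + b *: pplus B = pplus (a *: A + b *: B).
Proof.
rewrite /pplus !scale_block_mx add_block_mx !scaler0 !addr0; congr block_mx.
by rewrite linearD !linearZ /= opprD !scalerN.
Qed.

Lemma homogenize_linear n a p q : homogenize n (a *: p + q) = cst a * homogenize n p + homogenize n q.
Proof.
apply/polyP => i; rewrite coefD mul_polyC coefZ !coef_poly; case: ifP => _; last by rewrite mulr0 addr0.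
by rewrite coefD coefZ scalerDl mul_polyC scalerA.
Qed.

Lemma homogenizeMX n p : homogenize n.+1 (p * 'X) = homogenize n p * X1 F.
Proof.
apply/polyP => -[|i]; by rewrite coefMX !coef_poly /= coefMX /= ?scale0r // ltnS.
Qed.

Lemma homogenizeS n p : (size p <= n.+1)%N -> homogenize n.+1 p = homogenize n p * X2 F.
Proof.
move=> sp; apply/polyP => i; rewrite mulrC mul_polyC coefZ !coef_poly.
have [ni|ni] := leqP i n.
  by rewrite !ltnS leqW ?ni // -scalerAr -exprS subSn.
have -> : (i < n.+1)%N = false by apply/negbTE; rewrite -leqNgt.
by rewrite mulr0 (leq_sizeP _ _ sp) // scale0r if_same.
Qed.

Variable Q : 'M[F]_2.

Definition subp n p : {poly F} := dehom (subst2 Q (homogenize n p)).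

Lemma subp_linear n a p q : subp n (a *: p + q) = a *: subp n p + subp n q.
Proof.
by rewrite /subp homogenize_linear subst2D subst2M subst2_cst dehomD dehomM dehom_cst mul_polyC.
Qed.

Lemma size_dehom n g : homog n g -> (size (dehom g) <= n.+1)%N.
Proof.
move=> hg; apply/leq_sizeP => i ni; rewrite coef_map_id0 ?horner0 //.
by rewrite (homog_coef0 hg) // horner0.
Qed.

Lemma size_subp n p : (size (subp n p) <= n.+1)%N.
Proof. by apply/size_dehom/homog_subst2/homog_hom. Qed.

Definition subv n (y : 'rV[F]_n.+1) : 'rV[F]_n.+1 := poly_rV (subp n (rVpoly y)).

Lemma subv_is_linear n : linear (@subv n).
Proof. by move=> a u v; rewrite /subv linearP /= subp_linear linearP. Qed.

HB.instance Definition _ n := GRing.isLinear.Build F 'rV[F]_n.+1 'rV[F]_n.+1 _ (@subv n) (@subv_is_linear n).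

Definition subst_mx n : 'M[F]_n.+1 := lin1_mx (@subv n).

Lemma rVpoly_subst_mx n (y : 'rV_n.+1) : rVpoly (y *m subst_mx n) = subp n (rVpoly y).
Proof. by rewrite mul_rV_lin1 /subv poly_rV_K ?size_subp. Qed.

Hypothesis uQ : Q \in unitmx.

Lemma subst_mx_unit n : subst_mx n \in unitmx.
Proof.
rewrite -row_free_unit -kermx_eq0; apply: contraT => /rowV0Pn[y /sub_kermxP yt y0].
have := rVpoly_subst_mx y; rewrite yt linear0 => /esym/eqP.
rewrite /subp (@dehom_eq0 _ n); last exact/homog_subst2/homog_hom.
rewrite subst2_eq0 // => /eqP h0; have := @homK F n (rVpoly y) (size_poly _ _).
rewrite h0 /dehom map_poly0 => /esym/eqP; by rewrite rVpoly_eq0 (negPf y0).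
Qed.

Lemma eq_mx_rVpoly a b (M N : 'M[F]_(a, b)) :
  (forall y : 'rV_a, rVpoly (y *m M) = rVpoly (y *m N)) -> M = N.
Proof.
by move=> H; apply/row_matrixP => i; apply: (can_inj (@rVpolyK _ _)); rewrite !rowE H.
Qed.

Lemma dehom_linform a b : dehom (linform a b) = a *: 'X + b%:P :> {poly F}.
Proof. by rewrite /linform dehomD !dehomM !dehom_cst dehom_X1 dehom_X2 mulr1 mul_polyC. Qed.

Let m1 n := mxf n n.+1 (Rm2 F).
Let m2 n := mxf n n.+1 (Rm1 F).

(* On coefficient vectors of binary forms, [m1] and [m2] multiply by [x1] and [x2], and
   [subst_mx] is the substitution [Q]. *)
Lemma mul_x1_subst_mx n :
  m1 n.+1 *m subst_mx n.+1 = subst_mx n *m (Q 0 0 *: m1 n.+1 + Q 0 1 *: m2 n.+1).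
Proof.
apply: eq_mx_rVpoly => y; rewrite !mulmxA mulmxDr -!scalemxAr linearD !linearZ /=.
rewrite rVpoly_subst_mx !rVpoly_Rm1 !rVpoly_Rm2 rVpoly_subst_mx /subp homogenizeMX subst2M dehomM.
by rewrite subst2_X1 dehom_linform mulrDr -scalerAr [_ * _%:P]mulrC mul_polyC.
Qed.

Lemma mul_x2_subst_mx n :
  m2 n.+1 *m subst_mx n.+1 = subst_mx n *m (Q 1 0 *: m1 n.+1 + Q 1 1 *: m2 n.+1).
Proof.
apply: eq_mx_rVpoly => y; rewrite !mulmxA mulmxDr -!scalemxAr linearD !linearZ /=.
rewrite rVpoly_subst_mx !rVpoly_Rm1 !rVpoly_Rm2 rVpoly_subst_mx /subp homogenizeS ?size_poly // subst2M dehomM.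
by rewrite subst2_X2 dehom_linform mulrDr -scalerAr [_ * _%:P]mulrC mul_polyC.
Qed.

Lemma mulmx_x1 n q (P : 'M[F]_(n.+1, q)) i j : (m1 n *m P) i j = P (lift ord0 i) j.
Proof.
rewrite mxE (bigD1 (lift ord0 i)) //= mxE /Rm2 eqxx mul1r big1 ?addr0 // => k ki.
rewrite mxE /Rm2; case: eqP => [kE|]; last by rewrite mul0r.
by case/eqP: ki; apply: val_inj.
Qed.

Lemma mulmx_x2 n q (P : 'M[F]_(n.+1, q)) i j :
  (m2 n *m P) i j = P (widen_ord (leqnSn n) i) j.
Proof.
rewrite mxE (bigD1 (widen_ord (leqnSn n) i)) //= mxE /Rm1 eqxx mul1r big1 ?addr0 // => k ki.
rewrite mxE /Rm1; case: eqP => [kE|]; last by rewrite mul0r.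
by case/eqP: ki; apply: val_inj.
Qed.

(* In [R_f = (I, F(f))] the variable [x2] corresponds to the first matrix and [x1] to
   the second one, whence the reversed indices of [Q]. *)
Definition pact (M : MP F) (N : MP F) : Prop :=
  pcong (Q 1 1 *: mx1 M + Q 1 0 *: mx2 M) (Q 0 1 *: mx1 M + Q 0 0 *: mx2 M) (mx1 N) (mx2 N).

Lemma pact_eps d : (0 < d)%N -> pact (Rblock None d) (Rblock None d).
Proof.
case: d => // e _; rewrite /pact mx1_plus mx2_plus !pplus_comb.
case: e => [|e].
  have z (M N : 'M[F]_(0, 1)) : M = N by apply/matrixP => -[].
  by rewrite (z (_ + _) (mxf 0 1 (Rm1 F))) (z (_ + _) (mxf 0 1 (Rm2 F))); apply: pcong_refl.
have u1 := subst_mx_unit e; have u2 := subst_mx_unit e.+1.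
apply: (@pcong_pplus _ _ _ _ _ _ _ _ (subst_mx e) (invmx (subst_mx e)) (invmx (subst_mx e.+1)) (subst_mx e.+1));
  rewrite ?mulmxV ?mulVmx //.
  by rewrite addrC -mul_x2_subst_mx mulmxK.
by rewrite addrC -mul_x1_subst_mx mulmxK.
Qed.

Definition pvec n G : 'rV[F]_n.+1 := poly_rV (dehom G).

(* The pencil [(R1, R2)] is multiplication by [(x2, x1)] from the forms of degree
   [n - 1] to the forms of degree [n] modulo [G]. *)
Definition represents G n (R1 R2 : 'M[F]_n) : Prop :=
  exists (S : 'M[F]_n) (P : 'M[F]_(n.+1, n)), [/\ S \in unitmx, row_full P, pvec n G *m P = 0,
    S *m R1 = m2 n *m P & S *m R2 = m1 n *m P].

(* Both [P] and [subst_mx n *m P'] are epimorphisms with kernel spanned by [G]. *)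
Lemma represents_act n G G' lam (R1 R2 R1' R2' : 'M[F]_n.+1) :
  G != 0 -> homog n.+1 G -> subst2 Q G = cst lam * G' ->
  represents G R1 R2 -> represents G' R1' R2' ->
  exists S T : 'M[F]_n.+1, [/\ S \in unitmx, T \in unitmx,
    S *m (Q 1 1 *: R1' + Q 1 0 *: R2') *m T = R1 &
    S *m (Q 0 1 *: R1' + Q 0 0 *: R2') *m T = R2].
Proof.
move=> G0 hG sG [S [P [uS fP GP SR1 SR2]]] [S' [P' [uS' fP' GP' SR1' SR2']]].
have Gt : pvec n.+1 G *m subst_mx n.+1 = lam *: pvec n.+1 G'.
  apply: (can_inj (@rVpolyK _ _)); rewrite rVpoly_subst_mx linearZ /= /pvec.
  have sG' : (size (lam *: dehom G')%R <= n.+2)%N.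
    have -> : lam *: dehom G' = dehom (subst2 Q G) by rewrite sG dehomM dehom_cst mul_polyC.
    exact/size_dehom/homog_subst2.
  rewrite -linearZ -linearZ /= !poly_rV_K ?size_dehom // /subp (dehomK hG) sG.
  by rewrite dehomM dehom_cst mul_polyC.
have pG0 : pvec n.+1 G != 0.
  by rewrite -rVpoly_eq0 poly_rV_K ?size_dehom // (dehom_eq0 hG).
have kP : (kermx P <= pvec n.+1 G)%MS.
  have sk : (pvec n.+1 G <= kermx P)%MS by apply/sub_kermxP.
  rewrite -(geq_leqif (mxrank_leqif_sup sk)) mxrank_ker (eqP fP) rank_rV pG0.
  by rewrite subSnn.
pose Y := subst_mx n.+1 *m P'; pose T := pinvmx P *m Y.
(* The substitution descends to the quotients: the kernel of [P] is the line of [G], which is sent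
   into that of [G'], killed by [P']. *)
have PT : P *m T = Y.
  apply/eqP; rewrite -subr_eq0 /T mulmxA -[X in _ - X]mul1mx -mulmxBl.
  have : (P *m pinvmx P - 1%:M <= kermx P)%MS.
    by apply/sub_kermxP; rewrite mulmxBl mul1mx -mulmxA mulVpmx // mulmx1 subrr.
  move/submx_trans/(_ kP)/submxP => [D ->].
  by rewrite -mulmxA /Y (mulmxA (pvec _ _)) Gt -scalemxAl GP' scaler0 mulmx0.
have uT : T \in unitmx.
  rewrite -row_full_unit /row_full eqn_leq rank_leq_row /=.
  apply: leq_trans (_ : \rank Y <= _)%N; last by rewrite -PT mxrankM_maxr.
  by rewrite /Y (eqmxMfull _ (_ : row_full (subst_mx n.+1))) ?row_full_unit ?subst_mx_unit // (eqP fP').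
have ut := subst_mx_unit n.
have E1 : S *m R1 *m T = subst_mx n *m S' *m (Q 1 1 *: R1' + Q 1 0 *: R2').
  rewrite SR1 -mulmxA PT /Y mulmxA mul_x2_subst_mx -mulmxA mulmxDl -!scalemxAl.
  by rewrite -SR1' -SR2' -mulmxA; congr (_ *m _); rewrite mulmxDr -!scalemxAr addrC.
have E2 : S *m R2 *m T = subst_mx n *m S' *m (Q 0 1 *: R1' + Q 0 0 *: R2').
  rewrite SR2 -mulmxA PT /Y mulmxA mul_x1_subst_mx -mulmxA mulmxDl -!scalemxAl.
  by rewrite -SR1' -SR2' -mulmxA; congr (_ *m _); rewrite mulmxDr -!scalemxAr addrC.
exists (invmx S *m (subst_mx n *m S')), (invmx T); split.
- by rewrite !unitmx_mul unitmx_inv uS ut uS'.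
- by rewrite unitmx_inv.
- by rewrite -!mulmxA (mulmxA (subst_mx n)) (mulmxA (subst_mx n *m S')) -E1 mulmxK // mulKmx.
- by rewrite -!mulmxA (mulmxA (subst_mx n)) (mulmxA (subst_mx n *m S')) -E2 mulmxK // mulKmx.
Qed.

(** Setting [x2 = 1], [P] reduces modulo [f] in the basis of powers of [x1]: its last row is the
    reduction of [x1^n]. Multiplication by [x2] is then the identity. *)
Lemma represents_fin g d n : inP g -> g != X2 F ->
  size (dehom g ^+ d) = n.+1 -> dehom g ^+ d \is monic ->
  represents (g ^+ d) (mxf n n (idf F))^T (mxf n n (companion (dehom g ^+ d) n))^T.
Proof.
move=> ig gX sf mf; set f := dehom g ^+ d in sf mf *.
pose P : 'M[F]_(n.+1, n) := \matrix_(i, j) ((i == j :> nat)%:R - (i == n :> nat)%:R * f`_j).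
have E2 : m2 n *m P = 1%:M.
  by apply/matrixP => i j; rewrite mulmx_x2 !mxE /= (ltn_eqF (ltn_ord i)) mul0r subr0.
exists 1%:M, P; split.
- exact: unitmx1.
- by apply/row_fullP; exists (m2 n).
- apply/rowP => j; rewrite !mxE big_ord_recr /= !mxE dehomXn -/f /=.
  have -> : f`_n = 1 by move/monicP: mf; rewrite lead_coefE sf.
  rewrite eqxx (gtn_eqF (ltn_ord j)) mul1r sub0r mul1r (bigD1 j) //= !mxE /= eqxx.
  rewrite (ltn_eqF (ltn_ord j)) mul0r subr0 mulr1 dehomXn -/f big1 ?addr0 ?subrr // => k kj.
  by rewrite !mxE /= (ltn_eqF (ltn_ord k)) mul0r subr0 (negPf kj : (k == j :> nat) = false) mulr0.
- by rewrite E2 mul1mx; apply/matrixP => i j; rewrite !mxE /idf eq_sym.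
- rewrite mul1mx; apply/matrixP => i j; rewrite mulmx_x1 !mxE /companion lift0.
  have -> : (i == n.-1 :> nat) = (i.+1 == n) by have := ltn_ord i; lia.
  by rewrite (eq_sym (j : nat)).
Qed.

(** Modulo [X2 ^+ n] the coordinates are exponents of [x2], while monomials are numbered by the
    exponent of [x1]. Hence the reversal [S], and [P] which drops the monomial [x2^n]. *)
Lemma represents_inf n :
  represents (X2 F ^+ n) (mxf n n (companion ('X^n : {poly F}) n))^T (mxf n n (idf F))^T.
Proof.
pose P : 'M[F]_(n.+1, n) := \matrix_(i, j) (i == n - j :> nat)%N%:R.
pose S : 'M[F]_n := \matrix_(i, j) (j == rev_ord i)%:R.
have rS q (M : 'M[F]_(n, q)) i : row i (S *m M) = row (rev_ord i) M.
  rewrite row_mul (_ : row i S = delta_mx 0 (rev_ord i)) -?rowE //.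
  by apply/rowP => j; rewrite !mxE eqxx.
have SS : S *m S = 1%:M.
  apply/row_matrixP => i; rewrite rS; apply/rowP => j.
  by rewrite !mxE rev_ordK eq_sym.
have E1 : S *m (mxf n n (idf F))^T = m1 n *m P.
  apply/matrixP => i j; have := congr1 (fun r : 'rV_n => r 0 j) (rS _ (mxf n n (idf F))^T i).
  rewrite [X in X = _]mxE => ->; rewrite mulmx_x1 !mxE /idf lift0 /=; congr (_%:R).
  by have := ltn_ord i; have := ltn_ord j; case: eqP; case: eqP => //; lia.
have uS : S \in unitmx by case/mulmx1_unit: SS.
exists S, P; split => //.
- apply/row_fullP; exists (S *m m1 n); rewrite -mulmxA -E1 mulmxA SS mul1mx.
  by apply/matrixP => i j; rewrite !mxE /idf eq_sym.
- apply/rowP => j; rewrite !mxE big1 // => k _; rewrite !mxE dehomXn dehom_X2 expr1n coef1.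
  by case: eqP => [->|]; rewrite ?mul0r // mul1r; case: eqP => //; have := ltn_ord j; lia.
- apply/matrixP => i j.
  have := congr1 (fun r : 'rV_n => r 0 j) (rS _ (mxf n n (companion ('X^n : {poly F}) n))^T i).
  rewrite [X in X = _]mxE => ->; rewrite mulmx_x2 !mxE /companion coefXn.
  rewrite (ltn_eqF (ltn_ord j)) mulr0 subr0 /=; congr (_%:R).
  by have := ltn_ord i; have := ltn_ord j; case: eqP; case: eqP => //; lia.
Qed.

Lemma Rblock_represents g d : inP g -> (0 < d)%N ->
  exists R1 R2 : nat -> nat -> F, let n := (d * formdeg g)%N in
   [/\ Rblock (Some g) d = mkPlus n n R1 R2, (0 < n)%N &
       represents (g ^+ d) (mxf n n R1)^T (mxf n n R2)^T].
Proof.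
move=> ig d0; have [gX|gX] := eqVneq g (X2 F).
  exists (companion 'X^d d), (@idf F); rewrite gX /formdeg eqxx muln1 Rblock_X2; split => //.
  exact: represents_inf.
have [n [sn mn nE]] := size_dehom_pow ig gX d0; rewrite -nE.
exists (@idf F), (companion (dehom g ^+ d) n.+1); rewrite Rblock_fin //= sn; split=> //.
exact: represents_fin.
Qed.

Lemma homog_formdeg g : inP g -> homog (formdeg g) g.
Proof.
rewrite /formdeg => ig; case: eqVneq => [->|gX]; first exact: homog_X2.
by have [] := inP_monic ig gX.
Qed.

Lemma pact_block g g' d : inP g -> actP Q g g' -> (0 < d)%N ->
  pact (Rblock (Some g') d) (Rblock (Some g) d).
Proof.
move=> ig [ig' [lam [lam0 gE]]] d0.
have g0 : g != 0 by case: ig => -[].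
have g'0 : g' != 0 by case: ig' => -[].
have dE : formdeg g' = formdeg g.
  apply: (homog_uniq g'0); first exact: homog_formdeg.
  have -> : g' = cst lam^-1 * subst2 Q g.
    by rewrite gE mulrA -cstM mulVf // /cst !polyC1 mul1r.
  exact: (homogM (@homog_cst _ _) (homog_subst2 (homog_formdeg ig))).
have [R1 [R2 [-> n0 rep]]] := Rblock_represents ig d0.
have [R1' [R2' [-> _ rep']]] := Rblock_represents ig' d0.
rewrite dE in rep' *.
have hG := @homogX _ _ _ d (homog_formdeg ig).
move: (d * formdeg g)%N n0 rep rep' hG => [|n] // _ rep rep' hG.
have gdE : subst2 Q (g ^+ d) = cst (lam ^+ d) * g' ^+ d.
  by rewrite subst2Xn gE exprMn /cst !rmorphXn.
have [S [T [uS uT E1 E2]]] := represents_act (expf_neq0 d g0) hG gdE rep rep'.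
rewrite /pact !mx1_plus !mx2_plus !pplus_comb.
apply: (@pcong_pplus _ _ _ _ _ _ _ _ T^T (invmx T^T) S^T (invmx S^T));
  rewrite ?mulmxV ?mulVmx ?unitmx_tr //.
  by apply: trmx_inj; rewrite !trmx_mul !trmxK linearD !linearZ /= mulmxA.
by apply: trmx_inj; rewrite !trmx_mul !trmxK linearD !linearZ /= mulmxA.
Qed.

Lemma pact_dsum M M' N N' : pact M M' -> pact N N' -> pact (dsum M N) (dsum M' N').
Proof.
rewrite /pact => c1 c2; rewrite !mx1_dsum !mx2_dsum !scale_block_mx !add_block_mx.
by rewrite !scaler0 !addr0; apply: pcong_dsum.
Qed.

Lemma pact_Ablocks (f : key F -> key F) (s : seq (key F)) :
  (forall k, k \in s -> pact (Rblock k.1 k.2) (Rblock (f k).1 (f k).2)) ->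
  pact (Ablocks s) (Ablocks (map f s)).
Proof.
elim: s => [_|k s IH H].
  rewrite /pact; have z (M N : 'M[F]_0) : M = N by apply/matrixP => -[].
  rewrite (z (_ + _) (mx1 (Ablocks [::]))) (z (_ + _) (mx2 (Ablocks [::]))); exact: pcong_refl.
apply: pact_dsum; first by apply: H; rewrite mem_head.
by apply: IH => k' k's; apply: H; rewrite inE k's orbT.
Qed.

End Equivariance.

(** * The bottom *)

Section QuasiCyclic.
Variable p : nat.
Hypothesis Hp : prime p.

Lemma ratintE q : ratint q = (q \is a Num.int).
Proof. by rewrite Qint_def. Qed.

Lemma p_rat_neq0 : (p%:R : rat) != 0.
Proof. by rewrite pnatr_eq0 -lt0n prime_gt0. Qed.

Lemma pdenP q : reflect (exists k, q * (p ^ k)%:R \is a Num.int) (pden p q).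
Proof.
apply: (iffP idP) => [/p_natP[k dk]|[k /intrP[z zE]]].
  exists k; have -> : q * (p ^ k)%:R = (numq q)%:~R; last exact: intr_int.
  by rewrite -dk numqE pmulrn gez0_abs.
apply: (@pnat_dvd _ (p ^ k)); last by rewrite pnatX pnat_id.
have : (numq q * (p ^ k)%:Z)%:~R = (z * denq q)%:~R :> rat.
  by rewrite !rmorphM /= -zE numqE -pmulrn mulrAC.
move/intr_inj/(congr1 absz); rewrite !abszM /= => E.
have : (`|denq q| %| `|numq q| * p ^ k)%N by rewrite E dvdn_mull.
by rewrite Gauss_dvdr // coprime_sym coprime_num_den.
Qed.

Lemma pden0 : pden p 0. Proof. by apply/pdenP; exists 0%N; rewrite mul0r. Qed.

Lemma pdenD a b : pden p a -> pden p b -> pden p (a + b).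
Proof.
move=> /pdenP[k ak] /pdenP[l bl]; apply/pdenP; exists (k + l)%N.
have -> : (a + b) * (p ^ (k + l))%:R =
    a * (p ^ k)%:R * (p ^ l)%:R + b * (p ^ l)%:R * (p ^ k)%:R :> rat.
  by rewrite expnD natrM; ring.
by rewrite rpredD // rpredM ?rpred_nat.
Qed.

Lemma pdenN a : pden p a -> pden p (- a).
Proof. by move=> /pdenP[k ak]; apply/pdenP; exists k; rewrite mulNr rpredN. Qed.

Lemma pdenMn a n : pden p a -> pden p (a *+ n).
Proof. by elim: n => [|n IH] ha; rewrite ?pden0 // mulrS pdenD ?IH. Qed.

Lemma pden_div a : pden p a -> pden p (a / p%:R).
Proof.
move=> /pdenP[k ak]; apply/pdenP; exists k.+1.
by rewrite expnS natrM mulrA divfK ?p_rat_neq0.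
Qed.

Lemma pden_Fp c : pden p (Fp_to_rat p c).
Proof.
apply/pdenP; exists 1%N; by rewrite /Fp_to_rat expn1 divfK ?p_rat_neq0.
Qed.

Lemma Fp_to_rat0 : Fp_to_rat p 0 = 0.
Proof. by rewrite /Fp_to_rat mul0r. Qed.

(** [Fp_to_rat] uses representatives below [p], so it is compatible with sums and multiples only
    modulo integers; those statements all reduce to this one. *)
Lemma Fp_to_rat_modn n : Fp_to_rat p n%:R - n%:R / p%:R \is a Num.int.
Proof.
rewrite /Fp_to_rat val_Fp_nat // {2}(divn_eq n p) natrD natrM mulrDl mulfK ?p_rat_neq0 //.
by rewrite opprD addrCA subrr addr0 rpredN rpred_nat.
Qed.

Lemma Fp_to_ratMn c n : Fp_to_rat p (c *+ n) - Fp_to_rat p c *+ n \is a Num.int.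
Proof.
have := Fp_to_rat_modn (c * n); rewrite natrM natr_Zp mulr_natr.
by rewrite /Fp_to_rat natrM mulrAC mulr_natr.
Qed.

Lemma Fp_to_ratD c d : Fp_to_rat p (c + d) - (Fp_to_rat p c + Fp_to_rat p d) \is a Num.int.
Proof.
have := Fp_to_rat_modn (c + d); rewrite natrD !natr_Zp.
by rewrite /Fp_to_rat natrD mulrDl.
Qed.

Lemma Fp_to_rat_int c : Fp_to_rat p c \is a Num.int -> c = 0.
Proof.
move=> /intrP[z]; rewrite /Fp_to_rat => /(canRL (divfK p_rat_neq0)).
rewrite !pmulrn -rmorphM /= => /intr_inj/(congr1 absz); rewrite abszM /= => cE.
have cp : (c < p)%N by rewrite -[X in (_ < X)%N](Fp_cast Hp) ltn_ord.
apply: val_inj => /=; rewrite cE; move: cp; rewrite cE; case: `|z|%N => [|k] //.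
by rewrite mulSn ltnNge leq_addr.
Qed.

Lemma Fp_to_rat_surj a : a * p%:R \is a Num.int -> exists c, a - Fp_to_rat p c \is a Num.int.
Proof.
move=> /intrP[z zE]; exists (z%:~R).
have p0 : (p%:Z != 0) by rewrite eqz_nat -lt0n prime_gt0.
have [n nE] : exists n : nat, (z %% p%:Z)%Z = n by exists `|(z %% p%:Z)%Z|%N; rewrite gez0_abs ?modz_ge0.
have zn : (z%:~R : 'F_p) = n%:R.
  rewrite (divz_eq z p) nE rmorphD rmorphM /= -[p%:Z%:~R]/(p%:R) pchar_Fp_0 // mulr0 add0r //.
have -> : a - Fp_to_rat p z%:~R = (z %/ p)%Z%:~R - (Fp_to_rat p n%:R - n%:R / p%:R).
  rewrite zn -[a](mulfK p_rat_neq0) zE {1}(divz_eq z p) nE rmorphD rmorphM /=.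
  by rewrite mulrDl mulfK ?p_rat_neq0 // opprB addrA.
by rewrite rpredB ?intr_int ?Fp_to_rat_modn.
Qed.

(* [c.1 a_1 + c.2 a_2], that is, the [p]-torsion of the bottom. *)
Definition ip (c : 'F_p * 'F_p) : rat * rat := (Fp_to_rat p c.1, Fp_to_rat p c.2).

Local Notation dom := (M2_dom p).
Local Notation ker := M2_ker.

Lemma M2_kerP a : ker a <-> a.1 \is a Num.int /\ a.2 \is a Num.int.
Proof. by rewrite /M2_ker !ratintE; split => [/andP|[-> ->]]. Qed.

Lemma ker0 : ker 0. Proof. by apply/M2_kerP; rewrite !rpred0. Qed.
Lemma kerN a : ker a -> ker (- a).
Proof. by move=> /M2_kerP[? ?]; apply/M2_kerP; rewrite !rpredN. Qed.
Lemma dom0 : dom 0. Proof. by apply/andP; split; apply: pden0. Qed.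
Lemma domD a b : dom a -> dom b -> dom (a + b).
Proof. by move=> /andP[? ?] /andP[? ?]; apply/andP; rewrite !pdenD. Qed.
Lemma domN a : dom a -> dom (- a).
Proof. by move=> /andP[? ?]; apply/andP; rewrite !pdenN. Qed.
Lemma domMn a n : dom a -> dom (a *+ n).
Proof. by elim: n => [|n IH] ha; [apply: dom0|rewrite mulrS; apply: domD => //; apply: IH]. Qed.
Lemma dom_ip c : dom (ip c). Proof. by apply/andP; rewrite !pden_Fp. Qed.

Lemma pairMn (V W : nmodType) (x : V * W) n : x *+ n = (x.1 *+ n, x.2 *+ n).
Proof. by elim: n => // n IH; rewrite !mulrS IH. Qed.

Lemma divp_mulrn a : a / p%:R *+ p = a :> rat.
Proof. by rewrite -mulr_natr divfK ?p_rat_neq0. Qed.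

Lemma dom_divp a : dom a -> exists2 b, dom b & b *+ p = a.
Proof.
case: a => a1 a2 /andP[/= h1 h2]; exists (a1 / p%:R, a2 / p%:R).
  by apply/andP; rewrite !pden_div.
by rewrite pairMn /= !divp_mulrn.
Qed.

Lemma ip0 : ip 0 = 0. Proof. by rewrite /ip !Fp_to_rat0. Qed.

Lemma ipD c d : ker (ip (c + d) - (ip c + ip d)).
Proof. by apply/M2_kerP; split; apply: Fp_to_ratD. Qed.

Lemma ker_ip c : ker (ip c) -> c = 0.
Proof. by case: c => c1 c2 /M2_kerP[/Fp_to_rat_int /= -> /Fp_to_rat_int /= ->]. Qed.

Lemma ip_surj a : ker (a *+ p) -> exists c, ker (a - ip c).
Proof.
rewrite pairMn => /M2_kerP[/=]; rewrite -(mulr_natr a.1) -(mulr_natr a.2).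
move=> /Fp_to_rat_surj[c1 h1] /Fp_to_rat_surj[c2 h2].
by exists (c1, c2); apply/M2_kerP.
Qed.

Lemma ker_ip_p c : ker (ip c *+ p).
Proof.
by rewrite pairMn; apply/M2_kerP; rewrite /= /Fp_to_rat !divp_mulrn !rpred_nat.
Qed.

End QuasiCyclic.

Arguments ip p c : clear implicits.

(** * Centrality of the bottom and Baer's trick *)

Section GroupLaws.
Variable G : Grp.
Local Notation "x ** y" := (@gmul G x y) (at level 40, left associativity).
Local Notation inv := (@ginv G).
Local Notation one := (gone G).
Implicit Types x y z : G.

Lemma gmulKl x y : inv x ** (x ** y) = y.
Proof. by rewrite gmulA gmulV gmul1. Qed.

Lemma gmul_injl x y z : x ** y = x ** z -> y = z.
Proof. by move=> H; rewrite -(gmulKl x y) H gmulKl. Qed.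

Lemma gmulVr x : x ** inv x = one.
Proof.
by rewrite -[LHS]gmul1 -{1}(gmulV (inv x)) -gmulA (gmulKl x) gmulV.
Qed.

Lemma gmulr1 x : x ** one = x.
Proof. by rewrite -(gmulV x) gmulA gmulVr gmul1. Qed.

Lemma gmulKVl x y : x ** (inv x ** y) = y.
Proof. by rewrite gmulA gmulVr gmul1. Qed.

Lemma gmulKr x y : y ** x ** inv x = y.
Proof. by rewrite -gmulA gmulVr gmulr1. Qed.

Lemma gmul_injr x y z : y ** x = z ** x -> y = z.
Proof. by move=> H; rewrite -(gmulKr x y) H gmulKr. Qed.

Lemma ginvM x y : inv (x ** y) = inv y ** inv x.
Proof.
by apply: (@gmul_injl (x ** y)); rewrite gmulVr gmulA -(gmulA x) gmulVr gmulr1 gmulVr.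
Qed.

Lemma ginvK x : inv (inv x) = x.
Proof. by apply: (@gmul_injl (inv x)); rewrite gmulVr gmulV. Qed.

Lemma ginv1 : inv one = one.
Proof. by rewrite -[LHS]gmul1 gmulVr. Qed.

Lemma gcommE x y : x ** y = y ** x ** gcomm x y.
Proof. by rewrite /gcomm !gmulA gmulKr gmulVr gmul1. Qed.

Lemma gcommP x y c : x ** y = y ** x ** c -> gcomm x y = c.
Proof. by rewrite gcommE => /gmul_injl. Qed.

Lemma gexpS x n : gexp x n.+1 = x ** gexp x n. Proof. by []. Qed.

Lemma gexp_commute x y n : x ** y = y ** x -> gexp x n ** y = y ** gexp x n.
Proof.
move=> xy; elim: n => [|n IH]; first by rewrite gmul1 gmulr1.
by rewrite gexpS -gmulA IH !gmulA xy.
Qed.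

Lemma gexpSr x n : gexp x n.+1 = gexp x n ** x.
Proof. by rewrite gexpS gexp_commute. Qed.

Lemma gexpM x y n : x ** y = y ** x -> gexp (x ** y) n = gexp x n ** gexp y n.
Proof.
move=> xy; elim: n => [|n IH]; first by rewrite gmul1.
rewrite !gexpS IH -!gmulA; congr (_ ** _); rewrite !gmulA; congr (_ ** _).
by rewrite gexp_commute.
Qed.

Lemma gexp1n n : gexp one n = one :> G.
Proof. by elim: n => // n IH; rewrite gexpS IH gmul1. Qed.

End GroupLaws.

Section Central.
Variables (p : nat) (G : Grp).
Local Notation "x ** y" := (@gmul G x y) (at level 40, left associativity).
Local Notation inv := (@ginv G).
Local Notation one := (gone G).
Variables (B : G -> Prop).
Hypothesis nB : is_normal B.
Hypothesis abB : forall x y, B x -> B y -> x ** y = y ** x.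
Hypothesis divB : forall x, B x -> exists2 y, B y & gexp y p = x.
Hypothesis expB : forall x, B (gexp x p).
Hypothesis nil : grp_nilpotent G.

Let B1 : B one. Proof. by case: nB => -[]. Qed.
Let BM x y : B x -> B y -> B (x ** y). Proof. by case: nB => -[? H ?] _; apply: H. Qed.
Let BV x : B x -> B (inv x). Proof. by case: nB => -[? ? H] _; apply: H. Qed.
Let BJ x y : B y -> B (inv x ** y ** x). Proof. by case: nB => _; apply. Qed.
Let BX x n : B x -> B (gexp x n).
Proof. by move=> Bx; elim: n => [|n IH]; [apply: B1|apply: BM]. Qed.

Variable x : G.
Definition defect b := gcomm b x.
Local Notation N := defect.

Let NB b : B b -> B (N b).
Proof. by move=> Bb; rewrite /defect /gcomm -!gmulA; apply: BM; [apply: BV|rewrite gmulA; apply: BJ]. Qed.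

Let conjE b : inv x ** b ** x = b ** N b.
Proof. by rewrite /defect /gcomm !gmulA gmulVr gmul1. Qed.

Let NM b c : B b -> B c -> N (b ** c) = N b ** N c.
Proof.
move=> Bb Bc; apply: (@gmul_injl _ (b ** c)); rewrite -conjE.
have -> : b ** c ** (N b ** N c) = (b ** N b) ** (c ** N c).
  have := abB Bc (NB Bb); move: (N b) (N c) => u v uc.
  by rewrite -!gmulA (gmulA c) uc !gmulA.
by rewrite -!conjE !gmulA gmulKr.
Qed.

Let NX b n : B b -> N (gexp b n) = gexp (N b) n.
Proof.
move=> Bb; elim: n => [|n IH]; first by rewrite /defect /gcomm ginv1 gmul1 /= gmulr1 gmulV.
by rewrite !gexpS NM ?IH //; apply: BX.
Qed.

Let iterNB k b : B b -> B (iter k N b).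
Proof. by move=> Bb; elim: k => // k IH; apply: NB. Qed.

Let iterNX k b n : B b -> iter k N (gexp b n) = gexp (iter k N b) n.
Proof. by move=> Bb; elim: k => // k IH; rewrite !iterS IH NX //; apply: iterNB. Qed.

(* [x] acts on [B] as the unipotent [1 + N]; on vectors killed by [N ^ 2] its
   [p]-th power, which is trivial, is [1 + p N]. *)
Let conj_iter b j : inv (gexp x j) ** b ** gexp x j = iter j (fun c => inv x ** c ** x) b.
Proof.
elim: j => [|j IH]; first by rewrite /= ginv1 gmul1 gmulr1.
by rewrite iterS -IH gexpSr ginvM !gmulA.
Qed.

Let N2_torsion b : B b -> N (N b) = one -> gexp (N b) p = one.
Proof.
move=> Bb NN; have H j : iter j (fun c => inv x ** c ** x) b = b ** gexp (N b) j.
  elim: j => [|j IH]; first by rewrite /= gmulr1.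
  rewrite iterS IH conjE NM //; last exact/BX/NB.
  rewrite NX ?NN ?gexp1n ?gmulr1; last exact: NB.
  rewrite gexpS -gmulA; congr (_ ** _); apply: gexp_commute => //.
have := H p; rewrite -conj_iter; move: (expB x) => Bx.
rewrite -gmulA (abB Bb Bx) gmulKl => bE.
by apply: (@gmul_injl _ b); rewrite -bE gmulr1.
Qed.

(** Iterated commutators with [x] lie in the lower central series, so some power of [N] is trivial
    on [B]. If [N ^ (k + 2)] is trivial, the values of [N ^ (k + 1)] are killed by [p]; it is then
    trivial on [p]-th powers, which exhaust [B] by divisibility. This lowers the exponent down to
    1. *)
Lemma nilpotent_central b : B b -> b ** x = x ** b.
Proof.
suff N1 c : B c -> N c = one by move=> Bb; rewrite gcommE -/(N b) N1 // gmulr1.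
have [k Nk] : exists k, forall b, B b -> iter k N b = one.
  have [m lc] := nil; exists m => b0 Bb0; apply: lc; elim: m => //= m IH.
  by move=> H _ HS; apply: HS; exists (iter m N b0), x.
elim: k Nk c => [|k IH] Nk c Bc.
  by have := Nk _ (NB Bc).
case: k IH Nk => [|k] IH Nk; first exact: Nk.
apply: IH Bc => b0 Bb0; have [c' Bc' <-] := divB Bb0.
rewrite iterNX // iterS; apply: N2_torsion; first exact: iterNB.
exact: Nk c' Bc'.
Qed.

End Central.

Section ClassTwo.
Variable G : Grp.
Local Notation "x ** y" := (@gmul G x y) (at level 40, left associativity).
Local Notation inv := (@ginv G).
Local Notation one := (gone G).
Implicit Types x y z : G.

Definition gcentral z := forall x, z ** x = x ** z.

Lemma gcentral_exp z n : gcentral z -> gcentral (gexp z n).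
Proof. by move=> cz x; apply: gexp_commute. Qed.

Lemma gexp_add x m n : gexp x (m + n) = gexp x m ** gexp x n.
Proof. by elim: m => [|m IH]; rewrite ?gmul1 // addSn !gexpS IH gmulA. Qed.

Lemma gexp_inv x n : gexp (inv x) n = inv (gexp x n).
Proof. by elim: n => [|n IH]; rewrite ?ginv1 // gexpS gexpSr ginvM IH. Qed.

Hypothesis class2 : forall x y, gcentral (gcomm x y).

Lemma gcomm_inv x y : gcomm y x = inv (gcomm x y).
Proof. by apply: gcommP; rewrite (gcommE x y) gmulKr. Qed.

Lemma gcommMl x y z : gcomm (x ** y) z = gcomm x z ** gcomm y z.
Proof.
apply: gcommP; rewrite -gmulA (gcommE y z) !gmulA (gcommE x z).
by rewrite -(gmulA _ (gcomm x z) y) (class2 x z y) !gmulA.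
Qed.

Lemma gcommMr x y z : gcomm x (y ** z) = gcomm x y ** gcomm x z.
Proof.
rewrite [LHS]gcomm_inv gcommMl ginvM (gcomm_inv x y) (gcomm_inv x z) !ginvK.
exact: class2.
Qed.

Lemma gcommXl x n z : gcomm (gexp x n) z = gexp (gcomm x z) n.
Proof.
elim: n => [|n IH]; last by rewrite !gexpS gcommMl IH.
by apply: gcommP; rewrite gmul1 !gmulr1.
Qed.

Lemma gcomm_central z x : gcentral z -> gcomm z x = one.
Proof. by move=> cz; apply: gcommP; rewrite gmulr1 cz. Qed.

Lemma gcomm_centralr z x : gcentral z -> gcomm x z = one.
Proof. by move=> cz; apply: gcommP; rewrite gmulr1 cz. Qed.

Lemma gcommxx x : gcomm x x = one.
Proof. by apply: gcommP; rewrite gmulr1. Qed.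

End ClassTwo.

(** On commutators the exponent [h] acts as one half. The hypotheses form a single proposition so
    that a proof of it can index the type carrying the abelian structure. *)
Definition halvable_class2 (G : Grp) (h : nat) : Prop :=
  (forall x y : G, gcentral (gcomm x y)) /\
  (forall x y : G, gexp (gcomm x y) (h + h) = gcomm x y).

(* Baer's trick: halving the commutators, which are central, turns [G] into an
   abelian group with the same powers. *)
Definition baer (G : Grp) (h : nat) (H : halvable_class2 G h) : Type := gcar G.

Section Baer.
Variables (G : Grp) (h : nat) (H : halvable_class2 G h).
Local Notation "x ** y" := (@gmul G x y) (at level 40, left associativity).
Local Notation inv := (@ginv G).
Local Notation one := (gone G).
Let class2 := H.1.
Let halfK := H.2.

Definition badd (x y : baer H) : baer H := x ** y ** gexp (gcomm (y : G) x) h.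

Let cX (x y : G) n : gcentral (gexp (gcomm x y) n).
Proof. exact/gcentral_exp/class2. Qed.

Lemma badd_central (x z : G) : gcentral z -> badd x z = x ** z.
Proof. by move=> cz; rewrite /badd gcomm_central // gexp1n gmulr1. Qed.

Lemma baddA : associative badd.
Proof.
move=> x y z; rewrite /badd.
set c := gexp (gcomm (y : G) x) h; set d := gexp (gcomm (z : G) y) h.
have cc : gcentral c by apply: cX.
have cd : gcentral d by apply: cX.
rewrite !(gcommMl class2) !(gcommMr class2) (gcomm_central _ cd) (gcomm_centralr _ cc).
rewrite !gmulr1 (@gexpM _ (gcomm (y : G) x) (gcomm (z : G) x) _ (class2 y x _)).
rewrite (@gexpM _ (gcomm (z : G) x) (gcomm (z : G) y) _ (class2 z x _)).
rewrite -/c -/d; set e := gexp (gcomm (z : G) x) h.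
rewrite -!gmulA; congr (_ ** _); congr (_ ** _).
by rewrite [RHS]cc (cc e) (gmulA d) (cd e) !gmulA.
Qed.

Lemma baddC : commutative badd.
Proof.
move=> x y; rewrite /badd (gcommE x y) (gcomm_inv x y) gexp_inv.
move: (gcomm _ _) (halfK x y) => c cE; rewrite -!gmulA; congr (_ ** (_ ** _)).
by rewrite -{1}cE gexp_add -gmulA gmulVr gmulr1.
Qed.

Lemma badd0 : left_id (one : baer H) badd.
Proof.
move=> x; rewrite /badd gcomm_centralr ?gexp1n ?gmulr1 ?gmul1 // => z.
by rewrite gmul1 gmulr1.
Qed.

Lemma baddN : left_inverse (one : baer H) (inv : baer H -> baer H) badd.
Proof.
move=> x; rewrite /badd gmulV gmul1 (_ : gcomm _ _ = one) ?gexp1n //.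
by apply: gcommP; rewrite gmulr1 gmulVr gmulV.
Qed.

HB.instance Definition _ := gen_eqMixin (baer H).
HB.instance Definition _ := gen_choiceMixin (baer H).
HB.instance Definition _ := GRing.isZmodule.Build (baer H) baddA baddC badd0 baddN.

Implicit Types x y : baer H.

Lemma baer_add_central x (z : baer H) : gcentral (z : G) -> x + z = x ** z :> G.
Proof. exact: badd_central. Qed.

Lemma baer_mulrn x n : x *+ n = gexp (x : G) n.
Proof.
elim: n => // n IH; rewrite mulrS IH [LHS]/(badd _ _) /badd.
by rewrite (gcommXl class2) gcommxx !gexp1n gmulr1.
Qed.

Definition bcomm x y : baer H := gcomm (x : G) y.

Lemma baer_mul x y : (x ** y : baer H) = x + y + bcomm x y *+ h.
Proof.
rewrite baer_mulrn baer_add_central; last exact: cX.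
have -> : x + y = badd x y by [].
rewrite /badd -gmulA /bcomm (gcomm_inv x y) gexp_inv.
by rewrite gmulV gmulr1.
Qed.

Lemma bcommDl z : {morph bcomm^~ z : x y / x + y}.
Proof.
move=> x y; rewrite (@baer_add_central (bcomm x z)); last exact: class2.
have -> : x + y = badd x y by [].
by rewrite /bcomm /badd !(gcommMl class2) (gcomm_central _ (cX _ _ _)) gmulr1.
Qed.

Lemma bcommDr x : {morph bcomm x : y z / y + z}.
Proof.
move=> y z; rewrite (@baer_add_central (bcomm x y)); last exact: class2.
have -> : y + z = badd y z by [].
by rewrite /bcomm /badd !(gcommMr class2) (gcomm_centralr _ (cX _ _ _)) gmulr1.
Qed.

Lemma bcommN x y : bcomm y x = - bcomm x y.
Proof. exact: gcomm_inv. Qed.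

End Baer.

Section AdditiveMorphisms.
Variables (U V : zmodType) (f : U -> V).
Hypothesis fD : {morph f : x y / x + y}.

Lemma morphD0 : f 0 = 0.
Proof. by apply: (addrI (f 0)); rewrite -fD !addr0. Qed.

Lemma morphDN x : f (- x) = - f x.
Proof. by apply: (addrI (f x)); rewrite -fD !subrr morphD0. Qed.

Lemma morphDMn x n : f (x *+ n) = f x *+ n.
Proof. by elim: n => [|n IH]; rewrite ?morphD0 // !mulrS fD IH. Qed.

Lemma morphD_sum I (r : seq I) (P : pred I) (g : I -> U) :
  f (\sum_(i <- r | P i) g i) = \sum_(i <- r | P i) f (g i).
Proof. exact: (big_morph f fD morphD0). Qed.
End AdditiveMorphisms.

(** * Complements of a divisible subgroup *)

Section Complement.
Variables (V : zmodType) (p : nat) (B : V -> Prop).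
Hypothesis Hp : prime p.

Lemma Fp_mulrn (x : V) n : x *+ p = 0 -> x *+ (n%:R : 'F_p) = x *+ n.
Proof.
by move=> xp; rewrite val_Fp_nat // {2}(divn_eq n p) mulrnDr mulnC mulrnA xp mul0rn add0r.
Qed.

Lemma Fp_mulrnD (x : V) : x *+ p = 0 -> {morph (fun a : 'F_p => x *+ a) : a b / a + b}.
Proof.
move=> xp a b /=; rewrite -mulrnDr -(@Fp_mulrn x (a + b)) //.
by rewrite natrD !natr_Zp.
Qed.

Lemma Fp_charMn (a : 'F_p) : a *+ p = 0.
Proof. by rewrite -mulr_natr pchar_Fp_0 // mulr0. Qed.

Lemma row_charMn m (v : 'rV['F_p]_m) : v *+ p = 0.
Proof. by apply/rowP => j; rewrite mulmxnE Fp_charMn mxE. Qed.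

Hypothesis B0 : B 0.
Hypothesis BD : forall x y, B x -> B y -> B (x + y).
Hypothesis BN : forall x, B x -> B (- x).
Hypothesis divB : forall x, B x -> exists2 y, B y & y *+ p = x.
Hypothesis expB : forall x, B (x *+ p).
Variables (n : nat) (t : nat -> V).
Hypothesis finB : forall x, exists i, (i < n)%N /\ B (x - t i).

Let BB x y : B x -> B y -> B (x - y).
Proof. by move=> Bx By; apply: BD => //; apply: BN. Qed.

Let BMn x k : B x -> B (x *+ k).
Proof. by move=> Bx; elim: k => // k IH; rewrite mulrS; apply: BD. Qed.

Definition independent m (tau : 'rV['F_p]_m -> V) : Prop :=
  {morph tau : u v / u + v} /\ forall v, B (tau v) -> v = 0.

(** Distinct vectors have images in distinct cosets of [B], of which there are at most [n]. *)
Lemma independent_bound m tau : @independent m tau -> (p ^ m <= n)%N.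
Proof.
move=> [tD tB].
have ix v : {i : 'I_n | B (tau v - t i)}.
  by apply: cid; have [i [ni Bi]] := finB (tau v); exists (Ordinal ni).
have inj : injective (fun v => sval (ix v)).
  move=> v w /= E; apply/eqP; rewrite -subr_eq0; apply/eqP/tB.
  rewrite tD (morphDN tD); have := svalP (ix v); have := svalP (ix w); rewrite E => Bw Bv.
  by have := BB Bv Bw; rewrite opprB addrA subrK.
by have := leq_card _ inj; rewrite card_mx mul1n card_Fp // card_ord.
Qed.

(* A maximal independent family spans a complement because [B] is divisible: a vector
   outside [B + tau] can be corrected by [B] to have order [p]. *)
Lemma exists_complement : exists m (tau : 'rV['F_p]_m -> V),
  independent tau /\ forall x, exists v, B (x - tau v).
Proof.
pose Q m := `[< exists tau, @independent m tau >].
have Q0 : exists m, Q m.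
  exists 0%N; apply/asboolP; exists (fun=> 0); split=> [u v|v _]; first by rewrite addr0.
  by apply/rowP => -[].
have ubQ m : Q m -> (m <= n)%N.
  move=> /asboolP[tau /independent_bound]; apply: leq_trans.
  by apply: ltnW; apply: ltn_expl; apply: prime_gt1.
case: (ex_maxnP Q0 ubQ) => m /asboolP[tau [tD tB]] maxm.
exists m, tau; split => // x; apply: contrapT => nx.
have [y By yp] := divB (expB x); pose x' := x - y.
have x'p : x' *+ p = 0 by rewrite /x' mulrnBl yp subrr.
have xD := Fp_mulrnD x'p.
suff : Q (m + 1)%N by move/maxm; rewrite addn1 ltnn.
apply/asboolP; exists (fun u => tau (lsubmx u) + x' *+ (u 0 (rshift m 0) : 'F_p)).
split=> [u v|u Bu].
  by rewrite linearD tD mxE xD addrACA.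
set a : 'F_p := u 0 (rshift m 0) in Bu; have [a0|a0] := eqVneq a 0.
  rewrite a0 addr0 in Bu; rewrite -[u]hsubmxK (tB _ Bu).
  have -> : rsubmx u = 0 by apply/rowP => j; rewrite !mxE ord1 -/a a0.
  by rewrite row_mx0.
case: nx; exists (- (lsubmx u *+ (a^-1 : 'F_p))).
rewrite (morphDN tD) (morphDMn tD) opprK.
have -> : x = y + x' *+ a *+ (a^-1 : 'F_p).
  rewrite -mulrnA -Fp_mulrn // natrM !natr_Zp divff //.
  by rewrite -[1]/(1%:R) Fp_mulrn // mulr1n /x' addrCA subrr addr0.
rewrite -addrA [_ + tau _ *+ _]addrC -mulrnDl; apply: BD => //.
exact: BMn.
Qed.

End Complement.

Lemma bilinE (F : fieldType) n (A : nat -> nat -> F) (v w : 'rV[F]_n) :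
  bilin A v w = (v *m mxf n n A *m w^T) 0 0.
Proof.
rewrite /bilin mxE exchange_big /=; apply: eq_bigr => j _.
by rewrite !mxE mulr_suml; apply: eq_bigr => i _; rewrite !mxE.
Qed.

(** * Groups defined by a pair of forms *)

Section Model.
Variables (p : nat) (G : Grp).
Hypothesis Hp : prime p.
Local Notation "x ** y" := (@gmul G x y) (at level 40, left associativity).
Local Notation inv := (@ginv G).
Local Notation one := (gone G).
Local Notation dom := (M2_dom p).
Local Notation ker := M2_ker.

Let di (c : 'F_p * 'F_p) : dom (ip p c). Proof. exact: dom_ip. Qed.

Definition pairing (M : MP 'F_p) (v w : 'rV['F_p]_(msz M)) : 'F_p * 'F_p :=
  (bilin (mA M) v w, bilin (mB M) v w).

Definition halve (c : 'F_p * 'F_p) : 'F_p * 'F_p := (2%:R^-1 * c.1, 2%:R^-1 * c.2).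

Record central_embedding (phi : rat * rat -> G) : Prop := CentralEmbedding {
  phiD : forall a b, dom a -> dom b -> phi (a + b) = phi a ** phi b;
  phi_ker : forall a, dom a -> (phi a = one <-> ker a);
  phi_central : forall a, dom a -> gcentral (phi a) }.

(* An isomorphism from [G(M)], split into its bottom [phi] and a section [tau]. *)
Record model (M : MP 'F_p) (phi : rat * rat -> G) (tau : 'rV['F_p]_(msz M) -> G) : Prop :=
  Model {
  model_embedding :> central_embedding phi;
  tauM : forall v w, tau v ** tau w = phi (ip p (halve (pairing v w))) ** tau (v + w);
  tau_indep : forall a v, dom a -> tau v = phi a -> v = 0;
  model_surj : forall x, exists a v, dom a /\ x = phi a ** tau v }.

Lemma form0l M (w : 'rV_(msz M)) : pairing 0 w = 0.
Proof. by rewrite /pairing !bilinE !mul0mx mxE. Qed.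

Lemma form0r M (v : 'rV_(msz M)) : pairing v 0 = 0.
Proof. by rewrite /pairing !bilinE !trmx0 !mulmx0 mxE. Qed.

Lemma halve0 : halve 0 = 0.
Proof. by rewrite /halve !mulr0. Qed.

Section EmbeddingTheory.
Variable phi : rat * rat -> G.
Hypothesis mod : central_embedding phi.

Lemma phi0 : phi 0 = one.
Proof. by apply/(phi_ker mod (dom0 Hp)); apply: ker0. Qed.

Lemma phi_eq a b : dom a -> dom b -> ker (a - b) -> phi a = phi b.
Proof.
move=> da db /(phi_ker mod (domD Hp da (domN Hp db))) E.
by rewrite -[a](subrK b) (phiD mod) ?E ?gmul1 //; apply: domD => //; apply: domN.
Qed.

Lemma phiN a : dom a -> phi (- a) = inv (phi a).
Proof.
move=> da; apply: (@gmul_injl _ (phi a)); rewrite gmulVr -(phiD mod) ?subrr ?phi0 //.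
exact: domN.
Qed.

Lemma phiMn a n : dom a -> phi (a *+ n) = gexp (phi a) n.
Proof.
move=> da; elim: n => [|n IH]; first exact: phi0.
by rewrite mulrS (phiD mod) ?IH //; apply: domMn.
Qed.

Lemma phi_ipD (c d : 'F_p * 'F_p) : phi (ip p (c + d)) = phi (ip p c) ** phi (ip p d).
Proof.
rewrite -(phiD mod (di c) (di d)); apply: phi_eq => //; last exact: ipD.
exact: domD.
Qed.

Lemma phi_ip_inj (c d : 'F_p * 'F_p) : phi (ip p c) = phi (ip p d) -> c = d.
Proof.
move=> E; apply/eqP; rewrite -subr_eq0; apply/eqP/(ker_ip Hp)/(phi_ker mod (di _)).
apply: (@gmul_injr _ (phi (ip p d))); rewrite -phi_ipD subrK gmul1 E //.
Qed.

End EmbeddingTheory.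

Section ModelTheory.
Variables (M : MP 'F_p) (phi : rat * rat -> G) (tau : 'rV['F_p]_(msz M) -> G).
Hypothesis mod : model phi tau.

Lemma tau0 : tau 0 = one.
Proof.
have := tauM mod 0 0; rewrite form0l halve0 ip0 (phi0 mod) addr0 gmul1 => E.
by apply: (@gmul_injl _ (tau 0)); rewrite E gmulr1.
Qed.

Lemma iso_GA_of_model : iso_GA p M G.
Proof.
exists (fun x => phi x.1 ** tau x.2); split.
- move=> [a v] [b w] da db.
  have -> : @GA_op p M (a, v) (b, w) = (a + b + ip p (halve (pairing v w)), v + w) by [].
  rewrite [_.1]/= [_.2]/= [(a, v).1]/= [(a, v).2]/= [(b, w).1]/= [(b, w).2]/=.
  rewrite (phiD mod (domD Hp da db) (di _)).
  rewrite (phiD mod da db) -!gmulA; congr (_ ** _).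
  by rewrite -(tauM mod) gmulA (phi_central mod db) -!gmulA.
- move=> [a v]; rewrite /GA_dom /GA_ker /= => da; split.
    move=> E; have v0 : v = 0.
      apply: (@tau_indep _ _ _ mod (- a)); first exact: domN.
      by apply: (@gmul_injl _ (phi a)); rewrite E (phiN mod) // gmulVr.
    by split => //; apply/(phi_ker mod da); move: E; rewrite v0 tau0 gmulr1.
  by case=> /(phi_ker mod da) -> ->; rewrite tau0 gmul1.
- move=> x; split=> // _; have [a [v [da ->]]] := model_surj mod x.
  by exists (a, v).
Qed.

Lemma model_uniq a b u w : dom a -> dom b -> phi a ** tau u = phi b ** tau w -> u = w.
Proof.
move=> da db E; have Eu := tauM mod u (- w); have Ew := tauM mod w (- w).
set x := ip p _ in Eu; set y := ip p _ in Ew.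
have dx : dom x := di _. have dy : dom y := di _.
rewrite subrr tau0 gmulr1 in Ew.
have dab : dom (- a + b) by apply: domD => //; apply: domN.
have E1 : tau u = phi (- a + b) ** tau w.
  by rewrite (phiD mod) ?(phiN mod) -?gmulA -?E ?gmulKl //; apply: domN.
apply/eqP; rewrite -subr_eq0; apply/eqP.
have dz : dom (- x + (- a + b + y)) by apply: domD; [|apply: domN|apply: domD].
apply: (@tau_indep _ _ _ mod _ _ dz).
apply: (@gmul_injl _ (phi x)); rewrite -Eu E1 -gmulA Ew.
by rewrite -(phiD mod dab dy) -(phiD mod dx dz) addNKr.
Qed.

Hypothesis F2 : (2%:R : 'F_p) != 0.
Hypothesis skA : (mx1 M)^T = - mx1 M.
Hypothesis skB : (mx2 M)^T = - mx2 M.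

Lemma bilin_skew (A : nat -> nat -> 'F_p) (v w : 'rV_(msz M)) :
  (mxf (msz M) (msz M) A)^T = - mxf (msz M) (msz M) A -> bilin A w v = - bilin A v w.
Proof.
move=> sA; rewrite !bilinE; set C := mxf _ _ A in sA *.
have -> : w *m C *m v^T = - (v *m C *m w^T)^T.
  by rewrite !trmx_mul trmxK sA mulNmx mulmxN opprK mulmxA.
by rewrite mxE [X in - X]mxE.
Qed.

Lemma form_skew (v w : 'rV_(msz M)) : pairing w v = - pairing v w.
Proof. by rewrite /pairing (bilin_skew _ _ skA) (bilin_skew _ _ skB). Qed.

Lemma halveK c : halve c + halve c = c.
Proof.
rewrite /halve; case: c => c1 c2.
have H (x : 'F_p) : 2%:R^-1 * x + 2%:R^-1 * x = x.
  by rewrite -mulrDl -mulr2n -[_ *+ 2]mulr_natl divff // mul1r.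
by rewrite -[LHS]/(_ + _, _ + _) /= !H.
Qed.

Lemma halveN c : halve (- c) = - halve c.
Proof. by rewrite /halve /= !mulrN. Qed.

Lemma gcomm_tau v w : gcomm (tau v) (tau w) = phi (ip p (pairing v w)).
Proof.
apply: gcommP; rewrite !(tauM mod) (form_skew v w) halveN [w + v]addrC.
rewrite -gmulA -(phi_central mod (di _)) gmulA -(phi_ipD mod).
by rewrite -[X in - halve _ + X]halveK addKr.
Qed.

Lemma gcomm_model a b v w : dom a -> dom b ->
  gcomm (phi a ** tau v) (phi b ** tau w) = phi (ip p (pairing v w)).
Proof.
move=> da db; rewrite -gcomm_tau; apply: gcommP.
have ca := phi_central mod da; have cb := phi_central mod db.
rewrite -!gmulA (gmulA (tau v)) -(cb (tau v)) -!gmulA (gcommE (tau v)).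
by rewrite (gmulA (tau w) (phi a)) -(ca (tau w)) !gmulA (ca (phi b)).
Qed.

Lemma form_self (v : 'rV['F_p]_(msz M)) n : pairing (v *+ n) v = 0.
Proof.
have E (c : 'F_p * 'F_p) : c = - c -> c = 0.
  by move=> cN; rewrite -[c]halveK {2}cN halveN subrr.
have bMn A : bilin A (v *+ n) v = bilin A v v *+ n.
  by rewrite !bilinE -scaler_nat -!scalemxAl mxE mulr_natl.
have Z := E _ (form_skew v v).
have Z1 : bilin (mA M) v v = 0 := congr1 fst Z.
have Z2 : bilin (mB M) v v = 0 := congr1 snd Z.
by rewrite /pairing !bMn Z1 Z2 !mul0rn.
Qed.

Lemma gexp_tau (v : 'rV['F_p]_(msz M)) n : gexp (tau v) n = tau (v *+ n).
Proof.
elim: n => [|n IH]; first by rewrite mulr0n tau0.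
by rewrite gexpSr IH (tauM mod) form_self halve0 ip0 (phi0 mod) gmul1 -mulrSr.
Qed.

(** A skew form vanishes on multiples of one vector, so [tau] is a homomorphism on each line and has
    exponent [p] there; only the bottom survives. *)
Lemma gexp_model a v : dom a -> gexp (phi a ** tau v) p = phi (a *+ p).
Proof.
move=> da; rewrite gexpM ?(phi_central mod da) // gexp_tau row_charMn // tau0 gmulr1.
by rewrite (phiMn mod).
Qed.

End ModelTheory.

Lemma model_of_iso_GA M : iso_GA p M G -> exists phi tau, @model M phi tau.
Proof.
move=> [f [fM fK fS]].
have opl a b (w : 'rV_(msz M)) : @GA_op p M (a, 0) (b, w) = (a + b, w).
  have -> : @GA_op p M (a, 0) (b, w) = (a + b + ip p (halve (pairing 0 w)), 0 + w) by [].
  by rewrite form0l halve0 ip0 addr0 add0r.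
have opr a b (w : 'rV_(msz M)) : @GA_op p M (b, w) (a, 0) = (b + a, w).
  have -> : @GA_op p M (b, w) (a, 0) = (b + a + ip p (halve (pairing w 0)), w + 0) by [].
  by rewrite form0r halve0 ip0 !addr0.
have D0 : dom 0 by apply: dom0.
exists (fun a => f (a, 0)), (fun v => f (0, v)); split; first split.
- by move=> a b da db; rewrite -fM // opl.
- move=> a da; split => [/(fK (a, 0) da) []|ka] //.
  by apply/(fK (a, 0)).
- move=> a da x; have [[b w] [db <-]] := (fS x).1 I.
  by rewrite -!fM // opl opr addrC.
- move=> v w; rewrite -!fM //; last exact: dom_ip.
  rewrite opl; congr f.
  have -> : @GA_op p M (0, v) (0, w) = (0 + 0 + ip p (halve (pairing v w)), v + w) by [].
  by rewrite !add0r !addr0.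
- move=> a v da E.
  have dNa : dom (- a) by apply: domN.
  have : f (- a, v) = one.
    rewrite -[(- a, v)](_ : @GA_op p M (- a, 0) (0, v) = _); last by rewrite opl addr0.
    rewrite (fM (- a, 0) (0, v) dNa D0) E -(fM (- a, 0) (a, 0) dNa da) opl addNr.
    apply/(fK (0, 0) D0); split => //; exact: ker0.
  by move/fK => /(_ dNa)[].
- move=> x; have [[b w] [db <-]] := (fS x).1 I.
  by exists b, w; split => //; rewrite -(fM (b, 0) (0, w) db D0) opl addr0.
Qed.

End Model.

(** * Comparison of two models of one group *)

Section Transfer.
Variables (p : nat) (G : Grp).
Hypothesis Hp : prime p.
Hypothesis F2 : (2%:R : 'F_p) != 0.
Local Notation "x ** y" := (@gmul G x y) (at level 40, left associativity).
Local Notation one := (gone G).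
Local Notation dom := (M2_dom p).
Local Notation ker := M2_ker.

Section OneWay.
Variables (M M' : MP 'F_p) (phi phi' : rat * rat -> G).
Variables (tau : 'rV['F_p]_(msz M) -> G) (tau' : 'rV['F_p]_(msz M') -> G).
Hypothesis mod : model phi tau.
Hypothesis mod' : model phi' tau'.
Hypothesis skA : (mx1 M)^T = - mx1 M.
Hypothesis skB : (mx2 M)^T = - mx2 M.

(* The bottom of the group consists of the [p]-th powers. *)
Lemma bottom_transfer a : dom a -> exists2 b, dom b & phi' a = phi b.
Proof.
move=> da; have [c dc <-] := dom_divp Hp da.
have [b [u [db E]]] := model_surj mod (phi' c).
exists (b *+ p); first exact: domMn.
by rewrite (phiMn Hp mod') // E (gexp_model Hp mod F2 skA skB).
Qed.

Lemma socle_transfer (c : 'F_p * 'F_p) : exists d : 'F_p * 'F_p, phi' (ip p c) = phi (ip p d).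
Proof.
have [b db E] := bottom_transfer (dom_ip Hp c).
have : ker (b *+ p).
  apply/(phi_ker mod (domMn Hp _ db)).
  rewrite (phiMn Hp mod) // -E -(phiMn Hp mod') ?dom_ip //; last exact: dom_ip.
  by apply/(phi_ker mod' (domMn Hp _ (dom_ip Hp c))); apply: ker_ip_p.
move/(ip_surj Hp) => [d kd]; exists d; rewrite E; apply: (phi_eq Hp mod) => //.
exact: dom_ip.
Qed.

Lemma transfer : exists (om : 'F_p * 'F_p -> 'F_p * 'F_p) (sg : 'rV['F_p]_(msz M') -> 'rV['F_p]_(msz M)),
  (forall c, phi' (ip p c) = phi (ip p (om c))) /\
  (forall v, exists2 a, dom a & tau' v = phi a ** tau (sg v)).
Proof.
have [om omE] := choice socle_transfer.
have [|sg sgE] := @choice _ _ (fun v u => exists2 a, dom a & tau' v = phi a ** tau u).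
  by move=> v; have [a [u [da E]]] := model_surj mod (tau' v); exists u, a.
by exists om, sg.
Qed.

Variables (om : 'F_p * 'F_p -> 'F_p * 'F_p) (sg : 'rV['F_p]_(msz M') -> 'rV['F_p]_(msz M)).
Hypothesis omE : forall c, phi' (ip p c) = phi (ip p (om c)).
Hypothesis sgE : forall v, exists2 a, dom a & tau' v = phi a ** tau (sg v).

Lemma omD : {morph om : c d / c + d}.
Proof.
move=> c d; apply: (phi_ip_inj Hp mod).
by rewrite -omE (phi_ipD Hp mod') !omE -(phi_ipD Hp mod).
Qed.

Lemma sgD : {morph sg : v w / v + w}.
Proof.
move=> v w; have [a da Ea] := sgE v; have [b db Eb] := sgE w; have [c dc Ec] := sgE (v + w).
have := tauM mod' v w; rewrite Ea Eb Ec omE.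
rewrite -gmulA (gmulA (tau _)) -(phi_central mod db (tau _)) -gmulA (tauM mod).
rewrite !gmulA -!(phiD mod) //; try by do ?[apply: domD => //]; apply: dom_ip.
move/esym/(model_uniq Hp mod); apply.
  by apply: domD => //; apply: dom_ip.
by apply: domD => //; [apply: domD|apply: dom_ip].
Qed.

Lemma form_transfer v w : (mx1 M')^T = - mx1 M' -> (mx2 M')^T = - mx2 M' ->
  om (pairing v w) = pairing (sg v) (sg w).
Proof.
move=> skA' skB'; apply: (phi_ip_inj Hp mod); rewrite -omE.
have [a da Ea] := sgE v; have [b db Eb] := sgE w.
by rewrite -(gcomm_tau Hp mod' F2 skA' skB') Ea Eb (gcomm_model Hp mod F2 skA skB).
Qed.

End OneWay.

Lemma row_additive_mx m n (f : 'rV['F_p]_m -> 'rV['F_p]_n) :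
  {morph f : v w / v + w} -> forall v, f v = v *m \matrix_i f (delta_mx 0 i).
Proof.
move=> fD v; rewrite {1}[v]row_sum_delta (morphD_sum fD) mulmx_sum_row.
apply: eq_bigr => i _; rewrite rowK -[v 0 i in LHS]natr_Zp -[v 0 i in RHS]natr_Zp.
by rewrite !scaler_nat (morphDMn fD).
Qed.

Lemma pair_additive_mx (f : 'F_p * 'F_p -> 'F_p * 'F_p) : {morph f : v w / v + w} ->
  exists W : 'M['F_p]_2, forall c, f c = (W 0 0 * c.1 + W 0 1 * c.2, W 1 0 * c.1 + W 1 1 * c.2).
Proof.
move=> fD; pose e (i : 'I_2) : 'F_p * 'F_p := if i == 0 then (1, 0) else (0, 1).
exists (\matrix_(i, j) if i == 0 then (f (e j)).1 else (f (e j)).2) => -[c d]; rewrite !mxE /=.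
have -> : (c, d) = e 0 *+ c + e 1 *+ d.
  by rewrite !pairMn -[RHS]/(_ + _, _ + _) /= !mul0rn addr0 add0r !natr_Zp.
rewrite fD !(morphDMn fD) !pairMn -[LHS]/(_ + _, _ + _) /=.
have H (x : 'F_p) (a : 'F_p) : x *+ a = x * a by rewrite -mulr_natr natr_Zp.
by rewrite !H.
Qed.

(** The commutator map of [G] is computed in both models. The comparison [om] of the two
    parametrizations of the [p]-torsion has matrix [W], and the comparison [sg] of the quotients by
    the bottom gives the congruence; both are invertible by symmetry. *)
Lemma models_pcong (M M' : MP 'F_p) : iso_GA p M G -> iso_GA p M' G ->
  (mx1 M)^T = - mx1 M -> (mx2 M)^T = - mx2 M ->
  (mx1 M')^T = - mx1 M' -> (mx2 M')^T = - mx2 M' ->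
  exists2 W : 'M['F_p]_2, W \in unitmx &
    pcong (mx1 M) (mx2 M) (W 0 0 *: mx1 M' + W 0 1 *: mx2 M') (W 1 0 *: mx1 M' + W 1 1 *: mx2 M').
Proof.
move=> /(model_of_iso_GA Hp)[phi [tau mod]] /(model_of_iso_GA Hp)[phi' [tau' mod']] skA skB skA' skB'.
have [om [sg [omE sgE]]] := transfer mod mod' skA skB.
have [om' [sg' [omE' sgE']]] := transfer mod' mod skA' skB'.
have omK c : om (om' c) = c by apply: (phi_ip_inj Hp mod); rewrite -omE -omE'.
have sg_comp (N N' : MP 'F_p) f f' (t : 'rV_(msz N) -> G) (t' : 'rV_(msz N') -> G) g g' :
    model f t -> model f' t' -> (forall v, exists2 a, dom a & t' v = f a ** t (g v)) ->
    (forall v, exists2 a, dom a & t v = f' a ** t' (g' v)) ->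
    (forall a, dom a -> exists2 b, dom b & f' a = f b) -> forall v, g (g' v) = v.
  move=> mf mf' gE gE' bt v; have [a da Ea] := gE' v; have [b db Eb] := gE (g' v).
  have [c dc Ec] := bt a da; apply/esym.
  apply: (@model_uniq _ _ Hp _ _ _ mf 0 (c + b)); first exact: dom0.
    exact: domD.
  by rewrite (phi0 Hp mf) gmul1 Ea Eb Ec (phiD mf) // gmulA.
have sgK : cancel sg' sg := sg_comp _ _ _ _ _ _ _ _ mod mod' sgE sgE' (bottom_transfer mod mod' skA skB).
have sgK' : cancel sg sg' := sg_comp _ _ _ _ _ _ _ _ mod' mod sgE' sgE (bottom_transfer mod' mod skA' skB').
have sD := sgD mod mod' omE sgE; have sD' := sgD mod' mod omE' sgE'.
have [W WE] := pair_additive_mx (omD mod mod' omE).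
have [W' WE'] := pair_additive_mx (omD mod' mod omE').
exists W.
  have WW : W *m W' = 1%:M.
    have H c : W *m W' *m c = c :> 'cV_2.
      have := omK (c 0 0, c 1 0); rewrite WE' WE /= => -[E0 E1].
      apply/colP => i; rewrite -mulmxA !mxE big_ord_recl big_ord1 !mxE !big_ord_recl !big_ord0 !addr0.
      have -> : lift ord0 ord0 = 1 :> 'I_2 by apply: val_inj.
      have [->|->] : i = 0 \/ i = 1 by case: i => -[|[|]] // ii; [left|right]; apply: val_inj.
        by rewrite -[RHS]E0.
      by rewrite -[RHS]E1.
    by apply/matrixP => i j; have /colP/(_ i) := H (delta_mx j 0); rewrite -colE !mxE eqxx andbT.
  by case/mulmx1_unit: WW.
pose S := \matrix_i sg (delta_mx 0 i); pose T := \matrix_i sg' (delta_mx 0 i).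
have SE v : sg v = v *m S := row_additive_mx sD v.
have TE v : sg' v = v *m T := row_additive_mx sD' v.
have eq1 n (X Y : 'M['F_p]_n) : (forall v : 'rV_n, v *m X = v *m Y) -> X = Y.
  by move=> H; apply/row_matrixP => i; rewrite !rowE.
have eqb n (X Y : 'M['F_p]_n) : (forall v w : 'rV_n, (v *m X *m w^T) 0 0 = (v *m Y *m w^T) 0 0) -> X = Y.
  move=> H; apply/matrixP => i j; have := H (delta_mx 0 i) (delta_mx 0 j).
  by rewrite -!rowE !trmx_delta -!colE !mxE.
exists S, T; split.
- by apply: eq1 => v; rewrite mulmxA -SE -TE sgK' mulmx1.
- by apply: eq1 => v; rewrite mulmxA -TE -SE sgK mulmx1.
- apply: eqb => v w; have := form_transfer mod mod' skA skB omE sgE v w skA' skB'.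
  rewrite WE /pairing /= !bilinE !SE => -[E _].
  rewrite mulmxDr mulmxDl -!scalemxAr -!scalemxAl [RHS]mxE [X in _ = X + _]mxE [X in _ = _ + X]mxE.
  by rewrite E trmx_mul !mulmxA.
- apply: eqb => v w; have := form_transfer mod mod' skA skB omE sgE v w skA' skB'.
  rewrite WE /pairing /= !bilinE !SE => -[_ E].
  rewrite mulmxDr mulmxDl -!scalemxAr -!scalemxAl [RHS]mxE [X in _ = X + _]mxE [X in _ = _ + X]mxE.
  by rewrite E trmx_mul !mulmxA.
Qed.

End Transfer.

Lemma det_mx22 (R : comNzRingType) (A : 'M[R]_2) : \det A = A 0 0 * A 1 1 - A 0 1 * A 1 0.
Proof.
rewrite (expand_det_row _ 0) !big_ord_recl big_ord0 addr0 /cofactor !det_mx11 !mxE /=.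
have -> : lift 0 0 = 1 :> 'I_2 by apply: val_inj.
have -> : lift 1 0 = 0 :> 'I_2 by apply: val_inj.
by rewrite expr0 mul1r expr1 mulN1r mulrN.
Qed.

(** * Automorphisms of the bottom *)

Section Lift.
Variable p : nat.
Hypothesis Hp : prime p.
Local Notation dom := (M2_dom p).
Local Notation ker := M2_ker.
Variable U : 'M['F_p]_2.

Definition mxpair (c : 'F_p * 'F_p) : 'F_p * 'F_p :=
  (U 0 0 * c.1 + U 0 1 * c.2, U 1 0 * c.1 + U 1 1 * c.2).

(* The entries of [U] are lifted to [nat]; the lift is invertible on the bottom because
   its determinant is prime to [p]. *)
Definition mxlift (a : rat * rat) : rat * rat :=
  (a.1 *+ U 0 0 + a.2 *+ U 0 1, a.1 *+ U 1 0 + a.2 *+ U 1 1).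

Lemma mxliftD a b : mxlift (a + b) = mxlift a + mxlift b.
Proof. by rewrite /mxlift !mulrnDl -[RHS]/(_ + _, _ + _) /=; congr pair; apply: addrACA. Qed.

Lemma mxlift_dom a : dom a -> dom (mxlift a).
Proof. by case/andP=> ? ?; apply/andP; split; apply: pdenD => //; apply: pdenMn. Qed.

Lemma mxlift_ip c : ker (mxlift (ip p c) - ip p (mxpair c)).
Proof.
have H (a b x y : 'F_p) :
    Fp_to_rat p x *+ a + Fp_to_rat p y *+ b - Fp_to_rat p (a * x + b * y) \is a Num.int.
  have E (s t : 'F_p) : s * t = t *+ s by rewrite -mulr_natr natr_Zp mulrC.
  rewrite !E; set X := x *+ a; set Y := y *+ b.
  have -> : Fp_to_rat p x *+ a + Fp_to_rat p y *+ b - Fp_to_rat p (X + Y) =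
    - ((Fp_to_rat p (X + Y) - (Fp_to_rat p X + Fp_to_rat p Y)) +
      (Fp_to_rat p X - Fp_to_rat p x *+ a) + (Fp_to_rat p Y - Fp_to_rat p y *+ b)) by ring.
  rewrite rpredN; apply: rpredD; last exact: Fp_to_ratMn.
  by apply: rpredD; [apply: Fp_to_ratD|apply: Fp_to_ratMn].
by apply/M2_kerP; split; apply: H.
Qed.

Lemma mxlift_ker_sub a : ker a -> ker (mxlift a).
Proof. by case/M2_kerP=> ? ?; apply/M2_kerP; rewrite !rpredD ?rpredMn. Qed.

Hypothesis uU : U \in unitmx.

Let d : int := (U 0 0 : nat)%:Z * (U 1 1 : nat)%:Z - (U 0 1 : nat)%:Z * (U 1 0 : nat)%:Z.

(** The integer determinant [d] reduces to that of [U], a unit modulo [p]; so [x] inverts [d] on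
    elements killed by [p ^ k]. *)
Lemma mxlift_bezout k : exists x y : int, x * d + y * (p ^ k)%N = 1.
Proof.
have cd : coprimez d (p ^ k)%N.
  rewrite /coprimez /gcdz /= -[_ == _]/(coprime `|d| (p ^ k)).
  apply: coprimeXr; rewrite coprime_sym prime_coprime //; apply/negP => pd.
  have : (d%:~R : 'F_p) = 0.
    have [z ->] : exists z, d = z * p%:Z by apply/dvdzP; rewrite /dvdz /=.
    by rewrite rmorphM /= -pmulrn pchar_Fp_0 // mulr0.
  move/eqP; apply/negP; rewrite rmorphB !rmorphM /= -!pmulrn !natr_Zp.
  by move: uU; rewrite unitmxE det_mx22 unitfE.
have [x [y E]] := Bezoutz d (p ^ k)%N; exists x, y.
by rewrite E; apply/eqP.
Qed.

(** Cramer's rule makes [d] times each coordinate an integer. A power of [p] does the same, and the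
    two multipliers are coprime. *)
Lemma mxlift_ker a : dom a -> ker (mxlift a) -> ker a.
Proof.
move=> /andP[/(pdenP Hp)[k ak] /(pdenP Hp)[l al]] /M2_kerP[/= k1 k2].
have d1 : a.1 * d%:~R \is a Num.int.
  have -> : a.1 * d%:~R = (a.1 *+ U 0 0 + a.2 *+ U 0 1) *+ U 1 1
                        - (a.1 *+ U 1 0 + a.2 *+ U 1 1) *+ U 0 1.
    by rewrite /d rmorphB !rmorphM /= -!pmulrn; ring.
  by rewrite rpredB ?rpredMn.
have d2 : a.2 * d%:~R \is a Num.int.
  have -> : a.2 * d%:~R = (a.1 *+ U 1 0 + a.2 *+ U 1 1) *+ U 0 0
                        - (a.1 *+ U 0 0 + a.2 *+ U 0 1) *+ U 1 0.
    by rewrite /d rmorphB !rmorphM /= -!pmulrn; ring.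
  by rewrite rpredB ?rpredMn.
have H (q : rat) n : q * d%:~R \is a Num.int -> q * (p ^ n)%:R \is a Num.int -> q \is a Num.int.
  move=> qd qp; have [x [y E]] := mxlift_bezout n.
  have -> : q = q * d%:~R * x%:~R + q * (p ^ n)%:R * y%:~R.
    have E' : x%:~R * d%:~R + y%:~R * (p ^ n)%:R = 1 :> rat.
      have : (x * d + y * (p ^ n)%N)%:~R = 1%:~R :> rat by rewrite E.
      by rewrite rmorphD !rmorphM.
    have := congr1 ( *%R q) E'.
    by rewrite mulr1 mulrDr !mulrA [q * _ * d%:~R]mulrAC [q * _ * (p ^ n)%:R]mulrAC => ->.
  by apply: rpredD; apply: rpredM; rewrite ?intr_int.
by apply/M2_kerP; split; [apply: H d1 ak|apply: H d2 al].
Qed.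

Lemma mxlift_surj b : dom b -> exists2 a, dom a & ker (mxlift a - b).
Proof.
move=> /andP[d1 d2]; have [k bk] := pdenP Hp _ d1; have [l bl] := pdenP Hp _ d2.
(* One modulus serves both coordinates of [b]. The preimage below is the adjugate applied to [b],
   times the inverse [x] of the determinant. *)
have [x [y E]] := mxlift_bezout (k + l).
have pdenZ q (z : int) : pden p q -> pden p (q * z%:~R).
  move=> pq; case: z => z; first by rewrite -pmulrn mulr_natr pdenMn.
  by rewrite NegzE rmorphN /= mulrN pdenN // -pmulrn mulr_natr pdenMn.
exists ((b.1 *+ U 1 1 - b.2 *+ U 0 1) * x%:~R, (b.2 *+ U 0 0 - b.1 *+ U 1 0) * x%:~R).
  by apply/andP; split; apply: pdenZ; rewrite pdenD ?pdenN ?pdenMn.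
have Er : (d%:~R * x%:~R : rat) = 1 - y%:~R * (p ^ k)%:R * (p ^ l)%:R.
  have : ((x * d + y * (p ^ (k + l))%N)%:~R : rat) = 1 by rewrite E.
  rewrite rmorphD !rmorphM /= -(pmulrn 1 (p ^ (k + l))) expnD natrM.
  by move/(canRL (addrK _)); rewrite mulrC !mulrA.
have bK : b.1 * (p ^ k)%:R * (y%:~R * (p ^ l)%:R) \is a Num.int by rewrite (rpredM bk) ?rpredM ?intr_int ?rpred_nat.
have bL : b.2 * (p ^ l)%:R * (y%:~R * (p ^ k)%:R) \is a Num.int by rewrite (rpredM bl) ?rpredM ?intr_int ?rpred_nat.
have dE : (d%:~R : rat) = (U 0 0 : nat)%:R * (U 1 1 : nat)%:R - (U 0 1 : nat)%:R * (U 1 0 : nat)%:R.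
  by rewrite /d rmorphB !rmorphM /= -!pmulrn.
apply/M2_kerP; split=> /=.
- rewrite [X in X \is a _](_ : _ = b.1 * (d%:~R * x%:~R) - b.1); last by rewrite dE; ring.
  rewrite Er; have -> : b.1 * (1 - y%:~R * (p ^ k)%:R * (p ^ l)%:R) - b.1 =
      - (b.1 * (p ^ k)%:R * (y%:~R * (p ^ l)%:R)) by ring.
  by rewrite rpredN.
- rewrite [X in X \is a _](_ : _ = b.2 * (d%:~R * x%:~R) - b.2); last by rewrite dE; ring.
  rewrite Er; have -> : b.2 * (1 - y%:~R * (p ^ k)%:R * (p ^ l)%:R) - b.2 =
      - (b.2 * (p ^ l)%:R * (y%:~R * (p ^ k)%:R)) by ring.
  by rewrite rpredN.
Qed.

End Lift.

(** * Realization of a group by a pair of forms *)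

Section Realization.
Variables (p : nat) (G : Grp).
Hypothesis Hp : prime p.
Local Notation "x ** y" := (@gmul G x y) (at level 40, left associativity).
Local Notation inv := (@ginv G).
Local Notation one := (gone G).
Local Notation dom := (M2_dom p).
Local Notation ker := M2_ker.

Lemma mxpairK (U W : 'M['F_p]_2) : W *m U = 1%:M -> cancel (mxpair U) (mxpair W).
Proof.
move=> UW [c d].
have E i j : W i 0 * U 0 j + W i 1 * U 1 j = (i == j)%:R.
  have /matrixP/(_ i j) := UW; rewrite !mxE !big_ord_recl big_ord0 addr0.
  by have -> : lift ord0 ord0 = 1 :> 'I_2 by apply: val_inj.
rewrite /mxpair /=; congr pair.
  transitivity ((W 0 0 * U 0 0 + W 0 1 * U 1 0) * c + (W 0 0 * U 0 1 + W 0 1 * U 1 1) * d).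
    by ring.
  by rewrite !E mul1r mul0r addr0.
transitivity ((W 1 0 * U 0 0 + W 1 1 * U 1 0) * c + (W 1 0 * U 0 1 + W 1 1 * U 1 1) * d).
  by ring.
by rewrite !E mul1r mul0r add0r.
Qed.

(** The group stays the same and only its coordinates change. Combining the forms by [W] is
    compensated by composing [phi] with a lift of the inverse of [W], and the congruence by
    composing [tau] with [S]. *)
Lemma iso_GA_change (M N : MP 'F_p) phi (tau : 'rV['F_p]_(msz M) -> G) (W : 'M['F_p]_2) :
  model phi tau -> W \in unitmx ->
  pcong (W 0 0 *: mx1 M + W 0 1 *: mx2 M) (W 1 0 *: mx1 M + W 1 1 *: mx2 M) (mx1 N) (mx2 N) ->
  iso_GA p N G.
Proof.
move=> mod uW [S [T [ST TS E1 E2]]]; pose U := invmx W.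
have uU : U \in unitmx by rewrite unitmx_inv.
have UK : cancel (mxpair W) (mxpair U) by apply: mxpairK; apply: mulVmx.
have pN (v w : 'rV_(msz N)) : pairing v w = mxpair W (pairing (v *m S) (w *m S)).
  rewrite /pairing /mxpair /= !bilinE trmx_mul.
  have H (a b : 'F_p) : (v *m (S *m (a *: mx1 M + b *: mx2 M) *m S^T) *m w^T) 0 0 =
      a * (v *m S *m mx1 M *m (S^T *m w^T)) 0 0 + b * (v *m S *m mx2 M *m (S^T *m w^T)) 0 0.
    rewrite !(mulmxDr, mulmxDl) -!(scalemxAr, scalemxAl) !mulmxA.
    by rewrite mxE [X in X + _]mxE [X in _ + X]mxE.
  congr pair; first by rewrite -[mxf _ _ (mA N)]/(mx1 N) -E1 H.
  by rewrite -[mxf _ _ (mB N)]/(mx2 N) -E2 H.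
apply: (@iso_GA_of_model _ _ Hp N (fun a => phi (mxlift U a)) (fun v => tau (v *m S))).
have dl a : dom a -> dom (mxlift U a) := @mxlift_dom p Hp U a.
split; first split.
- by move=> a b da db; rewrite mxliftD (phiD mod) //; apply: dl.
- move=> a da; split=> [/(phi_ker mod (dl _ da))|ka]; first exact: mxlift_ker.
  by apply/(phi_ker mod (dl _ da)); apply: mxlift_ker_sub.
- by move=> a da; apply: (phi_central mod); apply: dl.
- move=> v w; rewrite (tauM mod) mulmxDl; congr (_ ** _).
  have -> : halve (pairing (v *m S) (w *m S)) = mxpair U (halve (pairing v w)).
    have hW (X : 'M_2) c : mxpair X (halve c) = halve (mxpair X c).
      by rewrite /mxpair /halve /=; congr pair; ring.
    by rewrite hW pN UK.
  apply: (phi_eq Hp mod); [exact: dom_ip|exact/dl/dom_ip|].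
  by rewrite -opprB; apply: kerN; apply: mxlift_ip.
- move=> a v da /(tau_indep mod (dl _ da)) vS.
  by rewrite -[v]mulmx1 -ST mulmxA vS mul0mx.
- move=> x; have [b [w [db ->]]] := model_surj mod x.
  have [a da ka] := mxlift_surj Hp uU db.
  exists a, (w *m T); split => //; rewrite -mulmxA TS mulmx1; congr (_ ** _).
  by apply: (phi_eq Hp mod) => //; [apply: dl|rewrite -opprB; apply: kerN].
Qed.

Lemma ip_mulrn c n : ker (ip p (c *+ n) - ip p c *+ n).
Proof.
by rewrite !pairMn; apply/M2_kerP; split; apply: Fp_to_ratMn.
Qed.

Hypothesis Hodd : odd p.

Lemma chernikov_model : grp_nilpotent G -> chernikov_M2_elab p G ->
  exists M phi (tau : 'rV['F_p]_(msz M) -> G),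
    [/\ model phi tau, (mx1 M)^T = - mx1 M & (mx2 M)^T = - mx2 M].
Proof.
move=> nil [B [nB [phi [phD phK phS]] [n [t tB]] cB eB]].
have [k pk] : exists k, p = (k + k).+1.
  by exists p./2; rewrite addnn -{1}(odd_double_half p) Hodd.
(* [h = (p + 1) / 2] halves commutators, because these have exponent [p]. *)
pose h := k.+1; have hh : (h + h = p.+1)%N by rewrite pk /h addSn addnS.
have phB a : dom a -> B (phi a) by move=> da; apply/phS; exists a.
have abB x y : B x -> B y -> x ** y = y ** x.
  by move=> /phS[a [da <-]] /phS[b [db <-]]; rewrite -!phD // /M2_op addrC [a.2 + _]addrC.
have phi0 : phi 0 = one by apply/(phK _ (dom0 Hp)); apply: ker0.
have phMn a m : dom a -> phi (a *+ m) = gexp (phi a) m.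
  move=> da; elim: m => [|m IH] //.
  by rewrite mulrS (phD a (a *+ m)) ?IH //; apply: domMn.
have divB x : B x -> exists2 y, B y & gexp y p = x.
  move=> /phS[a [da <-]]; have [b db <-] := dom_divp Hp da.
  by exists (phi b); [apply: phB|rewrite phMn].
have cenB b : B b -> gcentral b.
  by move=> Bb x; apply: (nilpotent_central nB abB divB eB nil).
have emb : central_embedding p phi.
  by split => // a da; apply/cenB/phB.
have cl2 (x y : G) : gcentral (gcomm x y) by apply: cenB.
have cp (x y : G) : gexp (gcomm x y) p = one.
  by rewrite -(gcommXl cl2) gcomm_central //; apply: cenB.
have H : halvable_class2 G h.
  by split => // x y; rewrite hh gexpS cp gmulr1.
pose V : zmodType := baer H; pose BV : V -> Prop := B.
have [[B1 BM BI] _] := nB.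
have addB (x z : V) : B z -> x + z = x ** z :> G.
  by move=> Bz; apply: baer_add_central; apply: cenB.
have BVM x : BV (x *+ p) by rewrite /BV baer_mulrn.
have BVD (x y : V) : BV x -> BV y -> BV (x + y).
  by move=> Bx By; rewrite /BV addB //; apply: BM.
have BVd x : BV x -> exists2 y : V, BV y & y *+ p = x.
  by move=> /divB[y By yE]; exists y => //; rewrite baer_mulrn.
have BVt (x : V) : exists i, (i < n)%N /\ BV (x - (t i : V)).
  have [i [ni Bi]] := tB x; exists i; split => //.
  suff -> : x - (t i : V) = (inv (t i) ** x : V) by [].
  apply/eqP; rewrite subr_eq eq_sym addrC; apply/eqP.
  by rewrite addB // gmulKVl.
have [m [tau [[tD tB0] tS]]] := exists_complement (B := BV) Hp B1 BVD BI BVd BVM BVt.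
have cE v w : exists c, gcomm (tau v : G) (tau w) = phi (ip p c).
  have /phS[a [da aE]] := cB (tau v) (tau w).
  have [|c kc] := @ip_surj p Hp a.
    by apply/(phK _ (domMn Hp _ da)); rewrite phMn // aE cp.
  by exists c; rewrite -aE; apply: (phi_eq Hp emb) => //; apply: dom_ip.
have [c0' c0E'] := choice (fun vw => cE vw.1 vw.2).
pose c0 v w := c0' (v, w).
have c0E v w : gcomm (tau v : G) (tau w) = phi (ip p (c0 v w)) := c0E' (v, w).
have inj := phi_ip_inj Hp emb.
have cD1 w : {morph c0^~ w : x y / x + y}.
  move=> x y; apply: inj; rewrite (phi_ipD Hp emb) -!c0E tD.
  by rewrite [LHS](bcommDl (tau w)) addB //; apply: cB.
have cD2 v : {morph c0 v : x y / x + y}.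
  move=> x y; apply: inj; rewrite (phi_ipD Hp emb) -!c0E tD.
  by rewrite [LHS](bcommDr (tau v)) addB //; apply: cB.
have cN v w : c0 w v = - c0 v w.
  apply: inj; rewrite (_ : - c0 v w = c0 (- v) w); last by rewrite (morphDN (cD1 w)).
  rewrite -!c0E (morphDN tD) [LHS](bcommN (tau v) (tau w)).
  exact: esym (morphDN (bcommDl (tau w)) (tau v)).
pose e i : 'rV['F_p]_m := \row_j ((j : nat) == i)%:R.
pose M := MkMP m (fun i j => (c0 (e i) (e j)).1) (fun i j => (c0 (e i) (e j)).2).
have vE (v : 'rV_m) : v = \sum_(i < m) e i *+ (v 0 i : 'F_p).
  apply/rowP => j; rewrite summxE (bigD1 j) //= big1 ?addr0 => [|i ij].
    by rewrite mulmxnE mxE eqxx natr_Zp.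
  by rewrite mulmxnE mxE eq_sym (negPf (ij : i != j :> nat)) mul0rn.
have bE (pr : 'F_p * 'F_p -> 'F_p) (prD : {morph pr : x y / x + y}) (v w : 'rV_m) :
    bilin (fun i j => pr (c0 (e i) (e j))) v w = pr (c0 v w).
  have d1 u : {morph (fun x => pr (c0 x u)) : x y / x + y} by move=> x y; rewrite cD1 prD.
  have d2 u : {morph (fun x => pr (c0 u x)) : x y / x + y} by move=> x y; rewrite cD2 prD.
  rewrite [in RHS](vE v) (morphD_sum (d1 w)); apply: eq_bigr => i _.
  rewrite (morphDMn (d1 w)) [in RHS](vE w) (morphD_sum (d2 _)) -sumrMnl; apply: eq_bigr => j _.
  rewrite (morphDMn (d2 _)) -[RHS]mulr_natr natr_Zp -[_ *+ (w 0 j : nat)]mulr_natr natr_Zp.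
  by rewrite [RHS]mulrC mulrA.
have pE (v w : 'rV_m) : pairing (M := M) v w = c0 v w.
  by rewrite /pairing !bE //; case: (c0 v w).
exists M, phi, tau; split.
- split => //.
  (* [tau] is additive for the Baer sum, so a product of two values in [G] exceeds [tau (v + w)] by
     the [h]-th power of their commutator; as [h] is the inverse of 2 in ['F_p], this is the cocycle
     of the model. *)
  + move=> v w; rewrite [LHS](baer_mul (tau v : V) (tau w)) -tD.
    have B3 : B (phi (ip p (halve (pairing (M := M) v w)))) by apply/phB/dom_ip.
    rewrite (cenB _ B3) -addB //; apply: (congr1 (fun z : V => tau (v + w) + z)).
    rewrite baer_mulrn pE [bcomm _ _]c0E -phMn; last exact: dom_ip.
    apply: (phi_eq Hp emb); [exact/domMn/dom_ip|exact: dom_ip|].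
    suff -> : halve (c0 v w) = c0 v w *+ h by rewrite -opprB; apply: kerN; apply: ip_mulrn.
    have h2 : h%:R * 2%:R = 1 :> 'F_p.
      by rewrite -natrM muln2 -addnn hh -natr1 pchar_Fp_0 // add0r.
    have h2V : 2%:R^-1 = h%:R :> 'F_p.
      have F2 : (2%:R : 'F_p) != 0.
        by apply/eqP => z; move/eqP: h2; rewrite z mulr0 eq_sym oner_eq0.
      by apply: (mulIf F2); rewrite mulVf // h2.
    by rewrite /halve pairMn h2V !mulr_natl.
  + by move=> a v da E; apply: tB0; rewrite /BV E; apply: phB.
  + move=> x; have [v Bv] := tS x; have /phS[a [da aE]] := Bv.
    exists a, v; split => //; rewrite aE (cenB _ Bv) -addB //.
    by rewrite addrC subrK.
- by apply/matrixP => i j; rewrite !mxE /= cN.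
- by apply/matrixP => i j; rewrite !mxE /= cN.
Qed.

End Realization.

(** * Orbits *)

Section Orbits.
Variable F : fieldType.
Implicit Types (s : seq (key F)) (rho : Fun F).

Lemma pplus_skew r c (R : 'M[F]_(r, c)) : (pplus R)^T = - pplus R.
Proof. by rewrite tr_block_mx opp_block_mx !trmx0 linearN /= trmxK opprK !oppr0. Qed.

Lemma Rblock_skew k d : (mx1 (@Rblock F k d))^T = - mx1 (Rblock k d) /\
  (mx2 (@Rblock F k d))^T = - mx2 (Rblock k d).
Proof.
by rewrite /Rblock; case: k => [g|]; first case: ifP => _ /=; rewrite mx1_plus mx2_plus !pplus_skew.
Qed.

Lemma Ablocks_skew s : (mx1 (Ablocks s))^T = - mx1 (Ablocks s) /\
  (mx2 (Ablocks s))^T = - mx2 (Ablocks s).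
Proof.
elim: s => [|k s [I1 I2]]; first by split; apply/matrixP => -[].
have [R1 R2] := Rblock_skew k.1 k.2.
by rewrite /= mx1_dsum mx2_dsum !tr_block_mx !opp_block_mx !trmx0 !oppr0 R1 R2 I1 I2.
Qed.

Lemma inFtilde_count s : (forall k, k \in s -> valid_key k) ->
  inFtilde (fun k d => count_mem (k, d) s).
Proof.
move=> vs; split.
- by exists s => k d; rewrite -lt0n -has_count has_pred1.
- by move=> g d; rewrite -lt0n -has_count has_pred1 => /vs[_ /(_ g)]; apply.
- by move=> k; apply/count_memPn/negP => /vs[].
Qed.

Lemma valid_of_count rho s : inFtilde rho -> (forall k d, count_mem (k, d) s = rho k d) ->
  forall k, k \in s -> valid_key k.
Proof.
move=> [_ rP r0] rE [k d] ks.
have n0 : rho k d != 0%N by rewrite -rE -lt0n -has_count has_pred1.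
split=> [|g /= kg]; last by apply: (rP g d); rewrite -kg.
by rewrite lt0n; apply: contraNneq n0 => /= ->; rewrite r0.
Qed.

(** A block labelled [g'] is relabelled by the [g] with [Q * g = g'], which is the image of [g']
    under the inverse of [Q]. Since [g] and [g'] determine each other, multiplicities are carried
    along. *)
Lemma act_Ablocks (Q : 'M[F]_2) s : Q \in unitmx -> (forall k, k \in s -> valid_key k) ->
  exists s', [/\ forall k, k \in s' -> valid_key k, pact Q (Ablocks s) (Ablocks s'),
    forall d, count_mem (None, d) s' = count_mem (None, d) s
  & forall g g' d, inP g -> actP Q g g' -> count_mem (Some g, d) s' = count_mem (Some g', d) s].
Proof.
move=> uQ vs.
(* The guard [k \in s] lets the choice function be total although only the keys in [s] are known to
   be valid. *)
pose P (k k' : key F) := k \in s -> k'.2 = k.2 /\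
  match k.1 with None => k'.1 = None
  | Some g' => exists g, [/\ k'.1 = Some g, inP g & actP Q g g'] end.
have [k|f fP] := @choice _ _ P.
  have [ks|nks] := boolP (k \in s); last by exists k => ks; rewrite ks in nks.
  have [_] := vs k ks; case: k ks => -[g'|] d ks /= ig'; last by exists (None, d).
  have uQ' : invmx Q \in unitmx by rewrite unitmx_inv.
  have [g ag] := actP_total uQ' (ig' _ erefl).
  have ig : inP g by case: ag.
  by exists (Some g, d) => _; split => //; exists g; split => //; apply/(actP_invE uQ ig (ig' _ erefl)).
have fS k : k \in s -> valid_key (f k).
  move=> ks; have [d0 kP] := vs k ks; have [f2 f1] := fP k ks.
  split; first by rewrite f2.
  move=> g; case: k.1 f1 => [g' [g1 [-> ig _]] [<-] //|-> //].
exists (map f s); split.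
- by move=> k /mapP[k0 k0s ->]; apply: fS.
- apply: pact_Ablocks => -[k d] ks; have [/= d0 _] := vs _ ks; have [/= f2 f1] := fP _ ks.
  rewrite f2; case: k f1 ks {f2} => [g'|-> _]; last exact: pact_eps.
  by move=> [g [-> ig ag]] _; apply: pact_block.
- move=> d; rewrite count_map; apply: eq_in_count => -[k e] ks /=.
  have [/= f2 f1] := fP _ ks; rewrite [f _]surjective_pairing f2.
  by case: k f1 {ks f2} => [g' [g [-> _ _]]|->].
- move=> g g' d ig ag; rewrite count_map; apply: eq_in_count => -[k e] ks /=.
  have [/= f2 f1] := fP _ ks; rewrite [f _]surjective_pairing f2 !xpair_eqE; congr andb.
  case: k f1 {ks f2} => [h [g0 [-> ig0 ah]]|-> //]; apply/eqP/eqP => -[E].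
    by rewrite E in ah; rewrite (actP_fun ah ag).
  rewrite E in ah; congr Some; have [ig' _] := ag.
  exact: (actP_fun (actP_inv uQ ig0 ah) (actP_inv uQ ig ag)).
Qed.

Lemma act_rel_count (Q : 'M[F]_2) rho rho' s s' : Q \in unitmx ->
  (forall k d, count_mem (k, d) s = rho k d) -> (forall k, k \in s' -> valid_key k) ->
  (forall d, count_mem (None, d) s' = count_mem (None, d) s) ->
  (forall g g' d, inP g -> actP Q g g' -> count_mem (Some g, d) s' = count_mem (Some g', d) s) ->
  act_rel Q rho rho' <-> forall k d, rho' k d = count_mem (k, d) s'.
Proof.
move=> uQ rE vs' cN cS; split=> [[aN aS a0] [g|] d|r'E].
- have [ig|nig] := pselect (inP g); last first.
    by rewrite a0 //; apply/esym/count_memPn/negP => /vs'[_ /(_ g erefl)].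
  by have [g' ag] := actP_total uQ ig; rewrite (aS _ _ ig ag) (cS _ _ _ ig ag) rE.
- by rewrite aN cN rE.
split=> [d|g g' ig ag d|g d nig]; first by rewrite r'E cN rE.
  by rewrite r'E (cS _ _ _ ig ag) rE.
by rewrite r'E; apply/count_memPn/negP => /vs'[_ /(_ g erefl)].
Qed.

End Orbits.

Lemma det_rev_mx (R : comNzRingType) (A : 'M[R]_2) :
  \det (\matrix_(i, j) A (rev_ord i) (rev_ord j)) = \det A.
Proof.
have r0 : rev_ord 0 = 1 :> 'I_2 by apply: val_inj.
have r1 : rev_ord 1 = 0 :> 'I_2 by apply: val_inj.
by rewrite !det_mx22 !mxE !r0 !r1 mulrC [A 1 0 * _]mulrC.
Qed.

Theorem theorem3p6 (p : nat) (Hp : prime p) (Hodd : odd p)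
  (Rep : Fun 'F_p -> Prop) (HRep : orbit_reps Rep)
  (G : Grp) (HGnil : grp_nilpotent G) (HGch : chernikov_M2_elab p G) :
  exists rho, [/\ Rep rho, iso_Grho p rho G
    & forall rho', Rep rho' -> iso_Grho p rho' G -> rho' = rho].
Proof.
have F2 : (2%:R : 'F_p) != 0.
  rewrite -(dvdn_pcharf (pchar_Fp Hp)) dvdn_prime2 //.
  by apply: contraTneq Hodd => ->.
have r0 : rev_ord 0 = 1 :> 'I_2 by apply: val_inj.
have r1 : rev_ord 1 = 0 :> 'I_2 by apply: val_inj.
have [repF repO repU] := HRep.
have [M [phi [tau [mod skA skB]]]] := chernikov_model Hp Hodd HGnil HGch.
have [s [vs cs]] := kronecker F2 skA skB.
have [rho [Rrho [Q [uQ aQ]]]] := repO _ (inFtilde_count vs).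
have [s' [vs' ps' cN cS]] := act_Ablocks uQ vs.
have rE k d : count_mem (k, d) s' = rho k d.
  by apply/esym; apply: (act_rel_count _ uQ _ vs' cN cS).1 aQ k d.
have rhoG : iso_Grho p rho G.
  (* [pact] attaches [x2] to the first matrix and [x1] to the second, whereas [iso_GA_change]
     numbers the forms in order; reversing both indices of [Q] reconciles the two. *)
  exists s'; split => //; pose W : 'M_2 := \matrix_(i, j) Q (rev_ord i) (rev_ord j).
  have uW : W \in unitmx by rewrite unitmxE det_rev_mx -unitmxE.
  apply: (iso_GA_change Hp mod uW); rewrite !mxE !r0 !r1.
  exact: pcong_trans (pcong_comb _ _ _ _ cs) ps'.
exists rho; split => // rho' Rrho' [s2 [r2E iso2]].
have [s1 [r1E iso1]] := rhoG.
have v1 := valid_of_count (repF _ Rrho) r1E; have v2 := valid_of_count (repF _ Rrho') r2E.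
have [sk1 sk1'] := Ablocks_skew s1; have [sk2 sk2'] := Ablocks_skew s2.
have [W uW cW] := models_pcong Hp F2 iso1 iso2 sk1 sk1' sk2 sk2'.
pose R : 'M_2 := \matrix_(i, j) W (rev_ord i) (rev_ord j).
have uR : R \in unitmx by rewrite unitmxE det_rev_mx -unitmxE.
have [s3 [v3 p3 cN3 cS3]] := act_Ablocks uR v2.
(* The blocks of [s1] are congruent to the [W]-combination of those of [s2], which the relabelling
   turns into the blocks of [s3]; hence uniqueness compares [s1] with [s3]. *)
have E13 : forall k, count_mem k s1 = count_mem k s3.
  apply: kronecker_unique v1 v3 _; apply: pcong_trans cW _.
  by move: p3; rewrite /pact !mxE !r0 !r1.
apply: (repU _ _ Rrho' Rrho); exists R; split; first exact: uR.
by apply/(act_rel_count _ uR r2E v3 cN3 cS3) => k d; rewrite -E13 r1E.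
Qed.
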